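(* Let $s\geq t\geq 1$ or $s\geq 1\geq t\geq 0$, let $\Omega\subset\mathbb{R}^n$ be a bounded open set and $u\in\widetilde H^s(\Omega)$. Then $$\|(-\Delta)^{t/2}u\|_{L^2(\mathbb{R}^n)}\leq C^{s-t}\,\|(-\Delta)^{s/2}u\|_{L^2(\mathbb{R}^n)},$$ where $C=C(n,\Omega)$ is the classical Poincaré constant.
   Context: $\widetilde H^s(\Omega)$ is the closure of $C_c^\infty(\Omega)$ in the $L^2$ Sobolev space $H^s(\mathbb{R}^n)$. For $a\ge0$, $(-\Delta)^{a}u=\mathcal{F}^{-1}(|\cdot|^{2a}\hat u)$. The classical Poincaré constant is a constant $C=C(n,\Omega)>0$ such that $\|\varphi\|_{L^2(\Omega)}\le C\|\nabla\varphi\|_{L^2(\Omega)}$ for all $\varphi\in C_c^\infty(\Omega)$. *)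

(* Defs.v *)
From HB Require Import structures.
From mathcomp Require Import all_boot all_order all_algebra.
From mathcomp Require Import all_classical all_reals all_analysis.
From mathcomp Require Import complex.

Set Implicit Arguments.
Unset Strict Implicit.
Unset Printing Implicit Defensive.
Import Order.TTheory GRing.Theory Num.Theory.
Import numFieldNormedType.Exports.
Import ComplexField.Normc.

Local Open Scope classical_set_scope.
Local Open Scope ring_scope.
Local Open Scope complex_scope.

(* The sigma-algebra on R^n generated by the coordinates (the Borel one).    *)
Section measurable_rV.
Variables (R : realType) (n : nat).

Let coords : 'I_n -> 'rV[R]_n -> measurableTypeR R := fun i v => v ord0 i.

Let rV_set0 : g_sigma_preimage coords set0.
Proof. exact: sigma_algebra0. Qed.

Let rV_setC A : g_sigma_preimage coords A -> g_sigma_preimage coords (~` A).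
Proof. exact: sigma_algebraC. Qed.

Let rV_bigcup (F : (set 'rV[R]_n)^nat) :
  (forall i, g_sigma_preimage coords (F i)) ->
  g_sigma_preimage coords (\bigcup_i (F i)).
Proof. exact: sigma_algebra_bigcup. Qed.

HB.instance Definition _ := @isMeasurable.Build default_measure_display
  'rV[R]_n (g_sigma_preimage coords) rV_set0 rV_setC rV_bigcup.

Lemma measurable_coord (i : 'I_n) :
  measurable_fun [set: 'rV[R]_n] (fun v : 'rV[R]_n => v ord0 i : measurableTypeR R).
Proof.
move=> _ Y mY; rewrite setTI; apply: sub_sigma_algebra => /=.
rewrite -bigcup_seq/=; exists i => /=; first by rewrite mem_index_enum.
by exists Y => //; rewrite setTI.
Qed.

Lemma measurable_fun_rV d (T : measurableType d) (f : T -> 'rV[R]_n) :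
  (forall i, measurable_fun [set: T] (fun x => f x ord0 i : measurableTypeR R)) ->
  measurable_fun [set: T] f.
Proof.
move=> mf; have sub : g_sigma_preimage coords `<=`
    [set A | measurable (f @^-1` A)].
  apply: smallest_sub.
    split => /=.
    - by rewrite preimage_set0.
    - by move=> A mA; rewrite setTD preimage_setC; exact: measurableC.
    - by move=> F mF; rewrite preimage_bigcup; exact: bigcup_measurable.
  rewrite -bigcup_seq/=; apply: bigcup_sub => i _ _ [B mB <-] /=.
  rewrite setTI -comp_preimage -[X in measurable X]setTI.
  exact: mf.
by move=> _ A mA; rewrite setTI; exact: sub.
Qed.

End measurable_rV.

(* n-dimensional Lebesgue measure, by induction on n: R^(n+1) = R^n x R.     *)
Definition row_rcons (R : realType) (n : nat)
    (p : 'rV[R]_n * measurableTypeR R) : 'rV[R]_n.+1 :=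
  \row_i (if unlift ord_max i is Some j then p.1 ord0 j else p.2).

Lemma measurable_row_rcons (R : realType) (n : nat) :
  measurable_fun [set: 'rV[R]_n * measurableTypeR R] (@row_rcons R n).
Proof.
apply: measurable_fun_rV => i.
under eq_fun do rewrite mxE.
case: unliftP => [j _|_]; last exact: measurable_snd.
by apply: (measurableT_comp (measurable_coord j)); exact: measurable_fst.
Qed.

Section lebesgue_rV_step.
Variables (R : realType) (n : nat) (m : {measure set 'rV[R]_n -> \bar R}).

Definition lebesgue_rV_step : set 'rV[R]_n.+1 -> \bar R :=
  pushforward (m \x @lebesgue_measure R)%E (@row_rcons R n).

Let step0 : lebesgue_rV_step set0 = 0%E.
Proof. by rewrite /lebesgue_rV_step /pushforward preimage_set0 measure0. Qed.

Let step_ge0 A : (0 <= lebesgue_rV_step A)%E.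
Proof. by rewrite /lebesgue_rV_step /pushforward measure_ge0. Qed.

Let step_sigma_additive : semi_sigma_additive lebesgue_rV_step.
Proof.
move=> F mF tF mUF; rewrite /lebesgue_rV_step /pushforward preimage_bigcup.
have mp A : measurable A -> measurable (@row_rcons R n @^-1` A).
  by move=> mA; rewrite -[X in measurable X]setTI; exact: measurable_row_rcons.
apply: measure_semi_sigma_additive.
- by move=> k; exact: mp.
- apply/trivIsetP => /= i j _ _ ij; rewrite -preimage_setI.
  by move/trivIsetP : tF => /(_ _ _ _ _ ij) ->//; rewrite preimage_set0.
- by rewrite -preimage_bigcup; exact: mp.
Qed.

HB.instance Definition _ := isMeasure.Build _ _ _
  lebesgue_rV_step step0 step_ge0 step_sigma_additive.

End lebesgue_rV_step.

Fixpoint lebesgue_rV (R : realType) (n : nat) :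
    {measure set 'rV[R]_n -> \bar R} :=
  match n with
  | 0 => \d_(0 : 'rV[R]_0)
  | k.+1 => lebesgue_rV_step (lebesgue_rV R k)
  end.

Lemma lebesgue_rV_box (R : realType) (n : nat) (A : 'I_n -> set R) :
  (forall i, measurable (A i)) ->
  lebesgue_rV R n [set v | forall i, A i (v ord0 i)] =
  (\prod_(i < n) lebesgue_measure (A i))%E.
Proof.
elim: n A => [|n IH] A mA.
  by rewrite big_ord0 /= diracE mem_set//= => -[].
rewrite big_ord_recr /= -IH//.
pose B := [set v : 'rV[R]_n |
  forall i, A (widen_ord (leqnSn n) i) (v ord0 i)].
have mB : measurable B.
  rewrite [X in measurable X](_ : _ = \bigcap_(i in [set: 'I_n])
      ((fun v : 'rV[R]_n => v ord0 i) @^-1` A (widen_ord (leqnSn n) i))).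
    apply: fin_bigcap_measurable; first exact: finite_finset.
    move=> i _; rewrite -[X in measurable X]setTI.
    by apply: (measurable_coord i) => //; exact: mA.
  apply/seteqP; split => v Bv i; first by move=> _; exact: (Bv i).
  exact: (Bv i I).
rewrite -/B -product_measure1E//; last exact: mA.
rewrite /lebesgue_rV_step /pushforward.
congr (_ _); apply/seteqP; split => -[v x] /=.
  move=> Avx; split => [i|]; last first.
    by have := Avx ord_max; rewrite mxE unlift_none.
  have := Avx (widen_ord (leqnSn n) i); rewrite mxE.
  have -> : widen_ord (leqnSn n) i = lift ord_max i.
    by apply/val_inj; rewrite /= /bump leqNgt ltn_ord.
  by rewrite liftK.
move=> [Bv Ax] i; rewrite mxE; case: unliftP => [j ->|->//].
have -> : lift ord_max j = widen_ord (leqnSn n) j.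
  by apply/val_inj; rewrite /= /bump leqNgt ltn_ord.
exact: Bv.
Qed.

(* The standard scalar product and Euclidean norm of R^n; the library norm   *)
(* `|x| on 'rV[R]_n is the sup norm, which is only used for the topology and *)
(* for boundedness.                                                          *)
Definition dotp (R : realType) (n : nat) (x y : 'rV[R]_n) : R :=
  \sum_(i < n) x ord0 i * y ord0 i.

Definition enorm (R : realType) (n : nat) (x : 'rV[R]_n) : R :=
  Num.sqrt (dotp x x).

Section complex_Lp.
Variables (R : realType) (n : nat).
Implicit Types (f g : 'rV[R]_n -> R[i]).

Definition cLfun (p : R) : set ('rV[R]_n -> R[i]) :=
  fun f => (fun x => complex.Re (f x)) \in Lfun (lebesgue_rV R n) p%:E /\
           (fun x => complex.Im (f x)) \in Lfun (lebesgue_rV R n) p%:E.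

Definition cintegral f : R[i] :=
  (\int[lebesgue_rV R n]_x complex.Re (f x)) +i*
  (\int[lebesgue_rV R n]_x complex.Im (f x)).

Definition L2norm f : \bar R :=
  ('N[lebesgue_rV R n]_2%:E[EFin \o (fun x => normc (f x))])%E.

(* The norm of L^2(D), for a real-valued function.                           *)
Definition L2norm_on (D : set 'rV[R]_n) (h : 'rV[R]_n -> R) : \bar R :=
  ('N[lebesgue_rV R n]_2%:E[EFin \o (h \_ D)])%E.

End complex_Lp.

Section fourier.
Variables (R : realType) (n : nat).
Implicit Types (f g u v : 'rV[R]_n -> R[i]).

Definition cis (theta : R) : R[i] := cos theta +i* sin theta.

(* With this normalisation |xi|^2 is the symbol of the Laplacian -Delta.     *)
Definition fourier_integral f : 'rV[R]_n -> R[i] := fun xi =>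
  cintegral (fun x => cis (- dotp x xi) * f x).

Definition inv_fourier_integral g : 'rV[R]_n -> R[i] := fun x =>
  (((2 * pi) ^- n)%:C) * cintegral (fun xi => cis (dotp x xi) * g xi).

(* [L2_extension T u v]: v is a value at u of the extension by continuity to *)
(* L^2 of the operator T, given on the dense subspace L^1 /\ L^2.            *)
Definition L2_extension (T : ('rV[R]_n -> R[i]) -> 'rV[R]_n -> R[i]) u v :=
  [/\ cLfun 2 u, cLfun 2 v &
  exists f_ : nat -> 'rV[R]_n -> R[i],
    [/\ forall k, cLfun 1 (f_ k) /\ cLfun 2 (f_ k),
        (fun k => L2norm (fun x => f_ k x - u x)) @ \oo --> 0%E &
        (fun k => L2norm (fun x => T (f_ k) x - v x)) @ \oo --> 0%E]].

(* The Fourier-Plancherel transform and its inverse. By Plancherel's theorem *)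
(* the chosen function exists and is unique up to a null set for every u in  *)
(* L^2; outside L^2 the value is the junk function 0.                        *)
Definition fourier u : 'rV[R]_n -> R[i] :=
  xget (fun=> 0) [set v | L2_extension fourier_integral u v].

Definition inv_fourier u : 'rV[R]_n -> R[i] :=
  xget (fun=> 0) [set v | L2_extension inv_fourier_integral u v].

Definition frac_laplacian (a : R) u : 'rV[R]_n -> R[i] :=
  inv_fourier (fun xi => (enorm xi `^ (2 * a))%:C * fourier u xi).

End fourier.

Section sobolev.
Variables (R : realType) (n : nat).
Implicit Types (u phi : 'rV[R]_n -> R[i]) (Omega : set 'rV[R]_n).

Definition partial (i : 'I_n) (h : 'rV[R]_n -> R) : 'rV[R]_n -> R :=
  fun x => 'D_(delta_mx ord0 i) h x.

Fixpoint Ck (k : nat) (h : 'rV[R]_n -> R) : Prop :=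
  match k with
  | 0 => continuous h
  | k'.+1 => continuous h /\
      forall i : 'I_n, (forall x, derivable h x (delta_mx ord0 i)) /\
                       Ck k' (partial i h)
  end.

Definition smooth (h : 'rV[R]_n -> R) := forall k, Ck k h.

(* C_c^oo(Omega), its elements being extended by 0 to the whole space.       *)
Definition test_function Omega : set ('rV[R]_n -> R[i]) :=
  fun phi => [/\ smooth (fun x => complex.Re (phi x)),
                 smooth (fun x => complex.Im (phi x)),
                 compact (closure [set x | phi x != 0]) &
                 closure [set x | phi x != 0] `<=` Omega].

Definition grad_norm phi : 'rV[R]_n -> R := fun x =>
  Num.sqrt (\sum_(i < n) (partial i (fun x => complex.Re (phi x)) x ^+ 2 +
                          partial i (fun x => complex.Im (phi x)) x ^+ 2)).

Definition poincare_constant Omega (C : R) :=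
  0 < C /\
  forall phi, test_function Omega phi ->
    (L2norm_on Omega (fun x => normc (phi x)) <=
       C%:E * L2norm_on Omega (grad_norm phi))%E.

Definition bessel_weighted (s : R) u : 'rV[R]_n -> R[i] := fun xi =>
  ((1 + enorm xi ^+ 2) `^ (s / 2))%:C * fourier u xi.

Definition sobolev_norm (s : R) u : \bar R := L2norm (bessel_weighted s u).

(* The space H^s(R^n), for s >= 0, as a subspace of L^2(R^n), whose elements *)
(* are handled through (Borel measurable) representatives.                   *)
Definition sobolev (s : R) : set ('rV[R]_n -> R[i]) :=
  fun u => cLfun 2 u /\ cLfun 2 (bessel_weighted s u).

(* The closure of C_c^oo(Omega) in H^s(R^n).                                 *)
Definition sobolev_tilde (s : R) Omega : set ('rV[R]_n -> R[i]) :=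
  fun u => sobolev s u /\
    forall e : R, 0 < e -> exists2 phi, test_function Omega phi &
      (sobolev_norm s (fun x => (u x - phi x)%R) < e%:E)%E.

End sobolev.

(* Main.v *)
From HB Require Import structures.
Require Import Defs.
From mathcomp Require Import all_boot all_order all_algebra.
From mathcomp Require Import all_classical all_reals all_analysis.
Import Order.TTheory GRing.Theory Num.Theory.
Import numFieldNormedType.Exports.
From mathcomp Require Import measurable_realfun complex.
From mathcomp Require Import ring lra.
Import ComplexField.Normc.

(** Write U for the Fourier transform of u. Up to one and the same constant, the
    two sides of the theorem are the L^2 norms of |xi|^t U and |xi|^s U, by
    Plancherel's theorem. The claim is thus a weighted inequality for the single
    function U, and the only information about Omega is Poincare's inequality,
    which on the Fourier side reads ||U|| <= C || |xi| U ||.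

    The passage from orders 0, 1 to orders t, s is a pointwise convexity
    inequality: for X >= 0, 1 <= s and 0 <= t <= s,
      X^t + (s - t) X <= X^s + (s - t)                           [powR_tangent].
    At X = (C |xi|)^2, integrated against |U|^2, it becomes
      C^(2t) || |xi|^t U ||^2 + (s - t) C^2 || |xi| U ||^2
        <= C^(2s) || |xi|^s U ||^2 + (s - t) ||U||^2,
    and by Poincare's inequality the terms with the factor s - t can be
    cancelled [riesz_interpolation]. In both cases of the theorem 1 <= s and
    0 <= t <= s.

    The rest is Fourier analysis. Plancherel's theorem is obtained by damping:
    for integrable f, Fubini's theorem turns the integral of
    exp (- e sum_i |xi_i|) |f^(xi)|^2 into the quadratic form of f with the
    kernel prod_i 2 e / (e^2 + (x_i - y_i)^2), a product of Poisson kernels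
    [damped_energy]. This kernel has mass (2 pi)^n, so Schur's test and Fatou's
    lemma give the upper bound for all f in both L^1 and L^2 [plancherel_le].
    The kernels form an approximate identity, so for bounded continuous f
    dominated convergence gives the opposite bound [plancherel_ge]. The upper
    bound makes the values of the extensions to L^2 unique up to null sets and,
    with the completeness of L^2, produces such values; the lower bound passes
    to those functions that are limits in L^2 of continuous functions with
    compact support [inv_fourier_ge]. The function |xi|^s U is such a limit:
    approximate u by test functions, and multiply their transforms by |xi|^s
    and by a cutoff [riesz_ccc_approx].

    Poincare's inequality is transported in the same spirit: the transform of
    the j-th partial derivative of a test function phi is i xi_j times that of
    phi, so that Plancherel's theorem gives the weighted inequality for phi
    [poincare_fourier], and the definition of the space as a closure gives it
    for U [poincare_sobolev]. *)

Set Implicit Arguments.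
Unset Strict Implicit.
Unset Printing Implicit Defensive.
Local Open Scope classical_set_scope.
Local Open Scope ring_scope.

(** * Lebesgue measure on R^n *)

Section euclidean_measure.
Variable R : realType.
Local Notation leb := (@lebesgue_measure R).

(** The set function underlying [lebesgue_rV], under a name of its own that can
    carry the sigma-finite structure on which Fubini's theorem relies. *)
Definition lebR (n : nat) : set 'rV[R]_n -> \bar R := lebesgue_rV R n.

HB.instance Definition _ n := Measure.on (@lebR n).

Definition cube n (M : R) := [set v : 'rV[R]_n | forall i, `|v ord0 i| <= M].

Lemma cube_box n M :
  @cube n M = [set v | forall i, `[- M, M]%classic (v ord0 i)].
Proof.
by apply/seteqP; split => v /= + i => /(_ i); rewrite in_itv/= ler_norml.
Qed.

Lemma measurable_cube n M : measurable (@cube n M).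
Proof.
rewrite cube_box [X in measurable X](_ : _ = \bigcap_(i in [set: 'I_n])
    ((fun v : 'rV[R]_n => v ord0 i) @^-1` `[- M, M]%classic)).
  apply: fin_bigcap_measurable; first exact: finite_finset.
  move=> i _; rewrite -[X in measurable X]setTI.
  exact: (measurable_coord i).
by apply/seteqP; split => v Bv i; [move=> _|]; exact: Bv.
Qed.

Lemma cube_finite n M : (@lebR n (@cube n M) < +oo)%E.
Proof.
rewrite cube_box.
have /= -> := @lebesgue_rV_box R n (fun=> `[- M, M]%classic)
  (fun=> measurable_itv _).
rewrite -ge0_fin_numE; last by apply: prode_ge0 => i _.
apply: prode_fin_num => i _.
by rewrite lebesgue_measure_itv; case: ifP.
Qed.

Lemma bigcup_cube n : \bigcup_k (@cube n k%:R) = [set: 'rV[R]_n].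
Proof.
apply/seteqP; split => v // _.
exists (Num.trunc (\sum_(i < n) `|v ord0 i|)).+1 => //= i.
apply: le_trans (ltW (truncnS_gt _)).
by rewrite (bigD1 i)//= lerDl sumr_ge0.
Qed.

(** R^n is the union of the cubes [-k, k]^n, whose measures are products of
    lengths of intervals. *)
Lemma lebR_sigma_finite n : sigma_finite [set: 'rV[R]_n] (@lebR n).
Proof.
exists (fun k => @cube n k%:R); first by rewrite bigcup_cube.
by move=> k; split; [exact: measurable_cube|exact: cube_finite].
Qed.

HB.instance Definition _ n :=
  Measure_isSigmaFinite.Build _ _ _ (@lebR n) (@lebR_sigma_finite n).

(** The measure of R^(n+1) is by definition the image of a product measure; the
    theorems of Tonelli and Fubini therefore give every integral over R^(n+1) as
    an iterated one. *)
Lemma lebRS n : @lebR n.+1 = pushforward (@lebR n \x leb)%E (@row_rcons R n).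
Proof. by []. Qed.

Lemma ge0_integral_rVS n (f : 'rV[R]_n.+1 -> \bar R) :
  measurable_fun [set: 'rV[R]_n.+1] f -> (forall x, 0 <= f x)%E ->
  (\int[@lebR n.+1]_x f x = \int[@lebR n]_v \int[leb]_t f (row_rcons (v, t)))%E.
Proof.
move=> mf f0; rewrite lebRS ge0_integral_pushforward//; last first.
  exact: measurable_row_rcons.
rewrite preimage_setT fubini_tonelli1//; last by move=> x; exact: f0.
by apply: (measurableT_comp mf); exact: measurable_row_rcons.
Qed.

Lemma integrable_row_rcons n (f : 'rV[R]_n.+1 -> \bar R) :
  (@lebR n.+1).-integrable setT f ->
  (@lebR n \x leb)%E.-integrable setT (f \o @row_rcons R n).
Proof.
move=> /integrableP[mf fi]; apply/integrableP; split.
  apply: (measurableT_comp mf); exact: measurable_row_rcons.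
move: fi; rewrite lebRS ge0_integral_pushforward//.
exact: measurable_row_rcons.
exact: measurableT_comp.
Qed.

Lemma integral_rVS n (f : 'rV[R]_n.+1 -> \bar R) :
  (@lebR n.+1).-integrable setT f ->
  (\int[@lebR n.+1]_x f x = \int[@lebR n]_v \int[leb]_t f (row_rcons (v, t)))%E.
Proof.
move=> fi; rewrite lebRS integral_pushforward//.
- rewrite preimage_setT -integral12_prod_meas1//; exact: integrable_row_rcons.
- exact: measurable_row_rcons.
- by case/integrableP: fi.
- by rewrite preimage_setT; exact: integrable_row_rcons.
Qed.

Lemma integral_rVS_swap n (f : 'rV[R]_n.+1 -> \bar R) :
  (@lebR n.+1).-integrable setT f ->
  (\int[@lebR n.+1]_x f x = \int[leb]_t \int[@lebR n]_v f (row_rcons (v, t)))%E.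
Proof.
move=> fi; rewrite lebRS integral_pushforward//.
- rewrite preimage_setT -integral21_prod_meas1//; exact: integrable_row_rcons.
- exact: measurable_row_rcons.
- by case/integrableP: fi.
- by rewrite preimage_setT; exact: integrable_row_rcons.
Qed.

(** Both sides are measures, and they agree on half-open intervals; Lebesgue
    measure is the only measure with these values. *)
Lemma leb_affine (e x : R) (A : set R) : 0 < e -> measurable A ->
  leb A = (e%:E *
    pushforward leb (fun t : R => (x - e * t)%R : measurableTypeR R) A)%E.
Proof.
move=> e0 mA.
have mf : measurable_fun [set: R] ((fun t : R => (x - e * t)%R : measurableTypeR R)).
  by apply: measurable_funB => //; apply: measurable_funM.
have e0' : 0 <= e by exact: ltW.
pose nu := mscale (NngNum e0')
  (pushforward leb (fun t : R => (x - e * t)%R : measurableTypeR R)).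
rewrite -[RHS]/(nu mf A).
apply: lebesgue_measure_unique => //= _ [[a b]] _ <-.
rewrite /nu /mscale/= /pushforward.
have -> : (fun t : R => x - e * t) @^-1` [set` Interval (BRight a) (BRight b)] =
    `[(x - b) / e, (x - a) / e[%classic.
  apply/seteqP; split => t /=; rewrite !in_itv/= ler_pdivrMr// ltr_pdivlMr//;
    move=> /andP[? ?]; apply/andP; split; lra.
rewrite !lebesgue_measure_itv/= !lte_fin ltr_pM2r ?invr_gt0// ltrD2l ltrN2.
case: ifPn => ab; last by rewrite mule0.
by rewrite -EFinB -EFinM; congr EFin; field; rewrite gt_eqF.
Qed.

Lemma ge0_integral_affine1 (e x : R) (f : R -> \bar R) : 0 < e ->
  measurable_fun [set: R] f -> (forall y, 0 <= f y)%E ->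
  (\int[leb]_y f y = \int[leb]_t (e%:E * f (x - e * t)%R))%E.
Proof.
move=> e0 mf f0.
have e0' : 0 <= e by exact: ltW.
have mh : measurable_fun [set: R] (fun t : R => x - e * t : measurableTypeR R).
  by apply: measurable_funB => //; apply: measurable_funM.
pose nu := mscale (NngNum e0')
  (pushforward leb (fun t : R => (x - e * t)%R : measurableTypeR R)).
transitivity (\int[nu mh]_y f y)%E.
  by apply: eq_measure_integral => A mA _; rewrite /nu/= (leb_affine x e0).
rewrite /nu ge0_integral_mscale//= ge0_integral_pushforward// preimage_setT.
by rewrite ge0_integralZl//; exact: measurableT_comp.
Qed.

Definition rV_init n (x : 'rV[R]_n.+1) : 'rV[R]_n :=
  \row_j x ord0 (lift ord_max j).

Lemma row_rconsE n (v : 'rV[R]_n) (t : R) :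
  (forall j, row_rcons (v, t) ord0 (lift ord_max j) = v ord0 j) *
  (row_rcons (v, t) ord0 ord_max = t).
Proof.
by split => [j|]; rewrite /row_rcons mxE ?liftK ?unlift_none.
Qed.

Lemma rV_initK n (x : 'rV[R]_n.+1) : row_rcons (rV_init x, x ord0 ord_max) = x.
Proof.
apply/rowP => i; case: (unliftP ord_max i) => [j ->|->];
  by rewrite !row_rconsE ?mxE.
Qed.

Lemma widen_ord_lift n (i : 'I_n) : widen_ord (leqnSn n) i = lift ord_max i.
Proof. by apply/val_inj; rewrite /= /bump leqNgt ltn_ord. Qed.

Lemma measurable_affine n (e : R) (x : 'rV[R]_n) :
  measurable_fun [set: 'rV[R]_n] (fun y => x - e *: y).
Proof.
apply: measurable_fun_rV => i.
under eq_fun do rewrite !mxE.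
apply: measurable_funB => //; apply: measurable_funM => //.
exact: measurable_coord.
Qed.

Lemma measurable_rVB d (T : measurableType d) n (f g : T -> 'rV[R]_n) :
  measurable_fun setT f -> measurable_fun setT g ->
  measurable_fun setT (fun x => f x - g x).
Proof.
move=> mf mg; apply: measurable_fun_rV => i.
under eq_fun do rewrite !mxE.
apply: measurable_funB; last exact: (measurableT_comp (measurable_coord i) mg).
exact: (measurableT_comp (measurable_coord i) mf).
Qed.

(** Induction on the dimension: Tonelli's theorem isolates the last coordinate,
    to which the one-dimensional substitution applies. *)
Lemma ge0_integral_affine n (e : R) (x : 'rV[R]_n) (f : 'rV[R]_n -> \bar R) :
  0 < e -> measurable_fun [set: 'rV[R]_n] f -> (forall y, 0 <= f y)%E ->
  (\int[@lebR n]_y f y = \int[@lebR n]_y ((e ^+ n)%:E * f (x - e *: y)%R))%E.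
Proof.
move=> e0; elim: n x f => [|n IH] x f mf f0.
  apply: eq_integral => y _; rewrite expr0 mul1e; congr f.
  by apply/rowP => -[].
have mr := @measurable_row_rcons R n.
have en0 k : (0 <= (e ^+ k)%:E)%E by rewrite lee_fin exprn_ge0// ltW.
have e0' : (0 <= e%:E)%E by rewrite lee_fin ltW.
have maff : measurable_fun [set: R] (fun t : R => x ord0 ord_max - e * t).
  by apply: measurable_funB => //; apply: measurable_funM.
pose h (p : 'rV[R]_n * measurableTypeR R) :=
  (e%:E * f (row_rcons (p.1, (x ord0 ord_max - e * p.2)%R)))%E.
have h0 p : (0 <= h p)%E by rewrite mule_ge0.
have mh : measurable_fun setT h.
  apply: emeasurable_funM => //; apply: (measurableT_comp mf).
  apply: measurable_fun_rV => i; under eq_fun do rewrite mxE.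
  case: unliftP => [j _|_].
    by apply: (measurableT_comp (measurable_coord j)); exact: measurable_fst.
  by apply: (measurableT_comp maff); exact: measurable_snd.
rewrite ge0_integral_rVS// [RHS]ge0_integral_rVS; last 2 first.
- apply: emeasurable_funM => //; apply: (measurableT_comp mf).
  exact: measurable_affine.
- by move=> y; rewrite mule_ge0.
transitivity (\int[@lebR n]_v (fubini_F leb h v))%E.
  apply: eq_integral => v _; rewrite /fubini_F.
  rewrite (@ge0_integral_affine1 e (x ord0 ord_max))//.
  by apply: (measurableT_comp mf); apply: (measurableT_comp mr).
rewrite (IH (rV_init x))//; last 2 first.
- exact: measurable_fun_fubini_tonelli_F.
- by move=> y; exact: integral_ge0.
apply: eq_integral => v _; rewrite /fubini_F -ge0_integralZl//; last first.
  by apply: (measurableT_comp mh).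
apply: eq_integral => t _; rewrite /h/= muleA -EFinM -exprSr; congr (_ * f _)%E.
apply/rowP => i; case: (unliftP ord_max i) => [j ->|->].
  by rewrite row_rconsE !mxE liftK.
by rewrite row_rconsE !mxE unlift_none.
Qed.

Definition prodf (h : R -> R) n (x : 'rV[R]_n) := \prod_(i < n) h (x ord0 i).

Lemma prodfS h n (v : 'rV[R]_n) (t : R) :
  prodf h (row_rcons (v, t)) = prodf h v * h t.
Proof.
rewrite /prodf big_ord_recr/= row_rconsE; congr (_ * _).
by apply: eq_bigr => i _; rewrite widen_ord_lift row_rconsE.
Qed.

Lemma measurable_prodf (h : R -> R) n : measurable_fun [set: R] h ->
  measurable_fun [set: 'rV[R]_n] (@prodf h n).
Proof.
move=> mh; apply: measurable_prod => i _.
by apply: (measurableT_comp mh); exact: measurable_coord.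
Qed.

Lemma prodf_ge0 h n (x : 'rV[R]_n) : (forall t, 0 <= h t) -> 0 <= prodf h x.
Proof. by move=> h0; exact: prodr_ge0. Qed.

Lemma integral_prodf (h : R -> R) n (c : R) :
  measurable_fun [set: R] h -> (forall t, 0 <= h t) ->
  (\int[leb]_t (h t)%:E = c%:E)%E ->
  (\int[@lebR n]_x (prodf h x)%:E = (c ^+ n)%:E)%E.
Proof.
move=> mh h0 hc; elim: n => [|n IH].
  rewrite /lebR/= integral_dirac//; last first.
    by apply/measurable_EFinP; exact: measurable_prodf.
  by rewrite /prodf big_ord0 expr0 mule1 diracE mem_set.
rewrite ge0_integral_rVS; last 2 first.
- by apply/measurable_EFinP; exact: measurable_prodf.
- by move=> x; rewrite lee_fin prodf_ge0.
under eq_integral => v _.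
  under eq_integral => t _ do rewrite prodfS EFinM.
  rewrite ge0_integralZl//; last 3 first.
  - exact/measurable_EFinP.
  - by move=> t _; rewrite lee_fin.
  - by rewrite lee_fin prodf_ge0.
  rewrite hc; over.
rewrite ge0_integralZr//; last 3 first.
- by apply/measurable_EFinP; exact: measurable_prodf.
- by move=> t _; rewrite lee_fin prodf_ge0.
- by rewrite -hc integral_ge0// => t _; rewrite lee_fin.
by rewrite IH -EFinM exprSr.
Qed.

Lemma Rintegral_rVS n (f : 'rV[R]_n.+1 -> R) :
  (@lebR n.+1).-integrable setT (EFin \o f) ->
  (forall v, leb.-integrable setT (fun t => (f (row_rcons (v, t)))%:E)) ->
  (\int[@lebR n.+1]_x f x)%R = \int[@lebR n]_v \int[leb]_t f (row_rcons (v, t)).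
Proof.
move=> fi fs; rewrite /Rintegral integral_rVS//; congr fine.
by apply: eq_integral => v _ /=; rewrite fineK//; exact: integrable_fin_num.
Qed.

Lemma dotpS n (x : 'rV[R]_n.+1) (v : 'rV[R]_n) (t : R) :
  dotp x (row_rcons (v, t)) = dotp (rV_init x) v + x ord0 ord_max * t.
Proof.
rewrite /dotp big_ord_recr/= row_rconsE; congr (_ + _).
by apply: eq_bigr => i _; rewrite widen_ord_lift row_rconsE !mxE.
Qed.

Lemma dotpC n (x y : 'rV[R]_n) : dotp x y = dotp y x.
Proof. by apply: eq_bigr => i _; rewrite mulrC. Qed.

Lemma measurable_dotp d (T : measurableType d) n (f g : T -> 'rV[R]_n) :
  measurable_fun setT f -> measurable_fun setT g ->
  measurable_fun setT (fun x => dotp (f x) (g x)).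
Proof.
move=> mf mg; apply: measurable_sum => i; apply: measurable_funM.
  by apply: (measurableT_comp (measurable_coord i)).
by apply: (measurableT_comp (measurable_coord i)).
Qed.

End euclidean_measure.

(** * One-dimensional integrals *)

Section one_dim.
Variable R : realType.
Local Notation leb := (@lebesgue_measure R).

Lemma measurable_cosf d (T : measurableType d) (f : T -> R) :
  measurable_fun setT f -> measurable_fun setT (fun x => cos (f x)).
Proof.
exact: (measurableT_comp (continuous_measurable_fun (@continuous_cos R))).
Qed.

Lemma measurable_sinf d (T : measurableType d) (f : T -> R) :
  measurable_fun setT f -> measurable_fun setT (fun x => sin (f x)).
Proof.
exact: (measurableT_comp (continuous_measurable_fun (@continuous_sin R))).
Qed.

(** Adding the contributions of t and -t leaves an integral over a half-line,
    where a primitive and its limit at infinity give the value. *)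
Lemma ge0_integral_fold (f : R -> \bar R) :
  measurable_fun [set: R] f -> (forall y, 0 <= f y)%E ->
  (\int[leb]_t f t = \int[leb]_(t in `[0%R, +oo[) (f t + f (- t)%R))%E.
Proof.
move=> mf f0.
have mN : measurable_fun [set: R] (fun t => f (- t)%R).
  by apply: (measurableT_comp mf).
rewrite -(itv_setU_setT true (0 : R)) ge0_integral_setU//=; last 2 first.
- exact: measurable_funTS.
- apply/disj_setPS => y /= []; rewrite !in_itv/= andbT => y0 /(lt_le_trans y0).
  by rewrite ltxx.
rewrite ge0_integralD//; last 2 first.
- exact: measurable_funTS.
- exact: measurable_funTS.
rewrite addeC; congr (_ + _)%E.
rewrite (ge0_integration_by_substitution0 mN)//.
under [RHS]eq_integral do rewrite opprK.
rewrite -integral_itv_bndo_bndc//.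
exact: measurable_funTS.
Qed.

Lemma ge0_FTC0y (f F : R -> R) (l : R) :
  (forall t : R, is_derive t 1 F (f t)) -> (forall t, 0 <= f t) ->
  continuous f -> F t @[t --> +oo] --> l ->
  (\int[leb]_(t in `[0%R, +oo[) (f t)%:E = (l - F 0)%:E)%E.
Proof.
move=> dF f0 cf Fl; rewrite (@ge0_continuous_FTC2y _ f F 0 l)//.
- exact: continuous_subspaceT.
- apply: cvg_at_right_filter.
  apply: differentiable_continuous; apply/derivable1_diffP.
  by apply: ex_derive; exact: dF.
- by move=> x _; rewrite derive1E; apply: derive_val; exact: dF.
Qed.

(** The damping factor that makes a bounded function integrable. It is
    exponential and not Gaussian because its transforms then have elementary
    primitives. *)
Definition dexp (e t : R) := expR (- (e * `|t|)).

Lemma dexp_ge0 e t : 0 <= dexp e t. Proof. exact: expR_ge0. Qed.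

Lemma measurable_dexp e : measurable_fun [set: R] (dexp e).
Proof.
apply: (measurableT_comp (@measurable_expR R)).
by apply: measurableT_comp => //; apply: measurable_funM => //.
Qed.

Lemma cvg_expRN (e : R) : 0 < e -> expR (- (e * t)) @[t --> +oo] --> (0 : R).
Proof.
move=> e0.
have -> : (fun t => expR (- (e * t))) = (fun y => expR (- y)) \o (fun t => e * t) by [].
apply: (@cvg_comp _ _ _ _ _ _ +oo); last exact: cvgr_expR.
apply/cvgryPge => A; near=> t; rewrite mulrC -(ler_pdivrMr _ _ e0).
by near: t; apply: nbhs_pinfty_ge; rewrite num_real.
Unshelve. all: by end_near. Qed.

Lemma integral_dexp (e : R) : 0 < e ->
  (\int[leb]_t (dexp e t)%:E = (2 / e)%:E)%E.
Proof.
move=> e0; rewrite ge0_integral_fold; last 2 first.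
- by apply/measurable_EFinP; exact: measurable_dexp.
- by move=> y; rewrite lee_fin dexp_ge0.
transitivity (\int[leb]_(t in `[0%R, +oo[) (2 * expR (- (e * t)))%:E)%E.
  apply: eq_integral => t; rewrite inE/= in_itv/= andbT => t0.
  by rewrite -EFinD /dexp normrN ger0_norm// mulr_natl.
have dF (t : R) : is_derive t 1 (fun t => - (2 / e) * expR (- (e * t)))
    (2 * expR (- (e * t))).
  by apply: is_derive_eq; rewrite /GRing.scale/=; field; rewrite gt_eqF.
rewrite (@ge0_FTC0y _ _ 0 dF).
- by rewrite mulr0 oppr0 expR0 mulr1 sub0r opprK.
- by move=> t; rewrite mulr_ge0// expR_ge0.
- move=> t; apply: cvgM; first exact: cvg_cst.
  apply: continuous_comp; last exact: continuous_expR.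
  by apply: cvgN; apply: cvgM; [exact: cvg_cst|exact: cvg_id].
- rewrite -[X in _ --> X](mulr0 (- (2 / e))).
  by apply: cvgM; [exact: cvg_cst|exact: cvg_expRN].
Qed.

(** The summand 1 makes the integrand nonnegative: the extended integral is then
    given by the limit of a primitive, without proving integrability first. *)
Lemma integral_dexp_cos1 (e x : R) : 0 < e ->
  (\int[leb]_t (dexp e t * (1 + cos (x * t)))%:E =
   (2 / e + 2 * e / (e ^+ 2 + x ^+ 2))%:E)%E.
Proof.
move=> e0; have c1 y : 0 <= 1 + cos y :> R.
  by rewrite addrC -lerBlDr sub0r cos_geN1.
have mc : measurable_fun [set: R] (fun t : R => 1 + cos (x * t)).
  apply: measurable_funD => //.
  by apply: measurable_cosf; apply: measurable_funM.
rewrite ge0_integral_fold; last 2 first.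
- by apply/measurable_EFinP; apply: measurable_funM => //; exact: measurable_dexp.
- by move=> y; rewrite lee_fin mulr_ge0// dexp_ge0.
transitivity (\int[leb]_(t in `[0%R, +oo[)
    (2 * expR (- (e * t)) * (1 + cos (x * t)))%:E)%E.
  apply: eq_integral => t; rewrite inE/= in_itv/= andbT => t0.
  rewrite -EFinD /dexp normrN ger0_norm// mulrN cosN; congr EFin; ring.
have k0 : 0 < e ^+ 2 + x ^+ 2 by rewrite ltr_pwDl ?sqr_ge0// exprn_gt0.
have dF (t : R) : is_derive t 1 (fun t => expR (- (e * t)) *
    (- (2 / e) + 2 * (x * sin (x * t) - e * cos (x * t)) / (e ^+ 2 + x ^+ 2)))
    (2 * expR (- (e * t)) * (1 + cos (x * t))).
  by apply: is_derive_eq; rewrite /GRing.scale/=; field; rewrite !gt_eqF.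
rewrite (@ge0_FTC0y _ _ 0 dF).
- rewrite !mulr0 oppr0 expR0 mul1r sin0 cos0; congr EFin; field.
  by rewrite !gt_eqF.
- by move=> t; rewrite !mulr_ge0// expR_ge0.
- move=> t; apply: cvgM.
    apply: cvgM; first exact: cvg_cst.
    apply: continuous_comp; last exact: continuous_expR.
    by apply: cvgN; apply: cvgM; [exact: cvg_cst|exact: cvg_id].
  apply: cvgD; first exact: cvg_cst.
  apply: continuous_comp; last exact: continuous_cos.
  by apply: cvgM; [exact: cvg_cst|exact: cvg_id].
- apply/cvgr0Pnorm_le => _/posnumP[d].
  (* k bounds the trigonometric factor of the primitive, uniformly in t. *)
  pose k := 2 / e + 2 * (`|x| + e) / (e ^+ 2 + x ^+ 2).
  have k1 : 0 < k.
    rewrite /k ltr_pwDl ?divr_gt0// divr_ge0//; last exact: ltW.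
    by rewrite mulr_ge0// addr_ge0// ltW.
  have /cvgr0Pnorm_le/(_ (d%:num / k)) := cvg_expRN e0.
  rewrite divr_gt0// => /(_ isT) near_e.
  near=> t.
  have : `|expR (- (e * t))| <= d%:num / k by near: t.
  rewrite normrM ler_pdivlMr// => dk.
  apply: le_trans dk; rewrite ler_wpM2l//.
  rewrite (le_trans (ler_normD _ _))// /k lerD//.
    by rewrite normrN ger0_norm// divr_ge0// ltW.
  rewrite !normrM normfV (ger0_norm (ltW k0)) ler_wpM2r ?invr_ge0 ?(ltW k0)//.
  rewrite ger0_norm// ler_pM2l// (le_trans (ler_normB _ _))// lerD// normrM.
    by rewrite ler_piMr// sin_max.
  by rewrite (ger0_norm (ltW e0)) ler_piMr// ?cos_max// ltW.
Unshelve. all: by end_near. Qed.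

(** The sine is odd, hence disappears when t and -t are added. *)
Lemma integral_dexp_sin1 (e x : R) : 0 < e ->
  (\int[leb]_t (dexp e t * (1 + sin (x * t)))%:E = (2 / e)%:E)%E.
Proof.
move=> e0; have c1 y : 0 <= 1 + sin y :> R.
  by rewrite addrC -lerBlDr sub0r sin_geN1.
rewrite -integral_dexp// !ge0_integral_fold.
- apply: eq_integral => t _; rewrite -!EFinD /dexp normrN mulrN sinN.
  by congr EFin; ring.
- by apply/measurable_EFinP; exact: measurable_dexp.
- by move=> y; rewrite lee_fin dexp_ge0.
- apply/measurable_EFinP; apply: measurable_funM.
    exact: measurable_dexp.
  by apply: measurable_funD => //; apply: measurable_sinf; apply: measurable_funM.
- by move=> y; rewrite lee_fin mulr_ge0// dexp_ge0.
Qed.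

Lemma integrable_dexp (e : R) : 0 < e -> leb.-integrable setT (EFin \o dexp e).
Proof.
move=> e0; apply/integrableP; split.
  by apply/measurable_EFinP; exact: measurable_dexp.
under eq_integral do rewrite gee0_abs ?lee_fin ?dexp_ge0//.
by rewrite integral_dexp// ltry.
Qed.

Lemma integrable_dexpM (e : R) (f : R -> R) : 0 < e ->
  measurable_fun setT f -> (forall t, `|f t| <= 1) ->
  leb.-integrable setT (EFin \o (fun t => dexp e t * f t)).
Proof.
move=> e0 mf f1; apply: le_integrable (integrable_dexp e0) => //.
  by apply/measurable_EFinP; apply: measurable_funM => //; exact: measurable_dexp.
by move=> t _; rewrite /= lee_fin normrM ler_piMr.
Qed.

Lemma Rintegral_dexp_cos (e x : R) : 0 < e ->
  \int[leb]_t (dexp e t * cos (x * t)) = 2 * e / (e ^+ 2 + x ^+ 2).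
Proof.
move=> e0; have mc : measurable_fun [set: R] (fun t => cos (x * t)).
  by apply: measurable_cosf; apply: measurable_funM.
have := integral_dexp_cos1 x e0.
under eq_integral do rewrite mulrDr mulr1 EFinD.
rewrite integralD//; [|exact: integrable_dexp|]; last first.
  by apply: integrable_dexpM => // t; exact: cos_max.
rewrite integral_dexp// EFinD => /(congr1 (fun z => z - (2 / e)%:E)%E).
rewrite [X in (X - _)%E = _]addeC addeK// [X in _ = (X - _)%E]addeC addeK//.
by rewrite /Rintegral => ->.
Qed.

Lemma Rintegral_dexp_sin (e x : R) : 0 < e ->
  \int[leb]_t (dexp e t * sin (x * t)) = 0.
Proof.
move=> e0; have mc : measurable_fun [set: R] (fun t => sin (x * t)).
  by apply: measurable_sinf; apply: measurable_funM.
have := integral_dexp_sin1 x e0.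
under eq_integral do rewrite mulrDr mulr1 EFinD.
rewrite integralD//; [|exact: integrable_dexp|]; last first.
  by apply: integrable_dexpM => // t; exact: sin_max.
rewrite integral_dexp// => /(congr1 (fun z => z - (2 / e)%:E)%E).
by rewrite [X in (X - _)%E = _]addeC addeK// subee// /Rintegral => ->.
Qed.

(** The Poisson kernel of the line, up to a factor 1 / (2 * pi): the cosine
    transform of [dexp e]. *)
Definition poisson (e t : R) := 2 * e / (e ^+ 2 + t ^+ 2).

Lemma poisson_ge0 (e t : R) : 0 < e -> 0 <= poisson e t.
Proof.
move=> e0; rewrite /poisson divr_ge0// ?addr_ge0 ?sqr_ge0//.
by rewrite mulr_ge0// ltW.
Qed.

Lemma continuous_poisson (e : R) : 0 < e -> continuous (poisson e).
Proof.
move=> e0 t; have k0 : 0 < e ^+ 2 + t ^+ 2 by rewrite ltr_pwDl ?sqr_ge0// exprn_gt0.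
apply: cvgM; first exact: cvg_cst.
apply: cvgV; first by rewrite gt_eqF.
apply: cvgD; first exact: cvg_cst.
by apply: cvgM; exact: cvg_id.
Qed.

Lemma measurable_poisson (e : R) : 0 < e -> measurable_fun setT (poisson e).
Proof. by move=> e0; apply: continuous_measurable_fun; exact: continuous_poisson. Qed.

Lemma integral_poisson1 : (\int[leb]_t (poisson 1 t)%:E = (2 * pi)%:E)%E.
Proof.
rewrite ge0_integral_fold; last 2 first.
- by apply/measurable_EFinP; exact: measurable_poisson.
- by move=> y; rewrite lee_fin poisson_ge0.
under eq_integral do rewrite -EFinD.
(* Folding doubles the integrand 2 / (1 + t^2), whence the factor 4. *)
have dF (t : R) : is_derive t 1 (fun t => 4 * atan t) (poisson 1 t + poisson 1 (- t)).
  apply: is_derive_eq; rewrite /GRing.scale/= /poisson; field.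
  by rewrite gt_eqF// ltr_pwDl// sqr_ge0.
rewrite (@ge0_FTC0y _ _ (2 * pi) dF).
- by rewrite atan0 mulr0 subr0.
- by move=> t; rewrite addr_ge0// poisson_ge0.
- under [X in continuous X]eq_fun do rewrite {2}/poisson sqrrN -/(poisson _ _).
  by move=> t; apply: cvgD; exact: continuous_poisson.
- rewrite (_ : 2 * pi = 4 * (pi / 2)); last by field.
  by apply: cvgM; [exact: cvg_cst|exact: cvgy_atan].
Qed.

End one_dim.

(** * Exchanging an integral with a bounded kernel *)

Section swap.
Context d1 d2 (T1 : measurableType d1) (T2 : measurableType d2) (R : realType).
Variables (m1 : {sigma_finite_measure set T1 -> \bar R}).
Variables (m2 : {sigma_finite_measure set T2 -> \bar R}).
Variables (a : T1 -> R) (g : T2 -> R) (k : T1 * T2 -> R) (c : R).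
Hypotheses (ia : m1.-integrable setT (EFin \o a)).
Hypotheses (ig : m2.-integrable setT (EFin \o g)).
Hypotheses (mk : measurable_fun setT k) (kc : forall z, `|k z| <= c).

Lemma bounded_mul_integrable d (T : measurableType d)
    (m : {measure set T -> \bar R}) (f h : T -> R) C :
  m.-integrable setT (EFin \o f) -> measurable_fun setT h ->
  (forall x, `|h x| <= C) -> m.-integrable setT (EFin \o (fun x => f x * h x)).
Proof.
move=> fi mh hC.
have mf : measurable_fun setT f by apply/measurable_EFinP; case/integrableP: fi.
apply: (le_integrable _ _ _ (integrableZl measurableT C fi)) => //.
  by apply/measurable_EFinP; exact: measurable_funM.
move=> t _; rewrite /= lee_fin !normrM mulrC ler_wpM2r//.
exact: le_trans (ler_norm _).
Qed.

Let ma : measurable_fun setT a.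
Proof. by apply/measurable_EFinP; case/integrableP: ia. Qed.
Let mg : measurable_fun setT g.
Proof. by apply/measurable_EFinP; case/integrableP: ig. Qed.

Let F (z : T1 * T2) := a z.1 * (g z.2 * k z).

Let mF : measurable_fun setT F.
Proof.
apply: measurable_funM; first exact: measurableT_comp.
by apply: measurable_funM => //; exact: measurableT_comp.
Qed.

Let iF : (m1 \x m2)%E.-integrable setT (EFin \o F).
Proof.
apply/integrable12ltyP; first exact/measurable_EFinP.
have gfin : (\int[m2]_y `|(g y)%:E|)%E \is a fin_num.
  have /integrableP[_] := ig; rewrite ge0_fin_numE//; exact: integral_ge0.
pose G := fine (\int[m2]_y `|(g y)%:E|)%E.
apply: (@le_lt_trans _ _ (\int[m1]_x ((G * `|c|)%:E * `|(a x)%:E|))%E).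
  apply: ge0_le_integral => //.
  - by move=> x _; exact: integral_ge0.
  - apply: (@measurable_fun_fubini_tonelli_F _ _ _ _ _ m2
      (fun z => `|(F z)%:E|%E)) => //.
    by apply/measurableT_comp => //; exact/measurable_EFinP.
  - apply: emeasurable_funM => //; apply: measurableT_comp => //.
    exact/measurable_EFinP.
  move=> x _.
  apply: (@le_trans _ _ (\int[m2]_y ((`|a x| * `|c|)%:E * `|(g y)%:E|))%E).
    apply: ge0_le_integral => //.
    - apply/measurableT_comp => //; apply/measurable_EFinP.
      by apply: (measurableT_comp mF); exact: pair1_measurable.
    - apply: emeasurable_funM => //; apply: measurableT_comp => //.
      exact/measurable_EFinP.
    move=> y _; rewrite /= -EFinM lee_fin /F/= !normrM.
    rewrite [leRHS]mulrAC -mulrA ler_wpM2l// ler_wpM2l//.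
    by rewrite (le_trans (kc _))// ler_norm.
  rewrite ge0_integralZl//; last first.
    by apply: measurableT_comp => //; exact/measurable_EFinP.
  rewrite -(fineK gfin) -/G abse_EFin -!EFinM.
  by rewrite (_ : `|a x| * `|c| * G = G * `|c| * `|a x|)//; ring.
rewrite ge0_integralZl//; last 2 first.
- by apply: measurableT_comp => //; exact/measurable_EFinP.
- by rewrite lee_fin mulr_ge0// fine_ge0// integral_ge0.
have /integrableP[_ /=] := ia.
have : (0 <= \int[m1]_x `|(a x)%:E|)%E by exact: integral_ge0.
case: (\int[m1]_x `|(a x)%:E|)%E => // r _ _.
by rewrite -EFinM ltry.
Qed.

(** Fubini's theorem: a bounded factor k does not spoil the integrability of the
    product of a and g over the product space. *)
Lemma Rintegral_swap :
  \int[m2]_y (g y * \int[m1]_x (a x * k (x, y))) =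
  \int[m1]_x (a x * \int[m2]_y (g y * k (x, y))).
Proof.
have mk1 x : measurable_fun setT (fun y => k (x, y)).
  by apply: (measurableT_comp mk); exact: pair1_measurable.
have mk2 y : measurable_fun setT (fun x => k (x, y)).
  by apply: (measurableT_comp mk); exact: pair2_measurable.
have iak y : m1.-integrable setT (EFin \o (fun x => a x * k (x, y))).
  exact: bounded_mul_integrable.
have igk x : m2.-integrable setT (EFin \o (fun y => g y * k (x, y))).
  exact: bounded_mul_integrable.
rewrite /Rintegral; congr fine.
transitivity (\int[m2]_y \int[m1]_x (F (x, y))%:E)%E.
  apply: eq_integral => y _.
  under [RHS]eq_integral do rewrite /F/= mulrCA EFinM.
  rewrite (integralZl measurableT (iak y)) EFinM.
  by congr (_ * _)%E; apply: fineK; exact: (integrable_fin_num _ (iak y)).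
rewrite -(Fubini iF); apply: eq_integral => x _.
rewrite -[LHS]/(\int[m2]_y (a x * (g y * k (x, y)))%:E)%E.
under [LHS]eq_integral do rewrite EFinM.
rewrite (integralZl measurableT (igk x)) EFinM.
by congr (_ * _)%E; apply/esym/fineK; exact: (integrable_fin_num _ (igk x)).
Qed.

End swap.

(** * Exponential damping and Poisson kernels *)

Section kernels.
Variables (R : realType) (n : nat).
Local Notation leb := (@lebesgue_measure R).
Local Notation mu := (@lebR R n).

Lemma integrable_prodf_dexp (e : R) m : 0 < e ->
  (@lebR R m).-integrable setT (EFin \o prodf (dexp e) (n := m)).
Proof.
move=> e0; apply/integrableP; split.
  by apply/measurable_EFinP; apply: measurable_prodf; exact: measurable_dexp.
have pge0 (x : 'rV[R]_m) : 0 <= prodf (dexp e) x.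
  by apply: prodf_ge0 => t; exact: dexp_ge0.
under eq_integral => x _ do rewrite gee0_abs ?lee_fin//.
rewrite (integral_prodf m (measurable_dexp e) (dexp_ge0 e) (integral_dexp e0)).
exact: ltry.
Qed.

(** Induction on the dimension. By the addition formulas the slice in the last
    coordinate is a combination of a cosine and a sine, and the integral of the
    damped sine vanishes; what is left is a transform in one dimension less
    times the one-dimensional kernel. The formulas for the cosine and for the
    sine are proved together, as each addition formula involves both. *)
Lemma kernel_transform (e : R) m (x : 'rV[R]_m) : 0 < e ->
  \int[@lebR R m]_y (prodf (dexp e) y * cos (dotp x y)) = prodf (poisson e) x /\
  \int[@lebR R m]_y (prodf (dexp e) y * sin (dotp x y)) = 0.
Proof.
move=> e0; elim: m x => [|m IH] x.
  rewrite /Rintegral /lebR/= !integral_dirac//= ?diracE ?mem_set// ?mul1e;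
    try by apply/measurable_EFinP; apply: measurable_funM;
      [exact: measurable_prodf (measurable_dexp e)|
       (apply: measurable_cosf || apply: measurable_sinf); exact: measurable_dotp].
  by rewrite /= indicT /prodf /dotp !big_ord0 cos0 sin0 !mul1r.
have md : measurable_fun setT (dotp x) by exact: measurable_dotp.
have mde := measurable_dexp e.
have [IHc IHs] := IH (rV_init x).
have ic : leb.-integrable setT
    (EFin \o (fun t => dexp e t * cos (x ord0 ord_max * t))).
  apply: integrable_dexpM => //; last by move=> t; exact: cos_max.
  by apply: measurable_cosf; apply: measurable_funM.
have isn : leb.-integrable setT
    (EFin \o (fun t => dexp e t * sin (x ord0 ord_max * t))).
  apply: integrable_dexpM => //; last by move=> t; exact: sin_max.
  by apply: measurable_sinf; apply: measurable_funM.
have mdi : measurable_fun setT (dotp (rV_init x)) by exact: measurable_dotp.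
have iC : (@lebR R m).-integrable setT
    (EFin \o (fun v => prodf (dexp e) v * cos (dotp (rV_init x) v))).
  apply: (bounded_mul_integrable (C := 1)); first exact: integrable_prodf_dexp.
    exact: measurable_cosf.
  by move=> ?; exact: cos_max.
have iS : (@lebR R m).-integrable setT
    (EFin \o (fun v => prodf (dexp e) v * sin (dotp (rV_init x) v))).
  apply: (bounded_mul_integrable (C := 1)); first exact: integrable_prodf_dexp.
    exact: measurable_sinf.
  by move=> ?; exact: sin_max.
have slice (p q : R) :
  leb.-integrable setT (EFin \o (fun t => p * (dexp e t * cos (x ord0 ord_max * t))
     + q * (dexp e t * sin (x ord0 ord_max * t)))) /\
  \int[leb]_t (p * (dexp e t * cos (x ord0 ord_max * t))
     + q * (dexp e t * sin (x ord0 ord_max * t))) = p * poisson e (x ord0 ord_max).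
  have i1 := integrableZl measurableT p ic.
  have i2 := integrableZl measurableT q isn.
  split; first exact: (integrableD measurableT i1 i2).
  rewrite RintegralD// !RintegralZl// Rintegral_dexp_cos// Rintegral_dexp_sin//.
  by rewrite mulr0 addr0.
(* The common part of both cases: h is the cosine or the sine, and p, q are the
   coefficients that its addition formula produces. *)
have fullE (h : R -> R) (r : R) (F := fun v t => prodf (dexp e) (row_rcons (v, t)) *
      h (dotp x (row_rcons (v, t)))) (p q : 'rV[R]_m -> R) :
    measurable_fun setT (fun y => h (dotp x y)) -> (forall y, `|h y| <= 1) ->
    (forall v t, F v t = p v * (dexp e t * cos (x ord0 ord_max * t))
      + q v * (dexp e t * sin (x ord0 ord_max * t))) ->
    (@lebR R m).-integrable setT (EFin \o p) ->
    \int[@lebR R m]_v p v = r ->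
    \int[@lebR R m.+1]_y (prodf (dexp e) y * h (dotp x y)) =
      r * poisson e (x ord0 ord_max).
  move=> mh h1 FE ip pr.
  rewrite Rintegral_rVS.
  - under eq_Rintegral => v _.
      under eq_Rintegral do rewrite -/(F v _) FE.
      rewrite (slice _ _).2; over.
    by rewrite RintegralZr// pr.
  - apply: (bounded_mul_integrable (C := 1)) => //.
    exact: integrable_prodf_dexp.
  - move=> v; apply: eq_integrable (slice (p v) (q v)).1 => //= t _.
    by rewrite -FE.
split.
- rewrite (@fullE cos (prodf (poisson e) (rV_init x))
    (fun v => prodf (dexp e) v * cos (dotp (rV_init x) v))
    (fun v => - (prodf (dexp e) v * sin (dotp (rV_init x) v))))//.
  + by rewrite -[in RHS](rV_initK x) prodfS.
  + exact: measurable_cosf.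
  + by move=> ?; exact: cos_max.
  + by move=> v t; rewrite prodfS dotpS cosD; ring.
- rewrite (@fullE sin 0
    (fun v => prodf (dexp e) v * sin (dotp (rV_init x) v))
    (fun v => (prodf (dexp e) v * cos (dotp (rV_init x) v))))//.
  + by rewrite mul0r.
  + exact: measurable_sinf.
  + by move=> ?; exact: sin_max.
  + by move=> v t; rewrite prodfS dotpS sinD; ring.
Qed.

Definition dexpn (e : R) (x : 'rV[R]_n) := prodf (dexp e) x.
Definition poissonn (e : R) (x : 'rV[R]_n) := prodf (poisson e) x.

Lemma poissonn_ge0 (e : R) x : 0 < e -> 0 <= poissonn e x.
Proof. by move=> e0; apply: prodf_ge0 => t; exact: poisson_ge0. Qed.

Lemma dexpn_ge0 (e : R) x : 0 <= dexpn e x.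
Proof. by apply: prodf_ge0 => t; exact: dexp_ge0. Qed.

Lemma dexpnE (e : R) (x : 'rV[R]_n) :
  dexpn e x = expR (- (e * \sum_(i < n) `|x ord0 i|)).
Proof.
by rewrite mulr_sumr -sumrN expR_sum.
Qed.

Lemma dexpn_le1 (e : R) x : 0 < e -> dexpn e x <= 1.
Proof.
move=> e0; rewrite dexpnE expR_le1 oppr_le0 mulr_ge0 ?(ltW e0)//.
exact: sumr_ge0.
Qed.

Lemma measurable_dexpn (e : R) : measurable_fun setT (dexpn e).
Proof. by apply: measurable_prodf; exact: measurable_dexp. Qed.

Lemma measurable_poissonn (e : R) : 0 < e -> measurable_fun setT (poissonn e).
Proof. by move=> e0; apply: measurable_prodf; exact: measurable_poisson. Qed.

Lemma poissonnN (e : R) x : poissonn e (- x) = poissonn e x.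
Proof. by apply: eq_bigr => i _; rewrite mxE /poisson sqrrN. Qed.

Lemma poissonnZ (e : R) z : 0 < e -> e ^+ n * poissonn e (e *: z) = poissonn 1 z.
Proof.
move=> e0; rewrite -[n in e ^+ n]card_ord -prodr_const -big_split/=.
apply: eq_bigr => i _; rewrite mxE /poisson; field.
rewrite (_ : e ^+ 2 + _ = e ^+ 2 * (1 + z ord0 i ^+ 2)); last by ring.
have k0 : 0 < 1 + z ord0 i ^+ 2 by rewrite ltr_pwDl// sqr_ge0.
by rewrite gt_eqF//= gt_eqF// mulr_gt0// exprn_gt0.
Qed.

(** The mass of the kernel depends neither on x nor on e: an affine substitution
    turns it into the centred kernel of parameter 1. *)
Lemma integral_poissonn (e : R) x : 0 < e ->
  (\int[mu]_y (poissonn e (x - y))%:E = ((2 * pi) ^+ n)%:E)%E.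
Proof.
move=> e0; rewrite (ge0_integral_affine x e0); last 2 first.
- apply/measurable_EFinP; apply: (measurableT_comp (measurable_poissonn e0)).
  exact: measurable_rVB.
- by move=> y; rewrite lee_fin poissonn_ge0.
rewrite -(integral_prodf n (measurable_poisson ltr01) (fun t => poisson_ge0 t ltr01)
  (integral_poisson1 R)).
apply: eq_integral => y _; rewrite -EFinM opprB addrC subrK.
by rewrite poissonnZ.
Qed.

End kernels.

(** * Cosine and sine transforms *)

Section param.
Context d1 d2 (T1 : measurableType d1) (T2 : measurableType d2) (R : realType).
Variables (m1 : {sigma_finite_measure set T1 -> \bar R}).

(** Tonelli's theorem gives the measurability for the positive and the negative
    part, and the integral is the difference of the two. *)
Lemma measurable_Rintegral_param (F : T1 * T2 -> R) :
  measurable_fun setT F ->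
  measurable_fun setT (fun y => \int[m1]_x F (x, y)).
Proof.
move=> mF; apply: measurableT_comp => //.
have mE : measurable_fun setT (EFin \o F) by exact/measurable_EFinP.
rewrite (_ : (fun y => _) = (fun y => (\int[m1]_x ((EFin \o F)^\+ (x, y)) -
  \int[m1]_x ((EFin \o F)^\- (x, y)))%E)).
  apply: emeasurable_funB.
    apply: (@measurable_fun_fubini_tonelli_G _ _ _ _ _ m1 ((EFin \o F)^\+)%E) => //.
    exact: measurable_funepos.
  apply: (@measurable_fun_fubini_tonelli_G _ _ _ _ _ m1 ((EFin \o F)^\-)%E) => //.
  exact: measurable_funeneg.
apply/funext => y; rewrite integralE.
by congr (_ - _)%E; apply: eq_integral => x _; rewrite ?funeposE ?funenegE.
Qed.

End param.

Section trig.
Variables (R : realType) (n : nat).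
Local Notation mu := (@lebR R n).
Implicit Types (a b : 'rV[R]_n -> R).

(** The Fourier integral of a complex function is made of these two transforms
    of its real and of its imaginary part, which keeps the analysis real. *)
Definition cosT a (xi : 'rV[R]_n) := \int[mu]_x (a x * cos (dotp x xi)).
Definition sinT a (xi : 'rV[R]_n) := \int[mu]_x (a x * sin (dotp x xi)).

Local Notation L1 a := (mu.-integrable setT (EFin \o a)).

Lemma L1_measurable a : L1 a -> measurable_fun setT a.
Proof. by case/integrableP => /measurable_EFinP. Qed.

Lemma integrable_cos a xi : L1 a -> L1 (fun x => a x * cos (dotp x xi)).
Proof.
move=> ia; apply: (bounded_mul_integrable (C := 1)) => //.
  by apply: measurable_cosf; exact: measurable_dotp.
by move=> x; exact: cos_max.
Qed.

Lemma integrable_sin a xi : L1 a -> L1 (fun x => a x * sin (dotp x xi)).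
Proof.
move=> ia; apply: (bounded_mul_integrable (C := 1)) => //.
  by apply: measurable_sinf; exact: measurable_dotp.
by move=> x; exact: sin_max.
Qed.

Lemma measurable_cosT a : L1 a -> measurable_fun setT (cosT a).
Proof.
move=> ia; apply: (@measurable_Rintegral_param _ _ _ _ _ mu
  (fun z => a z.1 * cos (dotp z.1 z.2))).
apply: measurable_funM.
  by apply: (measurableT_comp (L1_measurable ia)).
by apply: measurable_cosf; exact: measurable_dotp.
Qed.

Lemma measurable_sinT a : L1 a -> measurable_fun setT (sinT a).
Proof.
move=> ia; apply: (@measurable_Rintegral_param _ _ _ _ _ mu
  (fun z => a z.1 * sin (dotp z.1 z.2))).
apply: measurable_funM.
  by apply: (measurableT_comp (L1_measurable ia)).
by apply: measurable_sinf; exact: measurable_dotp.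
Qed.

Lemma norm_RintegralM_le a (h : 'rV[R]_n -> R) C : L1 a ->
  measurable_fun setT h -> (forall x, `|h x| <= C) ->
  `|\int[mu]_x (a x * h x)| <= C * \int[mu]_x `|a x|.
Proof.
move=> ia mh hC; have iah := bounded_mul_integrable ia mh hC.
have ina : L1 (fun x => `|a x|) by exact: integrable_norm ia.
rewrite (le_trans (le_normr_Rintegral measurableT iah))//.
rewrite -RintegralZl//; apply: le_Rintegral => //.
- exact: integrable_norm iah.
- exact: integrableZl ina.
- by move=> x _ /=; rewrite normrM mulrC ler_wpM2r.
Qed.

Lemma cosT_bound a xi : L1 a -> `|cosT a xi| <= \int[mu]_x `|a x|.
Proof.
move=> ia; rewrite -[leRHS]mul1r; apply: norm_RintegralM_le => //.
  by apply: measurable_cosf; exact: measurable_dotp.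
by move=> x; exact: cos_max.
Qed.

Lemma sinT_bound a xi : L1 a -> `|sinT a xi| <= \int[mu]_x `|a x|.
Proof.
move=> ia; rewrite -[leRHS]mul1r; apply: norm_RintegralM_le => //.
  by apply: measurable_sinf; exact: measurable_dotp.
by move=> x; exact: sin_max.
Qed.

Lemma trig_combination a (p q : R) xi : L1 a ->
  \int[mu]_x (a x * (p * cos (dotp x xi) + q * sin (dotp x xi))) =
  p * cosT a xi + q * sinT a xi.
Proof.
move=> ia; have ic := integrable_cos xi ia; have isn := integrable_sin xi ia.
rewrite -!RintegralZl// -RintegralD//=.
- by apply: eq_Rintegral => x _; ring.
- exact: (integrableZl measurableT p ic).
- exact: (integrableZl measurableT q isn).
Qed.

Lemma dotpBl (x y xi : 'rV[R]_n) : dotp (x - y) xi = dotp x xi - dotp y xi.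
Proof.
by rewrite /dotp -sumrB; apply: eq_bigr => i _; rewrite !mxE mulrBl.
Qed.

Lemma integrable_dexpn e : 0 < e -> L1 (dexpn e).
Proof. exact: integrable_prodf_dexp. Qed.

Lemma dexpn_cos e x : 0 < e ->
  \int[mu]_xi (dexpn e xi * cos (dotp x xi)) = poissonn e x.
Proof. by move=> e0; case: (kernel_transform x e0). Qed.

Lemma dexpn_sin e x : 0 < e ->
  \int[mu]_xi (dexpn e xi * sin (dotp x xi)) = 0.
Proof. by move=> e0; case: (kernel_transform x e0). Qed.

(** The bilinear form of the convolution with the Poisson kernel, a regularised
    version of (2 pi)^n times the scalar product of L^2. *)
Definition poisson_form e a b :=
  \int[mu]_x (a x * \int[mu]_y (b y * poissonn e (x - y))).

Section bilinear.
Variables (a b : 'rV[R]_n -> R) (e : R).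
Hypotheses (ia : L1 a) (ib : L1 b) (e0 : 0 < e).

Let B := \int[mu]_x `|b x|.

Let mixed_le (p q u v : R) : `|p| <= B -> `|q| <= B -> `|u| <= 1 -> `|v| <= 1 ->
  `|p * u + q * v| <= 2 * B.
Proof.
move=> pB qB u1 v1; rewrite (le_trans (ler_normD _ _))// mulr_natl mulr2n.
by apply: lerD; rewrite normrM (le_trans (ler_piMr _ _)).
Qed.

Let mdot1 : measurable_fun setT (fun z : 'rV[R]_n * 'rV[R]_n => dotp z.1 z.2).
Proof. exact: measurable_dotp. Qed.

(** Fubini's theorem, used twice: the product of the transforms carries the
    kernel cos (x.xi) cos (y.xi) + sin (x.xi) sin (y.xi) = cos ((x - y).xi),
    whose damped integral over xi is the Poisson kernel at x - y. *)
Lemma dexpn_inner :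
  \int[mu]_xi (dexpn e xi * (cosT a xi * cosT b xi + sinT a xi * sinT b xi)) =
  poisson_form e a b.
Proof.
pose k (z : 'rV[R]_n * 'rV[R]_n) :=
  cosT b z.2 * cos (dotp z.1 z.2) + sinT b z.2 * sin (dotp z.1 z.2).
transitivity (\int[mu]_xi (dexpn e xi * \int[mu]_x (a x * k (x, xi)))).
  apply: eq_Rintegral => xi _; rewrite /k/= trig_combination//.
  by congr (_ * _); ring.
rewrite (@Rintegral_swap _ _ _ _ _ mu mu a (dexpn e) k (2 * B) ia).
- apply: eq_Rintegral => x _; congr (_ * _).
  transitivity (\int[mu]_xi (dexpn e xi *
      \int[mu]_y (b y * cos (dotp (x - y) xi)))).
    apply: eq_Rintegral => xi _; congr (_ * _); rewrite /k/= mulrC [X in _ + X]mulrC.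
    rewrite -trig_combination//; apply: eq_Rintegral => y _.
    by rewrite dotpBl cosB.
  rewrite (@Rintegral_swap _ _ _ _ _ mu mu b (dexpn e)
    (fun z => cos (dotp (x - z.1) z.2)) 1 ib).
  + by apply: eq_Rintegral => y _; rewrite /= dexpn_cos.
  + exact: integrable_dexpn.
  + apply: measurable_cosf; apply: measurable_dotp => //.
    exact: measurable_rVB.
  + by move=> z; exact: cos_max.
- exact: integrable_dexpn.
- apply: measurable_funD; apply: measurable_funM.
  + by apply: (measurableT_comp (measurable_cosT ib)).
  + exact: measurable_cosf.
  + by apply: (measurableT_comp (measurable_sinT ib)).
  + exact: measurable_sinf.
- move=> z; apply: mixed_le; rewrite ?cos_max ?sin_max//.
    exact: cosT_bound.
  exact: sinT_bound.
Qed.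

(** The same computation with sin ((x - y).xi), whose damped integral vanishes.
    This integrand is the interaction of the real part of a complex function
    with its imaginary part. *)
Lemma dexpn_cross :
  \int[mu]_xi (dexpn e xi * (cosT b xi * sinT a xi - cosT a xi * sinT b xi)) = 0.
Proof.
pose k (z : 'rV[R]_n * 'rV[R]_n) :=
  - sinT b z.2 * cos (dotp z.1 z.2) + cosT b z.2 * sin (dotp z.1 z.2).
transitivity (\int[mu]_xi (dexpn e xi * \int[mu]_x (a x * k (x, xi)))).
  apply: eq_Rintegral => xi _; rewrite /k/= trig_combination//.
  by congr (_ * _); ring.
rewrite (@Rintegral_swap _ _ _ _ _ mu mu a (dexpn e) k (2 * B) ia).
- rewrite -[RHS](@mulr0 R (\int[mu]_x a x)) -RintegralZr//.
  apply: eq_Rintegral => x _; congr (_ * _).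
  transitivity (\int[mu]_xi (dexpn e xi *
      \int[mu]_y (b y * sin (dotp (x - y) xi)))).
    apply: eq_Rintegral => xi _; congr (_ * _); rewrite /k/=.
    rewrite addrC mulrC mulNr [X in _ - X]mulrC -mulNr.
    rewrite -trig_combination//; apply: eq_Rintegral => y _.
    by rewrite dotpBl sinB mulNr.
  rewrite (@Rintegral_swap _ _ _ _ _ mu mu b (dexpn e)
    (fun z => sin (dotp (x - z.1) z.2)) 1 ib).
  + rewrite -[RHS](@mulr0 R (\int[mu]_x b x)) -RintegralZr//.
    by apply: eq_Rintegral => y _; rewrite /= dexpn_sin.
  + exact: integrable_dexpn.
  + apply: measurable_sinf; apply: measurable_dotp => //.
    exact: measurable_rVB.
  + by move=> z; exact: sin_max.
- exact: integrable_dexpn.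
- apply: measurable_funD; apply: measurable_funM.
  + by apply: measurableT_comp => //; apply: (measurableT_comp (measurable_sinT ib)).
  + exact: measurable_cosf.
  + by apply: (measurableT_comp (measurable_cosT ib)).
  + exact: measurable_sinf.
- move=> z; apply: mixed_le; rewrite ?cos_max ?sin_max//.
    by rewrite normrN; exact: sinT_bound.
  exact: cosT_bound.
Qed.

End bilinear.

End trig.

(** * The Poisson kernel as an approximate identity *)

Section dct.
Context d (T : measurableType d) (R : realType) (m : {measure set T -> \bar R}).

Lemma Rintegral_dct (f_ : nat -> T -> R) (f g : T -> R) :
  (forall k, measurable_fun setT (f_ k)) ->
  (forall x, f_ k x @[k --> \oo] --> f x) ->
  m.-integrable setT (EFin \o g) -> (forall k x, `|f_ k x| <= g x) ->
  \int[m]_x f_ k x @[k --> \oo] --> \int[m]_x f x.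
Proof.
move=> mf ff ig fg.
have mlim : measurable_fun setT f.
  by apply: (@measurable_fun_cvg _ _ _ _ f_) => // x _; exact: ff.
have [] := @dominated_convergence _ _ _ m setT measurableT
  (fun k => EFin \o f_ k) (EFin \o f) (EFin \o g) _ _ _ ig _.
- by move=> k; exact/measurable_EFinP.
- exact/measurable_EFinP.
- apply: aeW => x _; apply: cvg_EFin; first exact: nearW.
  exact: ff.
- by apply: aeW => x k _; rewrite /= lee_fin.
move=> fi _ cv; apply: fine_cvg.
by rewrite fineK//; exact: (integrable_fin_num _ fi).
Qed.

End dct.

Section smoothing.
Variables (R : realType) (n : nat).
Local Notation mu := (@lebR R n).
Local Notation L1 a := (mu.-integrable setT (EFin \o a)).
Implicit Types (a b : 'rV[R]_n -> R) (e : R).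

Local Notation kappa := ((2 * @pi R) ^+ n).

(** Up to the factor (2 pi)^n, the convolution of b with the product of the
    Poisson kernels of the coordinates. *)
Definition smooth_by e b (x : 'rV[R]_n) := \int[mu]_y (b y * poissonn e (x - y)).

Lemma poissonn_le e (x : 'rV[R]_n) : 0 < e -> poissonn e x <= (2 / e) ^+ n :> R.
Proof.
move=> e0; rewrite -[n in (2 / e) ^+ n]card_ord -prodr_const.
apply: ler_prod => i _; rewrite poisson_ge0//= /poisson.
have k0 : 0 < e ^+ 2 + x ord0 i ^+ 2 by rewrite ltr_pwDl ?sqr_ge0// exprn_gt0.
rewrite ler_pdivrMr// mulrDr (_ : 2 / e * e ^+ 2 = 2 * e); last first.
  by field; rewrite gt_eqF.
by rewrite lerDl mulr_ge0 ?sqr_ge0// divr_ge0// ltW.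
Qed.

Lemma norm_poissonn_le e (x : 'rV[R]_n) : 0 < e -> `|poissonn e x| <= (2 / e) ^+ n :> R.
Proof. by move=> e0; rewrite ger0_norm ?poissonn_ge0// poissonn_le. Qed.

Lemma measurable_poissonnB e x : 0 < e ->
  measurable_fun setT (fun y : 'rV[R]_n => poissonn e (x - y)).
Proof.
move=> e0; apply: (measurableT_comp (measurable_poissonn e0)).
exact: measurable_rVB.
Qed.

Lemma integrable_poissonnB e x : 0 < e ->
  L1 (fun y : 'rV[R]_n => poissonn e (x - y)).
Proof.
move=> e0; apply/integrableP; split.
  by apply/measurable_EFinP; exact: measurable_poissonnB.
under eq_integral do rewrite /= ger0_norm ?poissonn_ge0//.
by rewrite integral_poissonn// ltry.
Qed.

Lemma integrable_poissonnM b e x : 0 < e -> L1 b ->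
  L1 (fun y => b y * poissonn e (x - y)).
Proof.
move=> e0 ib; apply: (bounded_mul_integrable (C := (2 / e) ^+ n)) => //.
  exact: measurable_poissonnB.
by move=> y; exact: norm_poissonn_le.
Qed.

Lemma measurable_smooth_by b e : 0 < e -> L1 b ->
  measurable_fun setT (smooth_by e b).
Proof.
move=> e0 ib; apply: (@measurable_Rintegral_param _ _ _ _ _ mu
  (fun z : 'rV[R]_n * 'rV[R]_n => b z.1 * poissonn e (z.2 - z.1))).
apply: measurable_funM; first exact: (measurableT_comp (L1_measurable ib)).
apply: (measurableT_comp (measurable_poissonn e0)).
exact: measurable_rVB.
Qed.

Lemma integral_smooth_by b e : 0 < e -> L1 b -> (forall x, 0 <= b x) ->
  (\int[mu]_x (smooth_by e b x)%:E = kappa%:E * \int[mu]_x (b x)%:E)%E.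
Proof.
move=> e0 ib b0; have mb := L1_measurable ib.
transitivity (\int[mu]_x \int[mu]_y (b y * poissonn e (x - y))%:E)%E.
  apply: eq_integral => x _; rewrite /smooth_by /Rintegral fineK//.
  exact: (integrable_fin_num _ (integrable_poissonnM x e0 ib)).
rewrite (@fubini_tonelli _ _ _ _ _ mu mu
  (fun z : 'rV[R]_n * 'rV[R]_n => (b z.2 * poissonn e (z.1 - z.2))%:E)); last 2 first.
- apply/measurable_EFinP; apply: measurable_funM.
    exact: measurableT_comp.
  apply: (measurableT_comp (measurable_poissonn e0)).
  exact: measurable_rVB.
- by move=> z; rewrite lee_fin mulr_ge0// poissonn_ge0.
rewrite -ge0_integralZl//; last 3 first.
- exact/measurable_EFinP.
- by move=> x _; rewrite lee_fin.
- by rewrite lee_fin exprn_ge0// mulr_ge0// pi_ge0.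
apply: eq_integral => y _ /=.
under eq_integral do rewrite EFinM -opprB poissonnN.
rewrite ge0_integralZl//.
- by rewrite integral_poissonn// muleC.
- apply/measurable_EFinP; exact: measurable_poissonnB.
- by move=> x _; rewrite lee_fin poissonn_ge0.
- by rewrite lee_fin.
Qed.

Lemma kappa_ge0 : 0 <= kappa.
Proof. by rewrite exprn_ge0// mulr_ge0// pi_ge0. Qed.

Lemma integrable_smooth_by b e : 0 < e -> L1 b -> (forall x, 0 <= b x) ->
  L1 (smooth_by e b).
Proof.
move=> e0 ib b0; apply/integrableP; split.
  by apply/measurable_EFinP; exact: measurable_smooth_by.
under eq_integral => x _.
  rewrite /= ger0_norm; last first.
    by apply: Rintegral_ge0 => y _; rewrite mulr_ge0// poissonn_ge0.
  over.
rewrite integral_smooth_by// -(fineK (integrable_fin_num _ ib))//.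
by rewrite -EFinM ltry.
Qed.

(** Schur's test: 2 |a x| |a y| is at most a x ^ 2 + a y ^ 2, and the kernel has
    mass (2 pi)^n in either variable. *)
Lemma poisson_form_le a e : 0 < e -> L1 a -> L1 (fun x => a x ^+ 2) ->
  poisson_form e a a <= kappa * \int[mu]_x (a x ^+ 2).
Proof.
move=> e0 ia ia2.
have isq := integrable_smooth_by e0 ia2 (fun x => sqr_ge0 _).
(* J is the integral over y of the bound that the inequality of arithmetic and
   geometric means gives; both of its summands have the same integral. *)
pose J x := 2^-1 * (kappa * a x ^+ 2 + smooth_by e (fun y => a y ^+ 2) x).
have ika : L1 (fun x => kappa * a x ^+ 2) := integrableZl measurableT kappa ia2.
have iJ : L1 J.
  apply: (integrableZl measurableT 2^-1
    (f := EFin \o (fun x => kappa * a x ^+ 2 + smooth_by e (fun y => a y ^+ 2) x))).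
  exact: (integrableD measurableT ika isq).
have JE : \int[mu]_x J x = kappa * \int[mu]_x (a x ^+ 2).
  rewrite RintegralZl//; last exact: (integrableD measurableT ika isq).
  rewrite RintegralD// RintegralZl//.
  have -> : \int[mu]_x smooth_by e (fun y => a y ^+ 2) x =
      kappa * \int[mu]_x (a x ^+ 2).
    rewrite /Rintegral integral_smooth_by//; last by move=> x; exact: sqr_ge0.
    by rewrite fineM// (integrable_fin_num _ ia2).
  by field.
have le_aJ x : `|a x * smooth_by e a x| <= J x.
  rewrite normrM.
  have ins := integrable_norm (integrable_poissonnM x e0 ia).
  apply: (@le_trans _ _ (`|a x| * \int[mu]_y `|a y * poissonn e (x - y)|)).
    rewrite ler_wpM2l//; apply: le_normr_Rintegral => //.
    exact: integrable_poissonnM.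
  rewrite -RintegralZl//.
  have i1 : L1 (fun y => a x ^+ 2 * poissonn e (x - y)).
    apply: (integrableZl measurableT (a x ^+ 2)
      (f := EFin \o (fun y => poissonn e (x - y)))).
    exact: integrable_poissonnB.
  have i1' := integrable_poissonnB x e0.
  have i2 := integrable_poissonnM x e0 ia2.
  have -> : J x = \int[mu]_y (2^-1 * (a x ^+ 2 * poissonn e (x - y) +
       a y ^+ 2 * poissonn e (x - y))).
    rewrite RintegralZl//; last exact: (integrableD measurableT i1 i2).
    rewrite RintegralD// RintegralZl// {1}/Rintegral integral_poissonn//=.
    by rewrite [a x ^+ 2 * _]mulrC.
  apply: le_Rintegral => //.
  - exact: (integrableZl measurableT _ ins).
  - apply: (integrableZl measurableT 2^-1 (f := EFin \o _)).
    exact: (integrableD measurableT i1 i2).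
  move=> y _; rewrite normrM (ger0_norm (poissonn_ge0 _ e0)) mulrA -mulrDl mulrA.
  rewrite ler_wpM2r ?poissonn_ge0// -(real_normK (num_real (a x))).
  rewrite -(real_normK (num_real (a y))).
  have := sqr_ge0 (`|a x| - `|a y|); nra.
apply: (@le_trans _ _ (\int[mu]_x J x)); last by rewrite JE.
apply: (le_trans (ler_norm _)).
have iS : L1 (fun x => a x * smooth_by e a x).
  apply: le_integrable iJ => //.
    apply/measurable_EFinP; apply: measurable_funM; first exact: L1_measurable.
    exact: measurable_smooth_by.
  by move=> x _; rewrite /= lee_fin (le_trans (le_aJ x))// ler_norm.
apply: (le_trans (le_normr_Rintegral _ iS)) => //.
apply: le_Rintegral => //.
exact: (integrable_norm iS).
Qed.

Lemma integral_affine (f : 'rV[R]_n -> R) e x : 0 < e -> measurable_fun setT f ->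
  \int[mu]_y f y = \int[mu]_y (e ^+ n * f (x - e *: y)).
Proof.
move=> e0 mf; rewrite /Rintegral integralE [in RHS]integralE.
have mE : measurable_fun setT (EFin \o f) by exact/measurable_EFinP.
have en : 0 <= e ^+ n by rewrite exprn_ge0// ltW.
congr (fine (_ - _)).
- rewrite (ge0_integral_affine x e0)//; last exact: measurable_funepos.
  apply: eq_integral => y _; rewrite !funeposE.
  by rewrite maxe_pMr ?lee_fin// mule0 EFinM.
- rewrite (ge0_integral_affine x e0)//; last exact: measurable_funeneg.
  apply: eq_integral => y _; rewrite !funenegE.
  by rewrite maxe_pMr ?lee_fin// mule0 muleN EFinM.
Qed.

(** The parameter e moves from the kernel into the argument of b, so that a
    single integrable function dominates all integrands. *)
Lemma smooth_byE b e x : 0 < e -> L1 b ->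
  smooth_by e b x = \int[mu]_z (b (x - e *: z) * poissonn 1 z).
Proof.
move=> e0 ib; rewrite /smooth_by (@integral_affine _ e x)//.
  apply: eq_Rintegral => z _.
  rewrite -(poissonnZ z e0) (_ : x - (x - e *: z) = e *: z); first by ring.
  by rewrite opprB addrC subrK.
exact: (L1_measurable (integrable_poissonnM x e0 ib)).
Qed.

Lemma integrable_poissonn e : 0 < e -> L1 (@poissonn R n e).
Proof.
move=> e0; have := integrable_poissonnB 0 e0.
by under eq_fun do rewrite sub0r poissonnN.
Qed.

(** Convergence theorems for integrals speak of sequences: the damping is
    removed along this one. *)
Definition eps k : R := k.+1%:R^-1.

Lemma eps_gt0 k : 0 < eps k. Proof. by rewrite /eps invr_gt0. Qed.

Lemma cvg_eps : eps k @[k --> \oo] --> 0.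
Proof. exact: cvg_harmonic. Qed.

(** Dominated convergence: b (x - eps k * z) tends to b x for each z. *)
Lemma cvg_smooth_by b (M : R) x : L1 b -> continuous b -> (forall y, `|b y| <= M) ->
  smooth_by (eps k) b x @[k --> \oo] --> kappa * b x.
Proof.
move=> ib cb bM; have mb := L1_measurable ib.
have -> : (fun k => smooth_by (eps k) b x) =
    (fun k => \int[mu]_z (b (x - eps k *: z) * poissonn 1 z)).
  by apply/funext => k; rewrite smooth_byE// eps_gt0.
have -> : kappa * b x = \int[mu]_z (b x * poissonn 1 z).
  rewrite RintegralZl//; last exact: integrable_poissonn.
  rewrite mulrC; congr (_ * _); rewrite /Rintegral.
  under eq_integral do rewrite -poissonnN -sub0r.
  by rewrite integral_poissonn.
apply: (@Rintegral_dct _ _ _ mu _ _ (fun z => M * poissonn 1 z)).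
- move=> k; apply: measurable_funM; last exact: measurable_poissonn.
  by apply: (measurableT_comp mb); exact: measurable_affine.
- move=> z; apply: cvgM; last exact: cvg_cst.
  suff cx : x - eps k *: (z : 'rV[R]_n) @[k --> \oo] --> x.
    exact: (cvg_comp _ _ cx (cb x)).
  rewrite -[X in _ --> X](subr0 x) -(scale0r (z : 'rV[R]_n)).
  by apply: cvgB; [exact: cvg_cst|apply: cvgZr_tmp; exact: cvg_eps].
- exact: (integrableZl measurableT M (integrable_poissonn ltr01)).
- move=> k z; rewrite normrM (ger0_norm (poissonn_ge0 _ ltr01)).
  by rewrite ler_wpM2r// poissonn_ge0.
Qed.

Lemma cvg_poisson_form a (M : R) : L1 a -> continuous a -> (forall y, `|a y| <= M) ->
  poisson_form (eps k) a a @[k --> \oo] --> kappa * \int[mu]_x (a x ^+ 2).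
Proof.
move=> ia ca aM.
have ia2 : L1 (fun x => a x ^+ 2).
  exact: (bounded_mul_integrable ia (L1_measurable ia) aM).
rewrite -RintegralZl//.
have i1 : L1 (fun x => M * kappa * `|a x|).
  exact: (integrableZl measurableT _ (integrable_norm ia)).
apply: (Rintegral_dct _ _ i1).
- move=> k; apply: measurable_funM; first exact: L1_measurable.
  by apply: measurable_smooth_by => //; exact: eps_gt0.
- move=> x; rewrite (_ : kappa * a x ^+ 2 = a x * (kappa * a x)); last by ring.
  by apply: cvgM; [exact: cvg_cst|exact: cvg_smooth_by].
- move=> k x; rewrite normrM mulrC ler_wpM2r//.
  have e0 := eps_gt0 k.
  rewrite (le_trans (le_normr_Rintegral _ (integrable_poissonnM x e0 ia)))//.
  have iK := integrable_poissonnB x e0.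
  have -> : M * kappa = \int[mu]_y (M * poissonn (eps k) (x - y)).
    by rewrite RintegralZl// /Rintegral integral_poissonn.
  apply: le_Rintegral => //.
  + exact: (integrable_norm (integrable_poissonnM x e0 ia)).
  + exact: (integrableZl measurableT M iK).
  move=> y _; rewrite normrM (ger0_norm (poissonn_ge0 _ e0)).
  by rewrite ler_wpM2r// poissonn_ge0.
Qed.

End smoothing.

(** * Complex-valued functions and their L^2 norms *)

Local Notation cRe := complex.Re.
Local Notation cIm := complex.Im.

Section complex_functions.
Variables (R : realType) (n : nat).
Local Notation mu := (@lebR R n).
Local Notation L1 a := (mu.-integrable setT (EFin \o a)).
Local Open Scope complex_scope.
Implicit Types (f g h : 'rV[R]_n -> R[i]) (z w : R[i]).

Definition nsq z : R := cRe z ^+ 2 + cIm z ^+ 2.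

Lemma nsq_ge0 z : 0 <= nsq z. Proof. by rewrite addr_ge0 ?sqr_ge0. Qed.

Lemma normc_sqr z : normc z ^+ 2 = nsq z.
Proof. by case: z => a b; rewrite /normc/= sqr_sqrtr// addr_ge0 ?sqr_ge0. Qed.

Lemma normc_ge0 z : 0 <= normc z.
Proof. by case: z => a b; rewrite /normc sqrtr_ge0. Qed.

Lemma cReD z w : cRe (z + w) = cRe z + cRe w.
Proof. by case: z; case: w. Qed.
Lemma cImD z w : cIm (z + w) = cIm z + cIm w.
Proof. by case: z; case: w. Qed.
Lemma cReB z w : cRe (z - w) = cRe z - cRe w.
Proof. by case: z; case: w. Qed.
Lemma cImB z w : cIm (z - w) = cIm z - cIm w.
Proof. by case: z; case: w. Qed.
Lemma cReM z w : cRe (z * w) = cRe z * cRe w - cIm z * cIm w.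
Proof. by case: z => a b; case: w. Qed.
Lemma cImM z w : cIm (z * w) = cRe z * cIm w + cIm z * cRe w.
Proof. by case: z => a b; case: w. Qed.
Lemma cReZ (r : R) z : cRe (r%:C * z) = r * cRe z.
Proof. by rewrite cReM /= mul0r subr0. Qed.
Lemma cImZ (r : R) z : cIm (r%:C * z) = r * cIm z.
Proof. by rewrite cImM /= mul0r addr0. Qed.
Lemma nsqZ (r : R) z : nsq (r%:C * z) = r ^+ 2 * nsq z.
Proof. by rewrite /nsq cReZ cImZ; ring. Qed.

Definition cmeas f := measurable_fun setT (fun x => cRe (f x)) /\
  measurable_fun setT (fun x => cIm (f x)).

Lemma cmeasD f g : cmeas f -> cmeas g -> cmeas (fun x => f x + g x).
Proof.
move=> [f1 f2] [g1 g2]; split.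
  under eq_fun do rewrite cReD; exact: measurable_funD.
under eq_fun do rewrite cImD; exact: measurable_funD.
Qed.

Lemma cmeasB f g : cmeas f -> cmeas g -> cmeas (fun x => f x - g x).
Proof.
move=> [f1 f2] [g1 g2]; split.
  under eq_fun do rewrite cReB; exact: measurable_funB.
under eq_fun do rewrite cImB; exact: measurable_funB.
Qed.

Lemma cmeasZ (w : 'rV[R]_n -> R) f : measurable_fun setT w -> cmeas f ->
  cmeas (fun x => (w x)%:C * f x).
Proof.
move=> mw [f1 f2]; split.
  under eq_fun do rewrite cReZ; exact: measurable_funM.
under eq_fun do rewrite cImZ; exact: measurable_funM.
Qed.

Lemma measurable_nsq f : cmeas f -> measurable_fun setT (fun x => nsq (f x)).
Proof.
by move=> [f1 f2]; apply: measurable_funD; exact: measurable_funX.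
Qed.

Lemma measurable_normc f : cmeas f -> measurable_fun setT (fun x => normc (f x)).
Proof.
move=> mf; have -> : (fun x => normc (f x)) = (fun x => Num.sqrt (nsq (f x))).
  by apply/funext => x; rewrite -normc_sqr sqrtr_sqr ger0_norm// normc_ge0.
apply: measurableT_comp => //; last exact: measurable_nsq.
apply: continuous_measurable_fun; exact: sqrt_continuous.
Qed.

(** The square of the L^2 norm, which unlike the norm is a plain integral. *)
Definition energy f : \bar R := (\int[mu]_x (nsq (f x))%:E)%E.

Lemma energy_ge0 f : (0 <= energy f)%E.
Proof. by apply: integral_ge0 => x _; rewrite lee_fin nsq_ge0. Qed.

Lemma L2normE f : L2norm f = (energy f `^ 2^-1)%E.
Proof.
rewrite /L2norm unlock; congr (_ `^ _)%E.
apply: eq_integral => x _ /=.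
by rewrite ger0_norm ?normc_ge0// powR_mulrn ?normc_ge0// normc_sqr.
Qed.

Lemma L2norm_ge0 f : (0 <= L2norm f)%E.
Proof. exact: Lnorm_ge0. Qed.

Lemma energyE f : energy f = (L2norm f `^ 2)%E.
Proof.
by rewrite L2normE -poweRrM mulVf// poweRe1// energy_ge0.
Qed.

Lemma L2norm_leP (c : R) f g : 0 <= c ->
  (L2norm f <= c%:E * L2norm g)%E <-> (energy f <= (c ^+ 2)%:E * energy g)%E.
Proof.
move=> c0; split => le_fg.
  rewrite !energyE -powR_mulrn// -poweR_EFin -poweRM ?lee_fin ?L2norm_ge0//.
  by rewrite gt0_ler_poweR//= ?in_itv/= ?leey ?andbT ?mule_ge0 ?L2norm_ge0// lee_fin.
have -> : c%:E = ((c ^+ 2)%:E `^ 2^-1)%E.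
  by rewrite poweR_EFin -powR_mulrn// -powRrM mulfV// powRr1.
have c2 : (0 <= (c ^+ 2)%:E)%E by rewrite lee_fin sqr_ge0.
rewrite !L2normE -poweRM ?energy_ge0//.
by rewrite gt0_ler_poweR//= ?in_itv/= ?leey ?andbT ?mule_ge0 ?energy_ge0.
Qed.

Lemma L2norm_le_num (c : R) f : 0 <= c ->
  (L2norm f <= c%:E)%E <-> (energy f <= (c ^+ 2)%:E)%E.
Proof.
move=> c0; have c2 : (0 <= (c ^+ 2)%:E)%E by rewrite lee_fin sqr_ge0.
split => le_c.
  rewrite energyE -powR_mulrn// -poweR_EFin.
  apply: gt0_ler_poweR => //; rewrite in_itv/= leey andbT ?lee_fin//.
  exact: L2norm_ge0.
have -> : c%:E = ((c ^+ 2)%:E `^ 2^-1)%E.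
  by rewrite poweR_EFin -powR_mulrn// -powRrM mulfV// powRr1.
rewrite L2normE; apply: gt0_ler_poweR => //; rewrite in_itv/= leey andbT//.
exact: energy_ge0.
Qed.

Lemma energy_le f g : cmeas f -> cmeas g -> (forall x, nsq (f x) <= nsq (g x)) ->
  (energy f <= energy g)%E.
Proof.
move=> mf mg fg; apply: ge0_le_integral => //.
- by move=> x _; rewrite lee_fin nsq_ge0.
- by apply/measurable_EFinP; exact: measurable_nsq.
- by apply/measurable_EFinP; exact: measurable_nsq.
- by move=> x _; rewrite lee_fin.
Qed.

Lemma L2norm_le f g : cmeas f -> cmeas g -> (forall x, nsq (f x) <= nsq (g x)) ->
  (L2norm f <= L2norm g)%E.
Proof.
move=> mf mg fg; rewrite -[leRHS]mul1e; apply/L2norm_leP => //.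
by rewrite expr1n mul1e energy_le.
Qed.

Lemma L2norm_triangle f g : cmeas f -> cmeas g ->
  (L2norm (fun x => f x + g x)%R <= L2norm f + L2norm g)%E.
Proof.
move=> mf mg.
apply: le_trans (minkowski_EFin _ (measurable_normc mf) (measurable_normc mg) _);
  last by rewrite ler1n.
have in0y (h : 'rV[R]_n -> \bar R) :
    (\int[mu]_x `|h x| `^ 2)%E \in `[0%E, +oo%E].
  by rewrite in_itv/= leey andbT integral_ge0// => x _; exact: poweR_ge0.
rewrite /L2norm unlock; apply: gt0_ler_poweR; [by []|exact: in0y|exact: in0y|].
apply: ge0_le_integral => //=.
- apply/measurable_EFinP.
  apply: (measurableT_comp (measurable_powR _)); apply: measurableT_comp => //.
  by apply: measurable_normc; exact: cmeasD.
- apply/measurable_EFinP.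
  apply: (measurableT_comp (measurable_powR _)); apply: measurableT_comp => //.
  by apply: measurable_funD; exact: measurable_normc.
move=> x _; rewrite lee_fin ge0_ler_powR// ?nnegrE//.
by rewrite !ger0_norm ?addr_ge0 ?normc_ge0// le_normcD.
Qed.

Lemma L2norm_sub_sym f g :
  L2norm (fun x => f x - g x)%R = L2norm (fun x => g x - f x)%R.
Proof. by rewrite !L2normE; congr (_ `^ _)%E; apply: eq_integral => x _;
  rewrite /nsq !cReB !cImB; congr EFin; ring. Qed.

Lemma L2norm_triangleB f g h : cmeas f -> cmeas g -> cmeas h ->
  (L2norm (fun x => f x - h x)%R <=
   L2norm (fun x => f x - g x)%R + L2norm (fun x => g x - h x)%R)%E.
Proof.
move=> mf mg mh.
have -> : (fun x => f x - h x) = (fun x => (f x - g x) + (g x - h x)).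
  by apply/funext => x; rewrite addrA subrK.
by apply: L2norm_triangle; exact: cmeasB.
Qed.

Lemma L2norm_le_sub f g : cmeas f -> cmeas g ->
  (L2norm f <= L2norm g + L2norm (fun x => f x - g x)%R)%E.
Proof.
move=> mf mg; have -> : f = (fun x => g x + (f x - g x)).
  by apply/funext => x; rewrite addrCA subrr addr0.
have -> : (fun x => g x + (f x - g x) - g x) = (fun x => f x - g x).
  by apply/funext => x; rewrite addrAC subrr add0r.
by apply: L2norm_triangle => //; exact: cmeasB.
Qed.

Lemma cLfun1P f : cLfun 1 f <-> L1 (fun x => cRe (f x)) /\ L1 (fun x => cIm (f x)).
Proof.
have P (a : 'rV[R]_n -> R) : a \in Lfun (lebesgue_rV R n) 1 <-> L1 a.
  exact: Lfun1_integrable.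
by split => -[h1 h2]; split; apply/P.
Qed.

Lemma in_Lfun2P (a : 'rV[R]_n -> R) : a \in Lfun (lebesgue_rV R n) 2%:E <->
  measurable_fun setT a /\ (\int[mu]_x (a x ^+ 2)%:E < +oo)%E.
Proof.
split.
  move=> a2; split; first by move: a2; rewrite inE => /andP[/[!inE]].
  have /integrableP[_] := Lfun2_integrable_sqr a2.
  by under eq_integral do rewrite /= ger0_norm ?sqr_ge0//.
move=> [ma a2]; rewrite inE; apply/andP; split; rewrite inE//=.
rewrite /finite_norm unlock; apply: poweR_lty.
under eq_integral do rewrite /= powR_mulrn// real_normK ?num_real//.
exact: a2.
Qed.

Lemma cLfun2P f : cLfun 2 f <-> cmeas f /\ (energy f < +oo)%E.
Proof.
have split_energy : cmeas f -> energy f = (\int[mu]_x (cRe (f x) ^+ 2)%:E +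
    \int[mu]_x (cIm (f x) ^+ 2)%:E)%E.
  move=> [m1 m2]; rewrite /energy; under eq_integral do rewrite EFinD.
  rewrite ge0_integralD//.
  - by move=> x _; rewrite lee_fin sqr_ge0.
  - by apply/measurable_EFinP; exact: measurable_funX.
  - by move=> x _; rewrite lee_fin sqr_ge0.
  - by apply/measurable_EFinP; exact: measurable_funX.
split.
  move=> [/in_Lfun2P[m1 f1] /in_Lfun2P[m2 f2]]; split; first by [].
  by rewrite split_energy// lte_add_pinfty.
move=> [mf]; have [m1 m2] := mf; rewrite split_energy// => lt_oo.
by split; apply/in_Lfun2P; split => //; apply: le_lt_trans lt_oo;
  rewrite ?leeDl ?leeDr//; apply: integral_ge0 => x _; rewrite lee_fin sqr_ge0.
Qed.

Lemma cLfun2_L2norm f : cLfun 2 f <-> cmeas f /\ (L2norm f < +oo)%E.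
Proof.
rewrite cLfun2P; split => -[mf lt_oo]; split => //.
  by rewrite L2normE poweR_lty.
by rewrite energyE poweR_lty.
Qed.

End complex_functions.

(** * Plancherel's theorem for integrable functions *)

Section fatou_bound.
Context d (T : measurableType d) (R : realType) (m : {measure set T -> \bar R}).

Lemma fatou_le (f_ : nat -> T -> R) (f : T -> R) (c : \bar R) :
  (forall k, measurable_fun setT (f_ k)) -> measurable_fun setT f ->
  (forall k x, 0 <= f_ k x) ->
  {ae m, forall x, f_ k x @[k --> \oo] --> f x} ->
  (forall k, (\int[m]_x (f_ k x)%:E <= c)%E) ->
  (\int[m]_x (f x)%:E <= c)%E.
Proof.
move=> mf_ mf f0 ff fc.
have mE k : measurable_fun setT (EFin \o f_ k) by exact/measurable_EFinP.
have -> : (\int[m]_x (f x)%:E = \int[m]_x limn_einf (fun k => (f_ k x)%:E))%E.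
  apply: ae_eq_integral => //.
  - exact/measurable_EFinP.
  - rewrite (_ : (fun x => limn_einf (fun k => (f_ k x)%:E)) =
        (fun x => - limn_esup (fun k => - (f_ k x)%:E))%E).
      apply: measurableT_comp => //.
      apply: (@measurable_fun_limn_esup _ _ _ _
        (fun k x => (- (f_ k x)%:E)%E)) => k.
      by apply: (measurableT_comp (f := -%E)) => //; exact: mE.
    apply/funext => x; rewrite -limn_einfN; congr limn_einf.
    by apply/funext => k; rewrite /comp oppeK.
  apply: filterS ff => x /= fx _.
  have : (f_ k x)%:E @[k --> \oo] --> (f x)%:E by apply: cvg_EFin => //; exact: nearW.
  by move/cvg_limn_einf_sup => [].
apply: (le_trans (fatou m measurableT (f := fun k => EFin \o f_ k) _ _)) => //.
  by move=> k x _; rewrite lee_fin.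
rewrite limn_einf_lim; apply: lime_le; first exact: is_cvg_einfs.
apply: nearW => k; apply: le_trans (fc k).
by apply: ereal_inf_lbound; exists k => //=.
Qed.

Lemma lim_EFin_le (u : nat -> R) (l : R) (c : \bar R) :
  u k @[k --> \oo] --> l -> (forall k, ((u k)%:E <= c)%E) -> (l%:E <= c)%E.
Proof.
move=> ul; case: c => [r| |] uc; rewrite ?leey//.
  by rewrite lee_fin; apply: (cvgr_to_le ul); apply: nearW => k; rewrite -lee_fin.
by have := uc 0%N; rewrite leeNy_eq.
Qed.

End fatou_bound.

Section plancherel.
Variables (R : realType) (n : nat).
Local Notation mu := (@lebR R n).
Local Notation L1 a := (mu.-integrable setT (EFin \o a)).
Local Notation kappa := ((2 * @pi R) ^+ n).
Local Open Scope complex_scope.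
Implicit Types (f g h : 'rV[R]_n -> R[i]).

(** The oscillatory transform with phase s * x.xi: s = -1 gives the Fourier
    integral and s = 1, up to a constant, the inverse one, so that Plancherel's
    theorem is proved once for both. *)
Definition oft (s : R) f : 'rV[R]_n -> R[i] := fun xi =>
  cintegral (fun x => cis (s * dotp x xi) * f x).

Lemma fourier_integralE f : fourier_integral f = oft (-1) f.
Proof. by apply/funext => xi; rewrite /oft; under eq_fun do rewrite mulN1r. Qed.

Lemma inv_fourier_integralE f :
  inv_fourier_integral f = fun x => ((2 * pi) ^- n)%:C * oft 1 f x.
Proof.
apply/funext => xi; rewrite /oft; under eq_fun do rewrite mul1r dotpC.
by [].
Qed.

Variables (s : R) (hs : s = 1 \/ s = -1).

Lemma cos_sign t : cos (s * t) = cos t.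
Proof. by case: hs => ->; rewrite ?mul1r// mulN1r cosN. Qed.

Lemma sin_sign t : sin (s * t) = s * sin t.
Proof. by case: hs => ->; rewrite ?mul1r// !mulN1r sinN. Qed.

Lemma s_sqr : s ^+ 2 = 1.
Proof. by case: hs => ->; rewrite ?sqrrN expr1n. Qed.

Lemma oftE f xi (a := fun x => cRe (f x)) (b := fun x => cIm (f x)) :
  L1 a -> L1 b ->
  cRe (oft s f xi) = cosT a xi - s * sinT b xi /\
  cIm (oft s f xi) = cosT b xi + s * sinT a xi.
Proof.
move=> ia ib; rewrite /oft /cintegral /=; split.
- transitivity (\int[mu]_x (a x * cos (dotp x xi) + - s * (b x * sin (dotp x xi)))).
    apply: eq_Rintegral => x _; rewrite cReM /= cos_sign sin_sign /a /b; ring.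
  rewrite RintegralD//; [|exact: integrable_cos|]; last first.
    exact: (integrableZl measurableT (- s) (integrable_sin xi ib)).
  by rewrite RintegralZl ?mulNr//; exact: integrable_sin.
- transitivity (\int[mu]_x (b x * cos (dotp x xi) + s * (a x * sin (dotp x xi)))).
    apply: eq_Rintegral => x _; rewrite cImM /= cos_sign sin_sign /a /b; ring.
  rewrite RintegralD//; [|exact: integrable_cos|]; last first.
    exact: (integrableZl measurableT s (integrable_sin xi ia)).
  by rewrite RintegralZl//; exact: integrable_sin.
Qed.

Lemma cmeas_oft f : cLfun 1 f -> cmeas (oft s f).
Proof.
move=> /cLfun1P[ia ib]; split.
  rewrite (_ : (fun x => _) = (fun xi => cosT (fun x => cRe (f x)) xi -
    s * sinT (fun x => cIm (f x)) xi)); last first.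
    by apply/funext => xi; have [] := oftE xi ia ib.
  apply: measurable_funB; first exact: measurable_cosT.
  by apply: measurable_funM => //; exact: measurable_sinT.
rewrite (_ : (fun x => _) = (fun xi => cosT (fun x => cIm (f x)) xi +
  s * sinT (fun x => cRe (f x)) xi)); last first.
  by apply/funext => xi; have [] := oftE xi ia ib.
apply: measurable_funD; first exact: measurable_cosT.
by apply: measurable_funM => //; exact: measurable_sinT.
Qed.

Lemma integrable_dexpn_mixed e (p q u v : 'rV[R]_n -> R) B : 0 < e ->
  measurable_fun setT p -> measurable_fun setT q ->
  measurable_fun setT u -> measurable_fun setT v ->
  (forall x, `|p x| <= B) -> (forall x, `|q x| <= B) ->
  (forall x, `|u x| <= B) -> (forall x, `|v x| <= B) ->
  L1 (fun x => dexpn e x * (p x * u x + q x * v x)).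
Proof.
move=> e0 mp mq mu_ mv pB qB uB vB.
apply: (bounded_mul_integrable (C := B * B + B * B)).
- exact: integrable_dexpn.
- by apply: measurable_funD; exact: measurable_funM.
- move=> x; rewrite (le_trans (ler_normD _ _))// !normrM.
  by apply: lerD; apply: ler_pM.
Qed.

(** Expanding the square of the modulus leaves the two quadratic forms of the
    real and the imaginary part and a cross term, whose integral is 0. *)
Lemma damped_energy f e (a := fun x => cRe (f x)) (b := fun x => cIm (f x)) :
  0 < e -> cLfun 1 f ->
  (\int[mu]_xi (dexpn e xi * nsq (oft s f xi))%:E =
   (poisson_form e a a + poisson_form e b b)%:E)%E.
Proof.
move=> e0 /cLfun1P[ia ib].
pose B := \int[mu]_x `|a x| + \int[mu]_x `|b x|.
have Ba : \int[mu]_x `|a x| <= B by rewrite lerDl; exact: Rintegral_ge0.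
have Bb : \int[mu]_x `|b x| <= B by rewrite lerDr; exact: Rintegral_ge0.
have ca x : `|cosT a x| <= B by rewrite (le_trans (cosT_bound x ia)).
have sa x : `|sinT a x| <= B by rewrite (le_trans (sinT_bound x ia)).
have cb x : `|cosT b x| <= B by rewrite (le_trans (cosT_bound x ib)).
have sb x : `|sinT b x| <= B by rewrite (le_trans (sinT_bound x ib)).
have mca := measurable_cosT ia; have msa := measurable_sinT ia.
have mcb := measurable_cosT ib; have msb := measurable_sinT ib.
have i1 : L1 (fun x => dexpn e x * (cosT a x * cosT a x + sinT a x * sinT a x)).
  exact: (@integrable_dexpn_mixed _ _ _ _ _ B).
have i2 : L1 (fun x => dexpn e x * (cosT b x * cosT b x + sinT b x * sinT b x)).
  exact: (@integrable_dexpn_mixed _ _ _ _ _ B).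
have i3 : L1 (fun x => dexpn e x * (cosT b x * sinT a x - cosT a x * sinT b x)).
  apply: eq_integrable (@integrable_dexpn_mixed e (cosT b) (fun x => - cosT a x)
    (sinT a) (sinT b) B e0 mcb _ msa msb cb _ sa sb) => //.
  - by move=> x _ /=; rewrite mulNr.
  - exact: measurableT_comp.
  - by move=> x; rewrite normrN.
have i12 := integrableD measurableT i1 i2.
have i3s := integrableZl measurableT (2 * s) i3.
transitivity (\int[mu]_xi (
    (dexpn e xi * (cosT a xi * cosT a xi + sinT a xi * sinT a xi) +
     dexpn e xi * (cosT b xi * cosT b xi + sinT b xi * sinT b xi)) +
    (2 * s) * (dexpn e xi * (cosT b xi * sinT a xi - cosT a xi * sinT b xi)))%:E)%E.
  apply: eq_integral => xi _; congr EFin.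
  have [reE imE] := oftE xi ia ib; rewrite /nsq reE imE -/a -/b.
  rewrite !sqrrD !sqrrN !exprMn s_sqr; ring.
rewrite -[LHS]fineK; last first.
  exact: (integrable_fin_num _ (integrableD measurableT i12 i3s)).
congr EFin; rewrite -[LHS]/(\int[mu]_xi (_ + _)) RintegralD//.
rewrite RintegralD// RintegralZl// (dexpn_inner ia ia e0) (dexpn_inner ib ib e0).
rewrite (dexpn_cross ia ib e0).
by rewrite mulr0 addr0.
Qed.

Lemma nsq_sum_energy f : cLfun 2 f -> cLfun 1 f ->
  [/\ L1 (fun x => cRe (f x) ^+ 2), L1 (fun x => cIm (f x) ^+ 2) &
   energy f = (\int[mu]_x (cRe (f x) ^+ 2) + \int[mu]_x (cIm (f x) ^+ 2))%:E].
Proof.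
move=> [/Lfun2_integrable_sqr i1 /Lfun2_integrable_sqr i2] _; split => //.
rewrite -RintegralD// /Rintegral fineK//.
exact: (integrable_fin_num _ (integrableD measurableT i1 i2)).
Qed.

Lemma cvg_dexpn (xi : 'rV[R]_n) : dexpn (eps R k) xi @[k --> \oo] --> (1 : R).
Proof.
under eq_fun do rewrite dexpnE.
rewrite -(@expR0 R); apply: (@continuous_cvg _ _ _ _ _ _ expR);
  first exact: continuous_expR.
set S := \sum_(i < n) _.
have : - (eps R k * S) @[k --> \oo] --> - (0 * S).
  by apply: cvgN; apply: cvgM; [exact: cvg_eps|exact: cvg_cst].
by rewrite mul0r oppr0.
Qed.

(** Schur's test bounds the damped energies uniformly, and Fatou's lemma removes
    the damping. *)
Lemma plancherel_le f : cLfun 1 f -> cLfun 2 f ->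
  (energy (oft s f) <= kappa%:E * energy f)%E.
Proof.
move=> f1 f2; have [ia2 ib2 ->] := nsq_sum_energy f2 f1.
have mo := measurable_nsq (cmeas_oft f1).
apply: (@fatou_le _ _ _ mu (fun k xi => dexpn (eps R k) xi * nsq (oft s f xi))) => //.
- by move=> k; apply: measurable_funM => //; exact: measurable_dexpn.
- by move=> k x; rewrite mulr_ge0 ?nsq_ge0// dexpn_ge0.
- apply: aeW => xi; rewrite -[X in _ --> X]mul1r.
  by apply: cvgM; [exact: cvg_dexpn|exact: cvg_cst].
- move=> k; have e0 := eps_gt0 R k; have [ia ib] := (cLfun1P f).1 f1.
  rewrite damped_energy// -EFinM lee_fin mulrDr.
  by apply: lerD; exact: poisson_form_le.
Qed.

(** For a bounded continuous f the damped energies converge to the left-hand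
    side, because the Poisson kernels are an approximate identity; none of them
    exceeds the energy without damping. *)
Lemma plancherel_ge f (M : R) (a := fun x => cRe (f x)) (b := fun x => cIm (f x)) :
  cLfun 1 f -> cLfun 2 f -> continuous a -> continuous b ->
  (forall x, `|a x| <= M) -> (forall x, `|b x| <= M) ->
  (kappa%:E * energy f <= energy (oft s f))%E.
Proof.
move=> f1 f2 ca cb aM bM; have [_ _ ->] := nsq_sum_energy f2 f1.
have [ia ib] := (cLfun1P f).1 f1.
rewrite -EFinM mulrDr.
apply: (@lim_EFin_le _ (fun k =>
    poisson_form (eps R k) a a + poisson_form (eps R k) b b)).
  by apply: cvgD; exact: (@cvg_poisson_form _ _ _ M).
move=> k; have e0 := eps_gt0 R k; rewrite -damped_energy//.
have mo := measurable_nsq (cmeas_oft f1).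
apply: ge0_le_integral => //.
- by move=> x _; rewrite lee_fin mulr_ge0 ?nsq_ge0// dexpn_ge0.
- by apply/measurable_EFinP; apply: measurable_funM => //; exact: measurable_dexpn.
- exact/measurable_EFinP.
- by move=> x _; rewrite lee_fin ler_piMl ?nsq_ge0// dexpn_le1.
Qed.

End plancherel.

(** * Completeness of L^2 *)

Section completeness.
Variables (R : realType) (n : nat).
Local Notation mu := (@lebR R n).
Local Open Scope complex_scope.
Implicit Types (f g : 'rV[R]_n -> R[i]).

Lemma cvg_geometric_steps (u : nat -> R) (M : R) :
  (forall k, `|u k.+1 - u k| <= M * 2^-1 ^+ k) -> cvgn u.
Proof.
move=> uM; have cs : cvgn (series (telescope u)).
  apply: normed_cvg; apply: (@series_le_cvg _ _ (geometric M 2^-1)) => //.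
  - by move=> k; rewrite /=.
  - by move=> k; apply: le_trans (uM k).
  - by apply: is_cvg_geometric_series; rewrite gtr0_norm// invf_lt1// ltr1n.
rewrite (_ : u = (fun k => u 0%N + series (telescope u) k)).
  by apply: is_cvgD => //; exact: is_cvg_cst.
by apply/funext => k; rewrite [LHS]eq_sum_telescope.
Qed.

(** The rate 4^-k is fast enough for the sum of the 4^k |g_(k+1) - g_k|^2 to be
    integrable, hence almost everywhere finite; at such a point the sequence has
    increments of order 2^-k and converges. The limit superior defines a
    measurable limit everywhere, and Fatou's lemma bounds the tails in L^2. *)
Lemma L2_complete (g_ : nat -> 'rV[R]_n -> R[i]) :
  (forall k, cLfun 2 (g_ k)) ->
  (forall k, (L2norm (fun x => g_ k.+1 x - g_ k x)%R <= (4^-1 ^+ k)%:E)%E) ->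
  exists v, cLfun 2 v /\
    (fun k => L2norm (fun x => g_ k x - v x)%R) @ \oo --> 0%E.
Proof.
move=> g2 gstep.
have mg k : cmeas (g_ k) by have /cLfun2P[] := g2 k.
pose d k x := g_ k.+1 x - g_ k x.
have md k : cmeas (d k) by exact: cmeasB.
pose w k x : \bar R := (4 ^+ k * nsq (d k x))%:E.
have w0 k x : (0 <= w k x)%E by rewrite lee_fin mulr_ge0 ?exprn_ge0// nsq_ge0.
have mw k : measurable_fun setT (w k).
  by apply/measurable_EFinP; apply: measurable_funM => //; exact: measurable_nsq.
pose W x := (\sum_(0 <= k <oo) w k x)%E.
have W0 x : (0 <= W x)%E by apply: nneseries_ge0 => k _ _.
have iW : mu.-integrable setT W.
  apply/integrableP; split.
    by apply: ge0_emeasurable_sum => k *.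
  under eq_integral do rewrite gee0_abs//.
  rewrite integral_nneseries//.
  (* The k-th integral is at most 4^k (4^-k)^2, so the total is at most 4/3. *)
  apply: (@le_lt_trans _ _ (2%:E)%E); last exact: ltry.
  apply: lime_le; first by apply: is_cvg_nneseries => k _ _; exact: integral_ge0.
  apply: nearW => m.
  apply: (@le_trans _ _ (\sum_(0 <= k < m) (4^-1 ^+ k)%:E)%E).
    apply: lee_sum => k _; rewrite /w.
    under eq_integral do rewrite EFinM.
    rewrite ge0_integralZl//; last 2 first.
    - by apply/measurable_EFinP; exact: measurable_nsq.
    - by move=> x _; rewrite lee_fin nsq_ge0.
    have /L2norm_le_num : (L2norm (d k) <= (4^-1 ^+ k)%:E)%E by exact: gstep.
    rewrite exprn_ge0// => /(_ isT) le_d.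
    apply: (@le_trans _ _ ((4 ^+ k)%:E * ((4^-1 ^+ k) ^+ 2)%:E)%E).
      by rewrite lee_wpmul2l// lee_fin exprn_ge0.
    by rewrite -EFinM expr2 mulrA -exprMn mulfV// expr1n mul1r.
  rewrite sumEFin lee_fin.
  have := @geometric_le_lim R m 1 4^-1 ler01.
  rewrite invr_gt0 ltr0n gtr0_norm// invf_lt1// ltr1n => /(_ isT isT).
  rewrite /series/=; under eq_bigr do rewrite mul1r.
  by move=> /le_trans; apply; rewrite ler_pdivrMr; lra.
have cvg_comp_ : {ae mu, forall x, cvgn (fun k => cRe (g_ k x)) /\
    cvgn (fun k => cIm (g_ k x))}.
  apply: filterS (integrable_ae measurableT iW) => x /= /(_ I) Wfin.
  pose M := fine (W x).
  have M0 : 0 <= M by rewrite fine_ge0.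
  have wM k : nsq (d k x) <= ((M + 1) * 2^-1 ^+ k) ^+ 2.
    have : (w k x <= W x)%E.
      apply: le_trans (nneseries_lim_ge k.+1 _) => //.
      by rewrite big_nat_recr//= leeDr// sume_ge0.
    rewrite -(fineK Wfin) lee_fin -ler_pdivlMl ?exprn_gt0// => /le_trans; apply.
    have h4 : 2^-1 ^+ 2 = 4^-1 :> R by field.
    rewrite exprMn -exprM mulnC exprM h4 exprVn mulrC -/M.
    by rewrite ler_wpM2r ?invr_ge0 ?exprn_ge0//; nra.
  have MB0 k : 0 <= (M + 1) * 2^-1 ^+ k by rewrite mulr_ge0 ?addr_ge0// exprn_ge0.
  split; apply: (@cvg_geometric_steps _ (M + 1)) => k.
  - rewrite -cReB -(ler_pXn2r (n := 2))// ?nnegrE// real_normK ?num_real//.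
    by apply: le_trans (wM k); rewrite lerDl sqr_ge0.
  - rewrite -cImB -(ler_pXn2r (n := 2))// ?nnegrE// real_normK ?num_real//.
    by apply: le_trans (wM k); rewrite lerDr sqr_ge0.
pose limf (u : nat -> 'rV[R]_n -> R) x := fine (limn_esup (fun k => (u k x)%:E)).
have mlim u : (forall k, measurable_fun setT (u k)) -> measurable_fun setT (limf u).
  move=> mu_; apply: measurableT_comp => //.
  apply: (@measurable_fun_limn_esup _ _ _ _ (fun k x => (u k x)%:E)) => k.
  exact/measurable_EFinP.
have limfE u x : cvgn (fun k => u k x) -> u k x @[k --> \oo] --> limf u x.
  move=> cu; suff -> : limf u x = limn (fun k => u k x) by [].
  rewrite /limf; have : (u k x)%:E @[k --> \oo] --> (limn (fun k => u k x))%:E.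
    by apply: cvg_EFin => //; exact: nearW.
  by move/cvg_limn_einf_sup => [_ ->].
pose v x := limf (fun k y => cRe (g_ k y)) x +i* limf (fun k y => cIm (g_ k y)) x.
have mv : cmeas v by split; apply: mlim => k; have [] := mg k.
have step k j : (L2norm (fun x => g_ k x - g_ (k + j)%N x)%R <=
    (2 * 4^-1 ^+ k - 2 * 4^-1 ^+ (k + j))%:E)%E.
  elim: j => [|j IH].
    rewrite addn0 subrr; apply/L2norm_le_num => //.
    rewrite /energy; under eq_integral do rewrite subrr /nsq/= expr0n/= addr0.
    by rewrite integral0 expr0n.
  apply: le_trans (L2norm_triangleB (mg k) (mg (k + j)%N) (mg _)) _.
  rewrite [X in (_ + X)%E]L2norm_sub_sym addnS.
  apply: (@le_trans _ _ ((2 * 4^-1 ^+ k - 2 * 4^-1 ^+ (k + j))%:E +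
      (4^-1 ^+ (k + j))%:E)%E).
    by apply: leeD => //; exact: gstep.
  rewrite -EFinD lee_fin exprS.
  have : 0 <= 4^-1 ^+ (k + j) :> R by exact: exprn_ge0.
  lra.
have tail k : (L2norm (fun x => g_ k x - v x)%R <= (2 * 4^-1 ^+ k)%:E)%E.
  have b0 : 0 <= 2 * 4^-1 ^+ k :> R by rewrite mulr_ge0// exprn_ge0.
  apply/L2norm_le_num => //.
  apply: (@fatou_le _ _ _ mu (fun j x => nsq (g_ k x - g_ (k + j)%N x))).
  - by move=> j; apply: measurable_nsq; exact: cmeasB.
  - by apply: measurable_nsq; exact: cmeasB.
  - by move=> *; exact: nsq_ge0.
  - apply: filterS cvg_comp_ => x [c1 c2].
    rewrite /nsq; under eq_fun do rewrite cReB cImB.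
    rewrite cReB cImB.
    have cv1 := limfE (fun k y => cRe (g_ k y)) x c1.
    have cv2 := limfE (fun k y => cIm (g_ k y)) x c2.
    have sh (u : nat -> R) (l : R) :
        u j @[j --> \oo] --> l -> u (k + j)%N @[j --> \oo] --> l.
      rewrite (_ : (fun j => u (k + j)%N) = (fun j => u (j + k)%N)).
        by move=> ul; rewrite (cvg_shiftn k u).
      by apply/funext => j; rewrite addnC.
    have sq (u : nat -> R) (a l : R) : u j @[j --> \oo] --> l ->
        (a - u (k + j)%N) ^+ 2 @[j --> \oo] --> (a - l) ^+ 2.
      move=> /sh ul; rewrite expr2; under eq_fun do rewrite expr2.
      by apply: cvgM; (apply: cvgB => //; exact: cvg_cst).
    exact: (cvgD (sq _ (cRe (g_ k x)) _ cv1) (sq _ (cIm (g_ k x)) _ cv2)).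
  - move=> j; apply/L2norm_le_num => //; apply: le_trans (step k j) _.
    by rewrite lee_fin gerBl mulr_ge0 ?exprn_ge0.
exists v; split.
  apply/cLfun2_L2norm; split => //.
  have := L2norm_le_sub mv (mg 0%N); rewrite L2norm_sub_sym => /le_lt_trans; apply.
  have /cLfun2_L2norm[_ g0] := g2 0%N.
  by rewrite lte_add_pinfty// (le_lt_trans (tail 0%N))// ltry.
apply: (@squeeze_cvge _ _ _ _ (cst 0%E) _ (fun k => (2 * 4^-1 ^+ k)%:E)).
- by apply: nearW => k; rewrite L2norm_ge0 tail.
- exact: cvg_cst.
- apply: cvg_EFin; first exact: nearW.
  rewrite -[X in _ --> X](mulr0 (2 : R)); apply: cvgM; first exact: cvg_cst.
  by apply: cvg_expr; rewrite gtr0_norm// invf_lt1// ltr1n.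
Qed.

End completeness.

(** * Extension of a bounded operator by continuity *)

Section L2_extension_theory.
Variables (R : realType) (n : nat).
Local Notation mu := (@lebR R n).
Local Notation L1 a := (mu.-integrable setT (EFin \o a)).
Local Open Scope complex_scope.
Implicit Types (f g u v : 'rV[R]_n -> R[i]).

Lemma cLfun1B f g : cLfun 1 f -> cLfun 1 g -> cLfun 1 (fun x => f x - g x).
Proof.
move=> /cLfun1P[f1 f2] /cLfun1P[g1 g2]; apply/cLfun1P; split.
  apply: eq_integrable (integrableB measurableT f1 g1) => // x _.
  by rewrite /= cReB.
apply: eq_integrable (integrableB measurableT f2 g2) => // x _.
by rewrite /= cImB.
Qed.

Lemma cLfun2_cmeas f : cLfun 2 f -> cmeas f.
Proof. by move=> /cLfun2P[]. Qed.

Lemma L2norm_fin f : cLfun 2 f -> (L2norm f < +oo)%E.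
Proof. by move=> /cLfun2_L2norm[]. Qed.

Lemma L2norm_leB f g : cmeas f -> cmeas g ->
  (L2norm (fun x => f x - g x)%R <= L2norm f + L2norm g)%E.
Proof.
move=> mf mg; have := L2norm_le_sub (cmeasB mf mg) mf.
have -> : L2norm (fun x => f x - g x - f x) = L2norm g; last by [].
rewrite !L2normE; congr (_ `^ _)%E; apply: eq_integral => x _.
by rewrite /nsq !cReB !cImB; congr EFin; ring.
Qed.

Lemma cLfun2B f g : cLfun 2 f -> cLfun 2 g -> cLfun 2 (fun x => f x - g x).
Proof.
move=> /cLfun2_L2norm[mf f2] /cLfun2_L2norm[mg g2]; apply/cLfun2_L2norm; split.
  exact: cmeasB.
by apply: le_lt_trans (L2norm_leB mf mg) _; rewrite lte_add_pinfty.
Qed.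

Lemma L2norm0 : L2norm (fun _ : 'rV[R]_n => 0 : R[i]) = 0%E.
Proof.
apply/eqP; rewrite eq_le L2norm_ge0 andbT; apply/L2norm_le_num => //.
rewrite /energy; under eq_integral do rewrite /nsq/= expr0n/= addr0.
by rewrite integral0 expr0n.
Qed.

Lemma L2norm_subrr f : L2norm (fun x => f x - f x) = 0%E.
Proof. by rewrite -[RHS]L2norm0; congr L2norm; apply/funext => x; rewrite subrr. Qed.

Variables (T : ('rV[R]_n -> R[i]) -> 'rV[R]_n -> R[i]) (c : R).
Hypothesis c_ge0 : 0 <= c.
Hypothesis T_meas : forall f, cLfun 1 f -> cmeas (T f).
Hypothesis T_bound : forall f, cLfun 1 f -> cLfun 2 f ->
  (L2norm (T f) <= c%:E * L2norm f)%E.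
Hypothesis T_sub : forall f g, cLfun 1 f -> cLfun 1 g ->
  T (fun x => f x - g x) = (fun x => T f x - T g x).

Lemma T_L2 f : cLfun 1 f -> cLfun 2 f -> cLfun 2 (T f).
Proof.
move=> f1 f2; apply/cLfun2_L2norm; split; first exact: T_meas.
apply: le_lt_trans (T_bound f1 f2) _.
by rewrite lte_mul_pinfty ?lee_fin// L2norm_fin.
Qed.

Lemma L2_extension_self f : cLfun 1 f -> cLfun 2 f -> L2_extension T f (T f).
Proof.
move=> f1 f2; split => //; first exact: T_L2.
exists (fun=> f); split => //.
  by under eq_fun do rewrite L2norm_subrr; exact: cvg_cst.
by under eq_fun do rewrite L2norm_subrr; exact: cvg_cst.
Qed.

(** The bound holds along the approximating sequences and passes to the limit.
    In particular a value of the extension is unique up to a null set. *)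
Lemma L2_extension_lipschitz u v u' v' :
  L2_extension T u v -> L2_extension T u' v' ->
  (L2norm (fun x => v x - v' x)%R <= c%:E * L2norm (fun x => u x - u' x)%R)%E.
Proof.
move=> [u2 v2 [f_ [f12 fu Tfv]]] [u2' v2' [g_ [g12 gu Tgv]]].
have mu_ := cLfun2_cmeas u2; have mu' := cLfun2_cmeas u2'.
have mv := cLfun2_cmeas v2; have mv' := cLfun2_cmeas v2'.
pose b k : \bar R := (L2norm (fun x => T (f_ k) x - v x)%R +
  (L2norm (fun x => T (g_ k) x - v' x)%R +
   c%:E * (L2norm (fun x => f_ k x - u x)%R + (L2norm (fun x => g_ k x - u' x)%R +
     L2norm (fun x => u x - u' x)%R))))%E.
have ub k : (L2norm (fun x => v x - v' x)%R <= b k)%E.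
  have [f1 f2] := f12 k; have [g1 g2] := g12 k.
  have mf := cLfun2_cmeas f2; have mg := cLfun2_cmeas g2.
  have mTf := T_meas f1; have mTg := T_meas g1.
  apply: le_trans (L2norm_triangleB mv mTf mv') _.
  rewrite L2norm_sub_sym leeD2l//.
  apply: le_trans (L2norm_triangleB mTf mTg mv') _.
  rewrite addeC leeD2l// -T_sub//.
  apply: le_trans (T_bound (cLfun1B f1 g1) (cLfun2B f2 g2)) _.
  rewrite lee_wpmul2l ?lee_fin//.
  apply: le_trans (L2norm_triangleB mf mu_ mg) _; rewrite leeD2l//.
  apply: le_trans (L2norm_triangleB mu_ mu' mg) _.
  by rewrite addeC L2norm_sub_sym.
have ufin : (L2norm (fun x => u x - u' x)%R) \is a fin_num.
  by rewrite ge0_fin_numE ?L2norm_ge0// L2norm_fin//; exact: cLfun2B.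
have cb : b k @[k --> \oo] --> (c%:E * L2norm (fun x => u x - u' x)%R)%E.
  rewrite -[X in _ --> X]add0e; apply: cvgeD => //.
  rewrite -[X in _ --> X]add0e; apply: cvgeD => //.
  apply: cvgeZl => //.
  rewrite -[X in _ --> X]add0e; apply: cvgeD => //.
  rewrite -[X in _ --> X]add0e; apply: cvgeD => //.
  exact: cvg_cst.
rewrite -(cvg_lim _ cb)//; apply: lime_ge; first by apply/cvg_ex; eexists; exact: cb.
exact: nearW.
Qed.

Lemma L2_extension_sub u v u' v' :
  L2_extension T u v -> L2_extension T u' v' ->
  L2_extension T (fun x => u x - u' x) (fun x => v x - v' x).
Proof.
move=> [u2 v2 [f_ [f12 fu Tfv]]] [u2' v2' [g_ [g12 gu Tgv]]].
split; [exact: cLfun2B|exact: cLfun2B|].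
have sub_cvg (p q : nat -> 'rV[R]_n -> R[i]) p' q' :
    (forall k, cmeas (p k)) -> (forall k, cmeas (q k)) -> cmeas p' -> cmeas q' ->
    L2norm (fun x => p k x - p' x) @[k --> \oo] --> 0%E ->
    L2norm (fun x => q k x - q' x) @[k --> \oo] --> 0%E ->
    L2norm (fun x => (p k x - q k x) - (p' x - q' x)) @[k --> \oo] --> 0%E.
  move=> mp mq mp' mq' cp cq.
  apply: (@squeeze_cvge _ _ _ _ (cst 0%E) _ (fun k =>
    L2norm (fun x => p k x - p' x)%R + L2norm (fun x => q k x - q' x)%R)%E).
  - apply: nearW => k; rewrite L2norm_ge0/=.
    have -> : (fun x => (p k x - q k x) - (p' x - q' x)) =
        (fun x => (p k x - p' x) - (q k x - q' x)).
      by apply/funext => x; rewrite !opprB addrACA [in RHS]addrACA [- q k x + _]addrC.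
    by apply: L2norm_leB; exact: cmeasB.
  - exact: cvg_cst.
  - by rewrite -[X in _ --> X]add0e; apply: cvgeD.
exists (fun k x => f_ k x - g_ k x); split.
- by move=> k; have [? ?] := f12 k; have [? ?] := g12 k; split;
    [exact: cLfun1B|exact: cLfun2B].
- by apply: sub_cvg => //; try exact: cLfun2_cmeas; move=> k;
    [have [_ ?] := f12 k|have [_ ?] := g12 k]; exact: cLfun2_cmeas.
- under eq_fun => k.
    rewrite (T_sub (f12 k).1 (g12 k).1); over.
  by apply: sub_cvg => //; try exact: cLfun2_cmeas; move=> k;
    [have [? _] := f12 k|have [? _] := g12 k]; exact: T_meas.
Qed.

Lemma cLfun12_0 : cLfun 1 (fun _ : 'rV[R]_n => 0 : R[i]) /\
  cLfun 2 (fun _ : 'rV[R]_n => 0 : R[i]).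
Proof.
split.
  by apply/cLfun1P; split; exact: integrable0.
apply/cLfun2_L2norm; rewrite L2norm0; split; last exact: ltry.
by split; exact: measurable_cst.
Qed.

Lemma L2_extension_le u v : L2_extension T u v -> (L2norm v <= c%:E * L2norm u)%E.
Proof.
move=> uv; have [z1 z2] := cLfun12_0.
have := T_bound z1 z2; rewrite L2norm0 mule0 => Tz0.
have [u2 v2 _] := uv.
have := L2_extension_lipschitz uv (L2_extension_self z1 z2).
have -> : (fun x => u x - 0) = u by apply/funext => x; rewrite subr0.
move=> le_c; apply: le_trans (L2norm_le_sub (cLfun2_cmeas v2) (T_meas z1)) _.
by apply: le_trans (leeD Tz0 le_c) _; rewrite add0e.
Qed.

(** The images of a fast approximating sequence form a fast Cauchy sequence,
    which has a limit by completeness. *)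
Lemma L2_extension_ex h (f_ : nat -> 'rV[R]_n -> R[i]) : cLfun 2 h ->
  (forall k, cLfun 1 (f_ k) /\ cLfun 2 (f_ k)) ->
  (forall k, (L2norm (fun x => f_ k x - h x)%R <=
     ((2 * (c + 1))^-1 * 4^-1 ^+ k)%:E)%E) ->
  exists v, L2_extension T h v.
Proof.
move=> h2 f12 fh.
have c1 : 0 < c + 1 by rewrite ltr_wpDl.
have mf k : cmeas (f_ k) by apply: cLfun2_cmeas; have [] := f12 k.
have [k|k|v [v2 Tv]] := @L2_complete R n (fun k => T (f_ k)).
- by apply: T_L2; have [] := f12 k.
- have [f1 f2] := f12 k; have [g1 g2] := f12 k.+1.
  rewrite -T_sub//.
  apply: le_trans (T_bound (cLfun1B g1 f1) (cLfun2B g2 f2)) _.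
  (* The factor (2 (c + 1))^-1 in the hypothesis is chosen for the images of
     consecutive functions to be at distance at most 4^-k. *)
  apply: (@le_trans _ _ (c%:E * ((2 * (c + 1))^-1 * 4^-1 ^+ k.+1 +
      (2 * (c + 1))^-1 * 4^-1 ^+ k)%:E)%E).
    rewrite lee_wpmul2l ?lee_fin//.
    apply: le_trans (L2norm_triangleB (mf _) (cLfun2_cmeas h2) (mf _)) _.
    by rewrite EFinD leeD// L2norm_sub_sym.
  rewrite -EFinM lee_fin -mulrDr exprS.
  have p0 : 0 <= 4^-1 ^+ k :> R by exact: exprn_ge0.
  rewrite mulrA [_ * _^-1]mulrC -mulrA ler_pdivrMl ?mulr_gt0//.
  nra.
exists v; split => //; exists f_; split => //.
apply: (@squeeze_cvge _ _ _ _ (cst 0%E) _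
  (fun k => ((2 * (c + 1))^-1 * 4^-1 ^+ k)%:E)).
- by apply: nearW => k; rewrite L2norm_ge0 fh.
- exact: cvg_cst.
- apply: cvg_EFin; first exact: nearW.
  rewrite -[X in _ --> X](mulr0 (2 * (c + 1))^-1).
  apply: cvgM; first exact: cvg_cst.
  by apply: cvg_expr; rewrite gtr0_norm// invf_lt1// ltr1n.
Qed.

End L2_extension_theory.

(** * Continuous functions with bounded support *)

Section continuous_functions.
Variables (R : realType) (n : nat).
Local Notation mu := (@lebR R n).
Local Notation L1 a := (mu.-integrable setT (EFin \o a)).
Implicit Types (a b : 'rV[R]_n -> R).

Let grid k (x : 'rV[R]_n) : 'rV[int]_n :=
  \row_i Num.floor (x ord0 i * k.+1%:R).

Let grid_point k (z : 'rV[int]_n) : 'rV[R]_n := \row_i ((z ord0 i)%:~R / k.+1%:R).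

Let measurable_grid k (z : 'rV[int]_n) : measurable [set x | grid k x = z].
Proof.
rewrite (_ : [set x | _] = \bigcap_(i in [set: 'I_n])
    ((fun v : 'rV[R]_n => v ord0 i) @^-1`
      `[(z ord0 i)%:~R / k.+1%:R, (z ord0 i + 1)%:~R / k.+1%:R[)).
  apply: fin_bigcap_measurable; first exact: finite_finset.
  move=> i _; rewrite -[X in measurable X]setTI.
  by apply: (measurable_coord i) => //; exact: measurable_itv.
have floorE (i : 'I_n) (x : 'rV[R]_n) : ((z ord0 i)%:~R / k.+1%:R <= x ord0 i <
    (z ord0 i + 1)%:~R / k.+1%:R) = (Num.floor (x ord0 i * k.+1%:R) == z ord0 i).
  by rewrite ler_pdivrMr// ltr_pdivlMr// -floor_eq// num_real.
apply/seteqP; split => x /=.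
  by move=> gz i _; rewrite /= in_itv/= floorE -gz mxE.
move=> xz; apply/rowP => i; rewrite mxE; apply/eqP; rewrite -floorE.
by have := xz i I; rewrite /= in_itv.
Qed.

(** The sigma-algebra is generated by the coordinates and not by the open sets.
    A continuous function is the limit of its values at the nearby points of
    finer and finer grids, and these approximations take countably many values,
    each on a union of half-open boxes. *)
Lemma continuous_measurable_rV a : continuous a -> measurable_fun setT a.
Proof.
move=> ca.
apply: (@measurable_fun_cvg _ _ _ _ (fun k x => a (grid_point k (grid k x)))) => //.
- move=> k _ Y mY; rewrite setTI.
  rewrite (_ : _ @^-1` Y = \bigcup_(z : 'rV[int]_n)
      (if a (grid_point k z) \in Y then [set x | grid k x = z] else set0)).
    apply: countable_bigcupT_measurable; first exact: countableP.
    by move=> z; case: ifP => _ //; exact: measurable_grid.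
  apply/seteqP; split => x /=.
    by move=> Yx; exists (grid k x) => //; rewrite mem_set.
  by move=> [z _]; case: ifPn => //= Yz xz; move: Yz; rewrite inE xz.
- move=> x _; suff cx : grid_point k (grid k x) @[k --> \oo] --> x.
    exact: (cvg_comp _ _ cx (ca x)).
  apply/cvg_ballP => e e0.
  have /cvgr0Pnorm_lt/(_ e e0)[N _ Ne] := @cvg_harmonic R.
  exists N => // k /= Nk; rewrite /ball/=; split => // i j; rewrite ord1 !mxE.
  apply: le_lt_trans (Ne k Nk).
  have k0 : 0 < k.+1%:R :> R by [].
  rewrite /harmonic/= (@ger0_norm _ k.+1%:R^-1) ?invr_ge0//.
  set y := x ord0 j * k.+1%:R; have xy : x ord0 j = y / k.+1%:R by rewrite mulfK.
  have [f1 f2] : (Num.floor y)%:~R <= y /\ y < (Num.floor y)%:~R + 1.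
    by split; [exact: floor_le|rewrite -intrD1 floorD1_gt].
  rewrite [x _ _]xy -mulrBl normrM normfV (ger0_norm (ltW k0)).
  rewrite -[leRHS]mul1r ler_pM2r ?invr_gt0// ger0_norm ?subr_ge0//.
  by rewrite lerBlDr addrC ltW.
Qed.

(** A sufficient condition for integrability that, unlike integrability itself,
    passes to the restrictions to coordinate hyperplanes. *)
Definition bounded_support (g : 'rV[R]_n -> R) :=
  [/\ measurable_fun setT g, exists B, forall x, `|g x| <= B &
      exists M, forall x, ~ cube M x -> g x = 0].

Lemma bounded_support_L1 (g : 'rV[R]_n -> R) : bounded_support g -> L1 g.
Proof.
move=> [mg [B gB] [M gM]].
have mC := @measurable_cube R n M.
have i1 : L1 (\1_(cube M) : 'rV[R]_n -> R).
  apply/integrableP; split; first exact/measurable_EFinP/measurable_indic.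
  under eq_integral do rewrite gee0_abs ?lee_fin//.
  by rewrite integral_indic// setIT; exact: cube_finite.
have := bounded_mul_integrable i1 mg gB.
apply: eq_integrable => // x _ /=; rewrite indicE.
have [cx|ncx] := pselect (cube M x); first by rewrite mem_set// mul1r.
by rewrite gM// mulr0.
Qed.

(** The space C_c(R^n); compactness of the support is expressed by its being
    contained in a cube. *)
Definition cc a := continuous a /\ exists M, forall x, ~ cube M x -> a x = 0.

Lemma norm_rV_le (x : 'rV[R]_n) B : 0 <= B ->
  (forall i, `|x ord0 i| <= B) -> `|x| <= B.
Proof.
move=> B0 xB; rewrite -[`|x|]/(mx_norm x) mx_normrE; apply: bigmax_le => //=.
by move=> [i j] _ /=; rewrite ord1.
Qed.

Lemma coord_le_norm (x : 'rV[R]_n) i : `|x ord0 i| <= `|x|.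
Proof.
rewrite -[`|x|]/(mx_norm x) mx_normrE.
exact: (le_bigmax _ (fun j : 'I_1 * 'I_n => `|x j.1 j.2|) (ord0, i)).
Qed.

Lemma cube_bounded_closed M : bounded_set (@cube R n M) /\ closed (@cube R n M).
Proof.
split.
  exists `|M|; split; first exact: num_real.
  move=> B MB x cx; apply: norm_rV_le.
    by rewrite (le_trans (normr_ge0 M))// ltW.
  by move=> j; rewrite (le_trans (cx j))// (le_trans (ler_norm M))// ltW.
rewrite (_ : cube M = \bigcap_(i in [set: 'I_n])
    (fun v : 'rV[R]_n => `|v ord0 i|) @^-1` [set t | t <= M]).
  apply: closed_bigI => i _.
  apply: preimage_closed; last exact: closed_le.
  move=> x _; apply: continuous_comp; first exact: coord_continuous.
  exact: norm_continuous.
by apply/seteqP; split => x cx i; [move=> _|]; exact: cx.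
Qed.

Lemma cc_bounded a : cc a -> exists B, forall x, `|a x| <= B.
Proof.
move=> [ca [M aM]]; have [bM clM] := cube_bounded_closed M.
have : compact (a @` cube M).
  apply: continuous_compact; last exact: bounded_closed_compact.
  exact: continuous_subspaceT.
move=> /compact_bounded[B [_ aB]]; exists (`|B| + 1) => x.
have [cx|/aM ->] := pselect (cube M x); last by rewrite normr0 addr_ge0.
by apply: aB; [rewrite (le_lt_trans (ler_norm B))// ltrDl|exists x].
Qed.

Lemma cc_measurable a : cc a -> measurable_fun setT a.
Proof. by move=> [ca _]; exact: continuous_measurable_rV. Qed.

Lemma cc_L1 a : cc a -> L1 a.
Proof.
move=> cca; apply: bounded_support_L1; split; first exact: cc_measurable.
  exact: cc_bounded.
exact: cca.2.
Qed.

Lemma ccM a b : continuous a -> cc b -> cc (fun x => a x * b x).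
Proof.
move=> ca [cb [M bM]]; split.
  by move=> x; exact: (cvgM (ca x) (cb x)).
by exists M => x /bM ->; rewrite mulr0.
Qed.

Lemma cc_L1_sqr a : cc a -> L1 (fun x => a x ^+ 2).
Proof. by move=> cca; apply: cc_L1; apply: (ccM cca.1 cca). Qed.

Definition ccc (f : 'rV[R]_n -> R[i]) :=
  cc (fun x => cRe (f x)) /\ cc (fun x => cIm (f x)).

Lemma ccc_cLfun1 f : ccc f -> cLfun 1 f.
Proof. by move=> [f1 f2]; apply/cLfun1P; split; exact: cc_L1. Qed.

Lemma ccc_cLfun2 f : ccc f -> cLfun 2 f.
Proof.
move=> [f1 f2]; apply/cLfun2P; split.
  by split; exact: cc_measurable.
have i1 := cc_L1_sqr f1; have i2 := cc_L1_sqr f2.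
have /integrableP[_] := integrableD measurableT i1 i2.
rewrite /energy; under eq_integral do rewrite gee0_abs ?lee_fin ?addr_ge0 ?sqr_ge0//.
by [].
Qed.

End continuous_functions.

(** * The Fourier-Plancherel transform and its inverse *)

Section fourier_plancherel.
Variables (R : realType) (n : nat).
Local Notation mu := (@lebR R n).
Local Notation L1 a := (mu.-integrable setT (EFin \o a)).
Local Notation kappa := ((2 * @pi R) ^+ n).
Local Open Scope complex_scope.
Implicit Types (f g h u v : 'rV[R]_n -> R[i]).

Lemma kappa_gt0 : 0 < kappa.
Proof. by rewrite exprn_gt0// mulr_gt0// pi_gt0. Qed.

Lemma complex_ext (z w : R[i]) : cRe z = cRe w -> cIm z = cIm w -> z = w.
Proof. by case: z => a b; case: w => c d /= -> ->. Qed.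

Lemma cosTB a b xi : L1 a -> L1 b ->
  cosT (fun x => a x - b x) xi = cosT a xi - cosT b xi :> R.
Proof.
move=> ia ib; rewrite /cosT -RintegralB//; try exact: integrable_cos.
by apply: eq_Rintegral => x _; rewrite mulrBl.
Qed.

Lemma sinTB a b xi : L1 a -> L1 b ->
  sinT (fun x => a x - b x) xi = sinT a xi - sinT b xi :> R.
Proof.
move=> ia ib; rewrite /sinT -RintegralB//; try exact: integrable_sin.
by apply: eq_Rintegral => x _; rewrite mulrBl.
Qed.

Lemma oftB (s : R) f g : s = 1 \/ s = -1 -> cLfun 1 f -> cLfun 1 g ->
  oft s (fun x => f x - g x) = fun xi => oft s f xi - oft s g xi.
Proof.
move=> hs f1 g1; have fg1 := cLfun1B f1 g1; apply/funext => xi.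
have [fa fb] := (cLfun1P _).1 f1; have [ga gb] := (cLfun1P _).1 g1.
have [ha hb] := (cLfun1P _).1 fg1.
have [r0 i0] := oftE hs xi ha hb.
have [r1 i1] := oftE hs xi fa fb; have [r2 i2] := oftE hs xi ga gb.
have reE : (fun x => cRe (f x - g x)) = (fun x => cRe (f x) - cRe (g x)).
  by apply/funext => x; rewrite cReB.
have imE : (fun x => cIm (f x - g x)) = (fun x => cIm (f x) - cIm (g x)).
  by apply/funext => x; rewrite cImB.
apply: complex_ext; rewrite ?cReB ?cImB.
- by rewrite r0 r1 r2 reE imE cosTB// sinTB//; ring.
- by rewrite i0 i1 i2 reE imE cosTB// sinTB//; ring.
Qed.

Lemma L2normZ (r : R) f : 0 <= r -> cmeas f ->
  L2norm (fun x => r%:C * f x) = (r%:E * L2norm f)%E.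
Proof.
move=> r0 mf; rewrite !L2normE.
have -> : energy (fun x => r%:C * f x) = ((r ^+ 2)%:E * energy f)%E.
  rewrite /energy; under eq_integral do rewrite nsqZ EFinM.
  rewrite ge0_integralZl//.
  - by apply/measurable_EFinP; exact: measurable_nsq.
  - by move=> x _; rewrite lee_fin nsq_ge0.
  - by rewrite lee_fin sqr_ge0.
rewrite poweRM ?energy_ge0 ?lee_fin ?sqr_ge0//; congr (_ * _)%E.
by rewrite poweR_EFin -powR_mulrn// -powRrM mulfV// powRr1.
Qed.

Lemma L2norm_oft_le (s : R) f : s = 1 \/ s = -1 -> cLfun 1 f -> cLfun 2 f ->
  (L2norm (oft s f) <= (Num.sqrt kappa)%:E * L2norm f)%E.
Proof.
move=> hs f1 f2; apply/L2norm_leP; first exact: sqrtr_ge0.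
by rewrite sqr_sqrtr ?kappa_ge0//; exact: plancherel_le.
Qed.

Lemma energy_oft_ge (s : R) f : s = 1 \/ s = -1 -> ccc f ->
  (kappa%:E * energy f <= energy (oft s f))%E.
Proof.
move=> hs cf; have [B1 ReB] := cc_bounded cf.1; have [B2 ImB] := cc_bounded cf.2.
apply: (@plancherel_ge _ _ s hs f (Num.max B1 B2)).
- exact: ccc_cLfun1.
- exact: ccc_cLfun2.
- exact: cf.1.1.
- exact: cf.2.1.
- by move=> x; rewrite le_max ReB.
- by move=> x; rewrite le_max ImB orbT.
Qed.

Lemma L2norm_oft_ge (s : R) f : s = 1 \/ s = -1 -> ccc f ->
  ((Num.sqrt kappa)%:E * L2norm f <= L2norm (oft s f))%E.
Proof.
move=> hs cf; rewrite !L2normE.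
have -> : (Num.sqrt kappa)%:E = (kappa%:E `^ 2^-1)%E.
  by rewrite poweR_EFin powR12_sqrt// kappa_ge0.
rewrite -poweRM ?lee_fin ?kappa_ge0 ?energy_ge0//.
apply: gt0_ler_poweR => //; rewrite ?in_itv/= ?leey ?andbT ?energy_ge0//.
  by rewrite mule_ge0 ?lee_fin ?kappa_ge0 ?energy_ge0.
exact: energy_oft_ge.
Qed.

Let h1 : (1 : R) = 1 \/ (1 : R) = -1. Proof. by left. Qed.
Let hN1 : (-1 : R) = 1 \/ (-1 : R) = -1. Proof. by right. Qed.

Lemma cmeas_fourier_integral f : cLfun 1 f -> cmeas (fourier_integral f).
Proof. by rewrite fourier_integralE; exact: cmeas_oft. Qed.

Lemma fourier_integral_le f : cLfun 1 f -> cLfun 2 f ->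
  (L2norm (fourier_integral f) <= (Num.sqrt kappa)%:E * L2norm f)%E.
Proof. by rewrite fourier_integralE; exact: L2norm_oft_le. Qed.

Lemma fourier_integralB f g : cLfun 1 f -> cLfun 1 g ->
  fourier_integral (fun x => f x - g x) =
  fun x => fourier_integral f x - fourier_integral g x.
Proof. by rewrite !fourier_integralE; exact: oftB. Qed.

(** The factor (2 pi)^-n is that of the definition of the inverse transform, the
    square root comes from Plancherel's theorem. *)
Local Notation inv_cst := (kappa^-1 * Num.sqrt kappa).

Lemma inv_cst_gt0 : 0 < inv_cst.
Proof. by rewrite mulr_gt0 ?invr_gt0 ?sqrtr_gt0 ?kappa_gt0. Qed.

Lemma cmeas_inv_fourier_integral f : cLfun 1 f -> cmeas (inv_fourier_integral f).
Proof.
move=> f1; rewrite inv_fourier_integralE; apply: cmeasZ => //.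
exact: cmeas_oft.
Qed.

Lemma inv_fourier_integral_le f : cLfun 1 f -> cLfun 2 f ->
  (L2norm (inv_fourier_integral f) <= inv_cst%:E * L2norm f)%E.
Proof.
move=> f1 f2; rewrite inv_fourier_integralE L2normZ; last 2 first.
- by rewrite invr_ge0 kappa_ge0.
- exact: cmeas_oft.
rewrite EFinM -muleA lee_wpmul2l ?lee_fin ?invr_ge0 ?kappa_ge0//.
exact: L2norm_oft_le.
Qed.

Lemma inv_fourier_integral_ge f : ccc f ->
  (inv_cst%:E * L2norm f <= L2norm (inv_fourier_integral f))%E.
Proof.
move=> cf; have f1 := ccc_cLfun1 cf.
rewrite inv_fourier_integralE L2normZ; last 2 first.
- by rewrite invr_ge0 kappa_ge0.
- exact: cmeas_oft.
rewrite EFinM -muleA lee_wpmul2l ?lee_fin ?invr_ge0 ?kappa_ge0//.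
exact: L2norm_oft_ge.
Qed.

Lemma inv_fourier_integralB f g : cLfun 1 f -> cLfun 1 g ->
  inv_fourier_integral (fun x => f x - g x) =
  fun x => inv_fourier_integral f x - inv_fourier_integral g x.
Proof.
move=> f1 g1; rewrite !inv_fourier_integralE oftB//.
by apply/funext => x; rewrite mulrBr.
Qed.

Lemma fourierP u : (exists v, L2_extension (@fourier_integral R n) u v) ->
  L2_extension (@fourier_integral R n) u (fourier u).
Proof. by move=> [v uv]; exact: (xgetPex _ (ex_intro _ v uv)). Qed.

(** Both terms of the difference are values of the extension at u - phi, hence
    equal almost everywhere; they need not be equal as functions, since
    [fourier] chooses its values. *)
Lemma fourierB_test u phi : ccc phi ->
  (exists v, L2_extension (@fourier_integral R n) u v) ->
  L2norm (fun x => fourier (fun y => u y - phi y) x -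
    (fourier u x - fourier_integral phi x)) = 0%E /\
  cLfun 2 (fourier (fun y => u y - phi y)).
Proof.
move=> cphi /fourierP uv.
have phiv := L2_extension_self (sqrtr_ge0 kappa) cmeas_fourier_integral
  fourier_integral_le (ccc_cLfun1 cphi) (ccc_cLfun2 cphi).
have sv := L2_extension_sub cmeas_fourier_integral fourier_integralB uv phiv.
have sv' := fourierP (ex_intro _ _ sv); split; last by have [] := sv'.
apply/eqP; rewrite eq_le L2norm_ge0 andbT.
apply: le_trans (L2_extension_lipschitz (sqrtr_ge0 kappa) cmeas_fourier_integral
  fourier_integral_le fourier_integralB sv' sv) _.
by rewrite L2norm_subrr mule0.
Qed.

(** Where the extension has no value the inverse transform is 0, so the bound
    holds for every g. *)
Lemma inv_fourier_le g : (L2norm (inv_fourier g) <= inv_cst%:E * L2norm g)%E.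
Proof.
have [ex|nex] := pselect (exists v, L2_extension (@inv_fourier_integral R n) g v).
  have := xgetPex (fun=> 0) ex; rewrite -/(inv_fourier g) => gv.
  exact: (L2_extension_le (ltW inv_cst_gt0) cmeas_inv_fourier_integral
    inv_fourier_integral_le inv_fourier_integralB gv).
have -> : inv_fourier g = fun=> 0.
  by rewrite /inv_fourier xgetPN// => v gv; apply: nex; exists v.
by rewrite L2norm0 mule_ge0 ?L2norm_ge0// lee_fin ltW// inv_cst_gt0.
Qed.

(** The approximation of h by functions of C_c serves twice: it provides a value
    of the extension at h, and it carries the lower bound of Plancherel's
    theorem, known for C_c, over to h. *)
Lemma inv_fourier_ge h : cLfun 2 h ->
  (forall d : R, 0 < d -> exists2 f, ccc f & (L2norm (fun x => f x - h x)%R <= d%:E)%E) ->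
  (inv_cst%:E * L2norm h <= L2norm (inv_fourier h))%E.
Proof.
move=> h2 happrox; have c0 := inv_cst_gt0; set c := inv_cst in c0 *.
have d0 k : 0 < (2 * (c + 1))^-1 * 4^-1 ^+ k.
  by rewrite mulr_gt0 ?invr_gt0 ?mulr_gt0 ?exprn_gt0 ?invr_gt0// addr_gt0.
have /choice[f_ fP] : forall k, exists f, ccc f /\
    (L2norm (fun x => f x - h x)%R <= ((2 * (c + 1))^-1 * 4^-1 ^+ k)%:E)%E.
  move=> k; have [f ? ?] := happrox _ (d0 k).
  by exists f.
have ex := @L2_extension_ex _ _ _ _ (ltW c0) cmeas_inv_fourier_integral
  inv_fourier_integral_le inv_fourier_integralB h f_ h2
  (fun k => conj (ccc_cLfun1 (fP k).1) (ccc_cLfun2 (fP k).1)) (fun k => (fP k).2).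
have := xgetPex (fun=> 0) ex; rewrite -/(inv_fourier h) => hv.
have [_ v2 _] := hv.
apply/lee_addgt0Pr => e e0.
(* Each of the two approximation errors below is then at most e / 2. *)
have ec : 0 < e / (2 * c) by rewrite divr_gt0// mulr_gt0.
have [f cf fh] := happrox _ ec.
have f1 := ccc_cLfun1 cf; have f2 := ccc_cLfun2 cf.
have mf := cLfun2_cmeas f2; have mh := cLfun2_cmeas h2; have mv := cLfun2_cmeas v2.
have fv := L2_extension_self (ltW c0) cmeas_inv_fourier_integral
  inv_fourier_integral_le f1 f2.
have lip := L2_extension_lipschitz (ltW c0) cmeas_inv_fourier_integral
  inv_fourier_integral_le inv_fourier_integralB fv hv.
have mTf := cmeas_inv_fourier_integral f1.
have cle (x : \bar R) : (x <= (e / (2 * c))%:E)%E -> (c%:E * x <= (e / 2)%:E)%E.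
  move=> xe; apply: (@le_trans _ _ (c%:E * (e / (2 * c))%:E)%E).
    by rewrite lee_wpmul2l// lee_fin ltW.
  by rewrite -EFinM lee_fin le_eqVlt; apply/orP; left; apply/eqP; field; rewrite gt_eqF.
apply: (@le_trans _ _ (c%:E * (L2norm f + L2norm (fun x => h x - f x)%R))%E).
  by rewrite lee_wpmul2l ?lee_fin ?(ltW c0)//; exact: L2norm_le_sub.
rewrite ge0_muleDr ?L2norm_ge0//.
apply: (@le_trans _ _ (L2norm (inv_fourier_integral f) + (e / 2)%:E)%E).
  apply: leeD; first exact: inv_fourier_integral_ge.
  by apply: cle; rewrite L2norm_sub_sym.
have -> : e%:E = ((e / 2)%:E + (e / 2)%:E)%E by rewrite -EFinD -splitr.
rewrite addeA leeD2r//.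
apply: le_trans (L2norm_le_sub mTf mv) _; rewrite leeD2l//.
by apply: le_trans lip _; exact: cle.
Qed.

End fourier_plancherel.

(** * Integration along lines *)

Section lines.
Variable R : realType.
Local Notation leb := (@lebesgue_measure R).

Local Notation ej n j := (delta_mx ord0 j : 'rV[R]_n).

Lemma bounded_support_L1_line (h : R -> R) (B M : R) : measurable_fun setT h ->
  (forall t, `|h t| <= B) -> (forall t, ~ (`|t| <= M) -> h t = 0) ->
  leb.-integrable setT (EFin \o h).
Proof.
move=> mh hB hM.
have i1 : leb.-integrable setT (EFin \o (\1_(`[- M, M]) : R -> R)).
  apply/integrableP; split; first exact/measurable_EFinP/measurable_indic.
  under eq_integral do rewrite gee0_abs ?lee_fin//.
  rewrite integral_indic// setIT/= lebesgue_measure_itv/=.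
  by case: ifP => _; rewrite ltry.
have := bounded_mul_integrable i1 mh hB.
apply: eq_integrable => // t _ /=; rewrite indicE.
have [tM|tM] := pselect (`|t| <= M).
  by rewrite mem_set ?mul1r//= in_itv/= -ler_norml.
by rewrite hM// mulr0.
Qed.

Lemma row_rcons_lastE n (v : 'rV[R]_n) (t : R) :
  row_rcons (v, t) = row_rcons (v, 0) + t *: ej n.+1 ord_max.
Proof.
apply/rowP => i; case: (unliftP ord_max i) => [k ->|->].
  by rewrite !mxE liftK /= eq_sym (negbTE (neq_lift _ _)) mulr0 addr0.
by rewrite !mxE unlift_none /= eqxx mulr1 add0r.
Qed.

Lemma row_rcons_liftE n (v : 'rV[R]_n) (t s : R) (j : 'I_n) :
  row_rcons (v + s *: ej n j, t) = row_rcons (v, t) + s *: ej n.+1 (lift ord_max j).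
Proof.
apply/rowP => i; case: (unliftP ord_max i) => [k ->|->].
  by rewrite !mxE liftK !mxE /= (inj_eq lift_inj).
by rewrite !mxE unlift_none /= (negbTE (neq_lift _ _)) mulr0 addr0.
Qed.

Lemma cube_rcons n M (v : 'rV[R]_n) (t : R) :
  cube M (row_rcons (v, t)) -> cube M v /\ `|t| <= M.
Proof.
move=> c; split; last by have := c ord_max; rewrite row_rconsE.
by move=> i; have := c (lift ord_max i); rewrite row_rconsE.
Qed.

Lemma measurable_rcons1 n (t : R) :
  measurable_fun setT (fun v : 'rV[R]_n => row_rcons (v, t)).
Proof. exact: (measurableT_comp (@measurable_row_rcons R n) (pair2_measurable t)). Qed.

Lemma measurable_rcons2 n (v : 'rV[R]_n) :
  measurable_fun setT (fun t : R => row_rcons (v, t)).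
Proof. exact: (measurableT_comp (@measurable_row_rcons R n) (pair1_measurable v)). Qed.

(** Fubini's theorem with the coordinate j innermost. The recursion peels off
    the last coordinate until it is the j-th one. *)
Lemma Rintegral_lines0 n (j : 'I_n) (g : 'rV[R]_n -> R) : bounded_support g ->
  (forall x, \int[leb]_t g (x + t *: ej n j) = 0) -> \int[@lebR R n]_x g x = 0.
Proof.
elim: n j g => [[]//|n IH] j g bg g0.
have ig := bounded_support_L1 bg.
have [mg [B gB] [M gM]] := bg.
case: (unliftP ord_max j) => [j' jE|jE]; rewrite {j}jE in g0.
  have inner0 (t : R) : (\int[@lebR R n]_v (g (row_rcons (v, t)))%:E = 0)%E.
    have bgt : bounded_support (fun v => g (row_rcons (v, t))).
      split; first by apply: (measurableT_comp mg); exact: measurable_rcons1.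
        by exists B => v; exact: gB.
      by exists M => v ncv; apply: gM => /cube_rcons[].
    have fin := integrable_fin_num measurableT (bounded_support_L1 bgt).
    rewrite -[LHS](fineK fin) -/(Rintegral _ _ _) (IH j')// => x.
    by under eq_Rintegral do rewrite row_rcons_liftE; exact: g0.
  rewrite /Rintegral integral_rVS_swap//.
  by under eq_integral do rewrite inner0; rewrite integral0.
rewrite Rintegral_rVS//; last first.
  move=> v; apply: (@bounded_support_L1_line _ B M).
  - by apply: (measurableT_comp mg); exact: measurable_rcons2.
  - by move=> t; exact: gB.
  - by move=> t nt; apply: gM => /cube_rcons[].
under eq_Rintegral => v _.
  under eq_Rintegral do rewrite row_rcons_lastE.
  rewrite g0; over.
by rewrite /Rintegral integral0.
Qed.

(** The fundamental theorem of calculus on an interval that contains the support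
    in its interior. *)
Lemma Rintegral_derive0 (F f : R -> R) (M : R) :
  (forall t : R, is_derive t 1 F (f t)) -> continuous f ->
  (forall t, ~ (`|t| <= M) -> F t = 0 /\ f t = 0) ->
  \int[leb]_t f t = 0.
Proof.
move=> dF cf FM; pose N : R := `|M| + 1.
have N0 : 0 < N by rewrite ltr_wpDl.
have MN : M < N by rewrite (le_lt_trans (ler_norm M))// ltrDl.
have cF : continuous F.
  move=> t; apply: differentiable_continuous; apply/derivable1_diffP.
  by apply: ex_derive; exact: dF.
have := @continuous_FTC2 R f F (- N) N.
have [FN _] : F N = 0 /\ f N = 0 by apply: FM; rewrite gtr0_norm// leNgt MN.
have [FN' _] : F (- N) = 0 /\ f (- N) = 0.
  by apply: FM; rewrite normrN gtr0_norm// leNgt MN.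
rewrite FN FN' subee// => FTC.
rewrite /Rintegral (_ : (\int[leb]_t (f t)%:E =
    \int[leb]_(t in `[(- N)%R, N]) (f t)%:E)%E); last first.
  rewrite [RHS]integral_mkcond; apply: eq_integral => t _; rewrite patchE.
  case: ifPn => //; rewrite notin_setE/= in_itv/= -ler_norml => tN.
  have [//|_ ->//] := FM t _; move=> tM; apply: tN; rewrite (le_trans tM)//.
  exact: ltW.
rewrite FTC//; first by rewrite gtrN.
- exact: continuous_subspaceT.
- split; first by move=> t _; apply: ex_derive; exact: dF.
    by apply: cvg_at_right_filter; exact: cF.
  by apply: cvg_at_left_filter; exact: cF.
- by move=> t _; rewrite derive1E; apply: derive_val; exact: dF.
Qed.

Lemma is_derive_line n (a : 'rV[R]_n -> R) (x v : 'rV[R]_n) (t : R) :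
  derivable a (x + t *: v) v ->
  is_derive t 1 (fun s => a (x + s *: v)) ('D_v a (x + t *: v)).
Proof.
move=> da.
have E : (fun h : R =>
    h^-1 *: (((fun s : R => a (x + s *: v)) \o shift t) (h *: (1 : R)) -
      a (x + t *: v))) =
  (fun h : R => h^-1 *: ((a \o shift (x + t *: v)) (h *: v) - a (x + t *: v))).
  apply/funext => h /=; congr (_ *: (a _ - _)).
  by rewrite /GRing.scale/= mulr1 -/(GRing.scale _ _) scalerDl addrCA.
split; first by rewrite /derivable E.
by rewrite /derive E.
Qed.

End lines.

(** * Integration by parts against sines and cosines *)

Section test_functions.
Variables (R : realType) (n : nat).
Local Notation mu := (@lebR R n).
Local Notation L1 a := (mu.-integrable setT (EFin \o a)).
Local Notation ej j := (delta_mx ord0 j : 'rV[R]_n).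

(** The regularity of test functions that integration by parts uses. *)
Definition C1c (a : 'rV[R]_n -> R) := cc a /\
  forall j, (forall x, derivable a x (ej j)) /\ cc (partial j a).

Lemma dotp_line (x xi : 'rV[R]_n) (t : R) j :
  dotp (x + t *: ej j) xi = dotp x xi + t * xi ord0 j.
Proof.
rewrite /dotp.
under eq_bigr do rewrite !mxE mulrDl.
rewrite big_split/=; congr (_ + _).
rewrite (bigD1 j)//= eqxx mulr1 big1 ?addr0// => i /negbTE ij.
by rewrite eq_sym in ij; rewrite eq_sym ij mulr0 mul0r.
Qed.

Lemma continuous_line (a : 'rV[R]_n -> R) (x v : 'rV[R]_n) : continuous a ->
  continuous (fun t : R => a (x + t *: v)).
Proof.
move=> ca t; suff ct : x + s *: v @[s --> t] --> x + t *: v.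
  exact: (cvg_comp _ _ ct (ca _)).
by apply: cvgD; [exact: cvg_cst|apply: cvgZr_tmp; exact: cvg_id].
Qed.

(** Along each line of direction j the sum of the integrands of both sides is
    the derivative of a(x) h(x.xi), which has bounded support. *)
Lemma trig_by_parts (a : 'rV[R]_n -> R) (h h' : R -> R) xi j : C1c a ->
  (forall s : R, is_derive s 1 h (h' s)) -> continuous h' ->
  (forall s, `|h s| <= 1) -> (forall s, `|h' s| <= 1) ->
  \int[mu]_x (partial j a x * h (dotp x xi)) =
  - (xi ord0 j * \int[mu]_x (a x * h' (dotp x xi))).
Proof.
move=> [cca /(_ j)[da ccp]] dh ch' h1 h1'.
have ch : continuous h.
  move=> t; apply: differentiable_continuous; apply/derivable1_diffP.
  by apply: ex_derive; exact: dh.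
have mdot : measurable_fun setT (fun x => dotp x xi) by exact: measurable_dotp.
have mh : measurable_fun setT (fun x => h (dotp x xi)).
  exact: (measurableT_comp (continuous_measurable_fun ch) mdot).
have mh' : measurable_fun setT (fun x => h' (dotp x xi)).
  exact: (measurableT_comp (continuous_measurable_fun ch') mdot).
have i1 : L1 (fun x => partial j a x * h (dotp x xi)).
  by apply: (bounded_mul_integrable (C := 1)) => //; exact: cc_L1.
have i2 : L1 (fun x => a x * h' (dotp x xi)).
  by apply: (bounded_mul_integrable (C := 1)) => //; exact: cc_L1.
have i2' := integrableZl measurableT (xi ord0 j) i2.
pose g x := partial j a x * h (dotp x xi) + xi ord0 j * (a x * h' (dotp x xi)).
suff : \int[mu]_x g x = 0.
  rewrite /g RintegralD// RintegralZl// => /eqP.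
  by rewrite addr_eq0 => /eqP.
have [B1 aB] := cc_bounded cca; have [B2 pB] := cc_bounded ccp.
have [M1 aM] := cca.2; have [M2 pM] := ccp.2.
have cube_sub (M M' : R) (x : 'rV[R]_n) : M <= M' -> cube M x -> cube M' x.
  by move=> MM cx i; rewrite (le_trans (cx i)).
apply: (@Rintegral_lines0 _ _ j) => [|x].
  split.
  - apply: measurable_funD; first by apply: measurable_funM => //; exact: cc_measurable.
    by apply: measurable_funM => //; apply: measurable_funM => //; exact: cc_measurable.
  - exists (B2 + `|xi ord0 j| * B1) => x; rewrite (le_trans (ler_normD _ _))//.
    apply: lerD; first by rewrite normrM (le_trans (ler_piMr _ _)).
    by rewrite !normrM ler_wpM2l// (le_trans (ler_piMr _ _)).
  - exists (Num.max M1 M2) => x nc; rewrite /g aM ?pM ?mul0r ?mulr0 ?addr0//.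
      by move=> cx; apply: nc; apply: cube_sub cx; rewrite le_max lexx orbT.
    by move=> cx; apply: nc; apply: cube_sub cx; rewrite le_max lexx.
pose F t := a (x + t *: ej j) * h (dotp x xi + t * xi ord0 j).
apply: (@Rintegral_derive0 _ F _ (Num.max M1 M2 + `|x ord0 j|)).
- move=> t; rewrite /g dotp_line.
  have dl := is_derive_line (da (x + t *: ej j)).
  have dht : is_derive t 1 (fun s => h (dotp x xi + s * xi ord0 j))
      (h' (dotp x xi + t * xi ord0 j) * xi ord0 j).
    have di : is_derive t 1 (fun s : R => dotp x xi + s * xi ord0 j) (xi ord0 j).
      by apply: is_derive_eq; rewrite /GRing.scale/=; ring.
    by apply: is_derive_eq; rewrite /GRing.scale/= mulrC.
  rewrite /F; apply: is_derive_eq; rewrite /GRing.scale/= /partial; ring.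
- move=> t; rewrite /g.
  under eq_fun do rewrite dotp_line.
  have ctr (k : R -> R) : continuous k ->
      k (dotp x xi + s * xi ord0 j) @[s --> t] --> k (dotp x xi + t * xi ord0 j).
    move=> ck; apply: (@cvg_comp _ _ _ _ k _ (nbhs (dotp x xi + t * xi ord0 j))) => //.
      by apply: cvgD; [exact: cvg_cst|apply: cvgM; [exact: cvg_id|exact: cvg_cst]].
    exact: ck.
  have cp := continuous_line (x := x) (v := ej j) ccp.1.
  have cl := continuous_line (x := x) (v := ej j) cca.1.
  exact: (cvgD (cvgM (cp t) (ctr _ ch))
    (cvgM (cvg_cst (xi ord0 j)) (cvgM (cl t) (ctr _ ch')))).
- move=> t nt.
  have nc : ~ cube (Num.max M1 M2) (x + t *: ej j).
    move=> /(_ j); rewrite !mxE !eqxx/= mulr1 => xt; apply: nt.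
    have -> : t = (x ord0 j + t) - x ord0 j by ring.
    by rewrite (le_trans (ler_normB _ _))// lerD.
  have a0 : a (x + t *: ej j) = 0.
    by apply: aM => cx; apply: nc; apply: cube_sub cx; rewrite le_max lexx.
  have p0 : partial j a (x + t *: ej j) = 0.
    by apply: pM => cx; apply: nc; apply: cube_sub cx; rewrite le_max lexx orbT.
  by rewrite /F /g a0 p0 !mul0r mulr0 addr0.
Qed.

Lemma cosT_partial a xi j : C1c a -> cosT (partial j a) xi = xi ord0 j * sinT a xi.
Proof.
move=> ca; rewrite /cosT (@trig_by_parts a cos (fun s => - sin s))//.
- have -> : \int[mu]_x (a x * - sin (dotp x xi)) =
      \int[mu]_x (-1 * (a x * sin (dotp x xi))).
    by apply: eq_Rintegral => x _; ring.
  by rewrite RintegralZl ?mulN1r ?mulrN ?opprK//; apply/integrable_sin/cc_L1/ca.1.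
- by move=> s; apply: cvgN; exact: continuous_sin.
- exact: cos_max.
- by move=> s; rewrite normrN sin_max.
Qed.

Lemma sinT_partial a xi j : C1c a -> sinT (partial j a) xi = - (xi ord0 j * cosT a xi).
Proof.
move=> ca; rewrite /sinT (@trig_by_parts a sin cos)//.
- exact: continuous_cos.
- exact: sin_max.
- exact: cos_max.
Qed.

Lemma cos_lipschitz (s t : R) : `|cos s - cos t| <= `|s - t|.
Proof.
wlog st : s t / s <= t.
  by move=> H; have [/H//|/ltW/H] := leP s t; rewrite distrC [X in _ <= X -> _]distrC.
rewrite distrC [leRHS]distrC.
have [//|c _ ->] := @MVT_segment R cos (fun u => - sin u) s t st.
  by apply: continuous_subspaceT; exact: continuous_cos.
by rewrite normrM ler_piMl// normrN sin_max.
Qed.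

Lemma sin_lipschitz (s t : R) : `|sin s - sin t| <= `|s - t|.
Proof.
wlog st : s t / s <= t.
  by move=> H; have [/H//|/ltW/H] := leP s t; rewrite distrC [X in _ <= X -> _]distrC.
rewrite distrC [leRHS]distrC.
have [//|c _ ->] := @MVT_segment R sin cos s t st.
  by apply: continuous_subspaceT; exact: continuous_sin.
by rewrite normrM ler_piMl// cos_max.
Qed.

Lemma lipschitz_continuous (V : normedModType R) (f : V -> R) (K : R) : 0 <= K ->
  (forall x y, `|f x - f y| <= K * `|x - y|) -> continuous f.
Proof.
move=> K0 lip x; apply/cvgrPdist_le => /= e e0.
near=> y.
apply: le_trans (lip x y) _.
have : `|x - y| <= e / (K + 1).
  near: y; apply: cvgr_dist_le; first exact: cvg_id.
  by rewrite divr_gt0// ltr_wpDl.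
rewrite ler_pdivlMr ?ltr_wpDl// => /(le_trans _); apply.
by rewrite mulrC ler_wpM2l// lerDl.
Unshelve. all: by end_near. Qed.

(** The transform is even Lipschitz: on the support of a, contained in a cube of
    half-side M, the phase x.xi varies by at most n M |xi - eta|. *)
Lemma continuous_trig_transform (a : 'rV[R]_n -> R) (h : R -> R) : cc a ->
  continuous h -> (forall s, `|h s| <= 1) -> (forall s t, `|h s - h t| <= `|s - t|) ->
  continuous (fun xi : 'rV[R]_n => \int[mu]_x (a x * h (dotp x xi))).
Proof.
move=> cca ch h1 hl; have ia := cc_L1 cca; have [M aM] := cca.2.
have mdot (xi : 'rV[R]_n) : measurable_fun setT (fun x => dotp x xi : R).
  exact: measurable_dotp.
have mh (xi : 'rV[R]_n) : measurable_fun setT (fun x => h (dotp x xi)).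
  exact: (measurableT_comp (continuous_measurable_fun ch) (mdot xi)).
have ih (xi : 'rV[R]_n) : L1 (fun x => a x * h (dotp x xi)).
  by apply: (bounded_mul_integrable (C := 1)).
pose K := n%:R * `|M| * \int[mu]_x `|a x|.
have lip (xi eta : 'rV[R]_n) : `|\int[mu]_x (a x * h (dotp x xi)) -
    \int[mu]_x (a x * h (dotp x eta))| <= K * `|xi - eta|.
  have mC := @measurable_cube R n M.
  rewrite -RintegralB//.
  have -> : \int[mu]_x (a x * h (dotp x xi) - a x * h (dotp x eta)) =
      \int[mu]_x (a x * (\1_(cube M) x * (h (dotp x xi) - h (dotp x eta)))).
    apply: eq_Rintegral => x _; rewrite indicE.
    have [cx|ncx] := pselect (cube M x); first by rewrite mem_set// mul1r mulrBr.
    by rewrite aM// !mul0r subrr.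
  rewrite /K mulrAC; apply: norm_RintegralM_le => //.
    apply: measurable_funM; first exact: measurable_indic.
    exact: measurable_funB.
  move=> x; rewrite indicE.
  have [cx|ncx] := pselect (cube M x); last first.
    by rewrite memNset// mul0r normr0 !mulr_ge0.
  rewrite mem_set// mul1r (le_trans (hl _ _))//.
  rewrite !(dotpC x) -dotpBl /dotp (le_trans (ler_norm_sum _ _ _))//.
  apply: (@le_trans _ _ (\sum_(i < n) (`|M| * `|xi - eta|))); last first.
    by rewrite sumr_const card_ord -mulrA mulr_natl.
  apply: ler_sum => i _; rewrite normrM mulrC ler_pM//.
    by rewrite (le_trans (cx i))// ler_norm.
  exact: coord_le_norm.
have K0 : 0 <= K by rewrite !mulr_ge0// Rintegral_ge0.
exact: lipschitz_continuous lip.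
Qed.

Lemma continuous_cosT (a : 'rV[R]_n -> R) : cc a -> continuous (cosT a).
Proof.
move=> cca; apply: continuous_trig_transform => //.
- exact: continuous_cos.
- exact: cos_max.
- exact: cos_lipschitz.
Qed.

Lemma continuous_sinT (a : 'rV[R]_n -> R) : cc a -> continuous (sinT a).
Proof.
move=> cca; apply: continuous_trig_transform => //.
- exact: continuous_sin.
- exact: sin_max.
- exact: sin_lipschitz.
Qed.

End test_functions.

(** * Poincare's inequality on the Fourier side *)

Section poincare.
Variables (R : realType) (n : nat).
Local Notation mu := (@lebR R n).
Local Notation kappa := ((2 * @pi R) ^+ n).
Local Open Scope complex_scope.
Implicit Types (f g u v phi : 'rV[R]_n -> R[i]) (Omega : set 'rV[R]_n).

Lemma closure_out phi x : ~ closure [set y | phi y != 0] x ->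
  \forall y \near x, phi y = 0.
Proof.
move=> ncl; have oc : open (~` closure [set y | phi y != 0]).
  by apply: closed_openC; exact: closed_closure.
have : nbhs x (~` closure [set y | phi y != 0]) by exact: open_nbhs_nbhs.
apply: filterS => y /= ny; apply/eqP/negP => /negP py.
by apply: ny; apply: subset_closure.
Qed.

Lemma partial_out (a : 'rV[R]_n -> R) x j : (\forall y \near x, a y = 0) ->
  partial j a x = 0.
Proof.
move=> a0; rewrite /partial (near_eq_derive (g := fun=> 0))//.
by rewrite derive_cst.
Qed.

Lemma test_function_cube Omega phi : test_function Omega phi ->
  exists M, forall x, ~ cube M x -> \forall y \near x, phi y = 0.
Proof.
move=> [_ _ /compact_bounded[B [_ clB]] _]; exists (`|B| + 1) => x nc.
apply: closure_out => clx; apply: nc => i.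
apply: le_trans (coord_le_norm x i) _.
by apply: clB clx; rewrite (le_lt_trans (ler_norm B))// ltrDl.
Qed.

Lemma test_function_C1c Omega phi : test_function Omega phi ->
  C1c (fun x => cRe (phi x)) /\ C1c (fun x => cIm (phi x)).
Proof.
move=> tphi; have [M phi0] := test_function_cube tphi.
have [sRe sIm _ _] := tphi.
have C1 (a : 'rV[R]_n -> R) : smooth a ->
    (forall x, ~ cube M x -> \forall y \near x, a y = 0) -> C1c a.
  move=> sa a0; have [ca da] := sa 1%N.
  split.
    by split => //; exists M => x /a0 /nbhs_singleton.
  move=> j; have [dj cj] := da j; split => //; split; first exact: cj.
  by exists M => x /a0; exact: partial_out.
by split; apply: C1 => // x /phi0; apply: filterS => y ->.
Qed.

Lemma test_function_ccc Omega phi : test_function Omega phi -> ccc phi.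
Proof. by move=> /test_function_C1c[[? _] [? _]]. Qed.

Definition cpartial phi (j : 'I_n) : 'rV[R]_n -> R[i] := fun x =>
  partial j (fun y => cRe (phi y)) x +i* partial j (fun y => cIm (phi y)) x.

Lemma cpartial_ccc Omega phi j : test_function Omega phi -> ccc (cpartial phi j).
Proof. by move=> /test_function_C1c[[_ /(_ j)[_ ?]] [_ /(_ j)[_ ?]]]. Qed.

Let hN1 : (-1 : R) = 1 \/ (-1 : R) = -1. Proof. by right. Qed.

(** Integration by parts: the transform of the j-th partial derivative is the
    transform multiplied by i xi_j. *)
Lemma nsq_fourier_partial Omega phi j xi : test_function Omega phi ->
  nsq (fourier_integral (cpartial phi j) xi) =
  xi ord0 j ^+ 2 * nsq (fourier_integral phi xi).
Proof.
move=> tphi; have [C1r C1i] := test_function_C1c tphi.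
have [ir ii] := (cLfun1P _).1 (ccc_cLfun1 (test_function_ccc tphi)).
have [jr ji] := (cLfun1P _).1 (ccc_cLfun1 (cpartial_ccc j tphi)).
rewrite !fourier_integralE /nsq.
have [-> ->] := oftE hN1 xi ir ii; have [-> ->] := oftE hN1 xi jr ji.
by rewrite /= !cosT_partial// !sinT_partial//; ring.
Qed.

Lemma enorm_sqr (x : 'rV[R]_n) : enorm x ^+ 2 = \sum_(i < n) x ord0 i ^+ 2.
Proof.
have -> : \sum_(i < n) x ord0 i ^+ 2 = dotp x x by [].
by rewrite sqr_sqrtr//; apply: sumr_ge0 => i _; rewrite -expr2 sqr_ge0.
Qed.

Lemma enorm_ge0 (x : 'rV[R]_n) : 0 <= enorm x.
Proof. exact: sqrtr_ge0. Qed.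

Lemma measurable_enorm : measurable_fun setT (@enorm R n).
Proof.
apply: measurableT_comp; last exact: measurable_dotp.
by apply: continuous_measurable_fun; exact: sqrt_continuous.
Qed.

(** Multiplication by |xi|^r, that is, (- Delta)^(r/2) on the Fourier side. *)
Definition riesz (r : R) f : 'rV[R]_n -> R[i] := fun xi => (enorm xi `^ r)%:C * f xi.

Lemma cmeas_riesz r f : cmeas f -> cmeas (riesz r f).
Proof.
move=> mf; apply: cmeasZ => //.
exact: (measurableT_comp (measurable_powR _) measurable_enorm).
Qed.

Lemma energy_riesz1 f : cmeas f -> energy (riesz 1 f) =
  (\sum_(j < n) \int[mu]_xi (xi ord0 j ^+ 2 * nsq (f xi))%:E)%E.
Proof.
move=> mf; rewrite -ge0_integral_sum//; last 2 first.
- move=> j; apply/measurable_EFinP; apply: measurable_funM.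
    by apply: measurable_funX; exact: measurable_coord.
  exact: measurable_nsq.
- by move=> j x _; rewrite lee_fin mulr_ge0 ?sqr_ge0 ?nsq_ge0.
apply: eq_integral => xi _; rewrite sumEFin -mulr_suml -enorm_sqr nsqZ.
by rewrite powRr1// enorm_ge0.
Qed.

(** A test function and its gradient vanish outside Omega, so the norms over
    Omega in the definition of the Poincare constant are norms over R^n. *)
Lemma poincare_energy Omega C phi : poincare_constant Omega C ->
  test_function Omega phi ->
  (energy phi <= (C ^+ 2)%:E * \sum_(j < n) energy (cpartial phi j))%E.
Proof.
move=> [C0 poinc] tphi; have := poinc _ tphi.
have [_ _ _ clO] := tphi.
have patchE (D := Omega) (h : 'rV[R]_n -> R) :
    (forall x, ~ closure [set y | phi y != 0] x -> h x = 0) -> h \_ D = h.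
  move=> h0; apply/funext => x; rewrite patchE; case: ifPn => //.
  by rewrite notin_setE => nO; rewrite h0// => /clO.
rewrite /L2norm_on !patchE; last 2 first.
- move=> x /closure_out p0; rewrite /grad_norm big1 ?sqrtr0// => i _.
  rewrite !partial_out ?expr0n ?addr0//; apply: filterS p0 => y -> //.
- by move=> x /closure_out/nbhs_singleton ->; rewrite normc0.
pose g x : R[i] := (grad_norm phi x)%:C.
have -> : ('N[lebesgue_rV R n]_2%:E[EFin \o grad_norm phi] = L2norm g)%E.
  rewrite /L2norm; congr Lnorm; apply/funext => x /=.
  by rewrite expr0n/= addr0 sqrtr_sqr ger0_norm// sqrtr_ge0.
move=> /(L2norm_leP _ _ (ltW C0)); rewrite -/(energy phi).
suff -> : energy g = (\sum_(j < n) energy (cpartial phi j))%E by [].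
rewrite /energy -ge0_integral_sum//.
- apply: eq_integral => x _; rewrite sumEFin; congr EFin.
  rewrite /nsq /g/= expr0n/= addr0 sqr_sqrtr//.
  by apply: sumr_ge0 => j _; rewrite addr_ge0 ?sqr_ge0.
- move=> j; apply/measurable_EFinP.
  exact: (measurable_nsq (cLfun2_cmeas (ccc_cLfun2 (cpartial_ccc j tphi)))).
- by move=> j x _; rewrite lee_fin nsq_ge0.
Qed.

(** Plancherel's theorem turns Poincare's inequality into a weighted inequality
    for the transform: the upper bound is used for phi and the lower bound for
    its partial derivatives. *)
Lemma poincare_fourier Omega C phi : poincare_constant Omega C ->
  test_function Omega phi ->
  (L2norm (fourier_integral phi) <=
   C%:E * L2norm (riesz 1 (fourier_integral phi)))%E.
Proof.
move=> pC tphi; have [C0 _] := pC; have cphi := test_function_ccc tphi.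
have p1 := ccc_cLfun1 cphi; have p2 := ccc_cLfun2 cphi.
apply/L2norm_leP; first exact: ltW.
have C2 : (0 <= (C ^+ 2)%:E)%E by rewrite lee_fin sqr_ge0.
apply: (@le_trans _ _ (kappa%:E * energy phi)%E).
  by rewrite fourier_integralE; exact: plancherel_le.
apply: (@le_trans _ _ (kappa%:E *
    ((C ^+ 2)%:E * \sum_(j < n) energy (cpartial phi j)))%E).
  by rewrite lee_wpmul2l ?lee_fin ?kappa_ge0//; exact: poincare_energy pC tphi.
rewrite muleCA lee_wpmul2l// energy_riesz1; last exact: cmeas_fourier_integral.
rewrite ge0_sume_distrr; last by move=> j _; exact: energy_ge0.
apply: lee_sum => j _.
apply: le_trans (energy_oft_ge hN1 (cpartial_ccc j tphi)) _.
rewrite -fourier_integralE.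
by rewrite /energy; under eq_integral do rewrite (nsq_fourier_partial _ _ tphi).
Qed.

End poincare.

(** * Interpolation by convexity *)

Section power_inequalities.
Variable R : realType.
Implicit Types x y z p q s t : R.

(** Bernoulli's inequality: a concave power lies below its tangent at 1. *)
Lemma powR_le_affine z q : 0 <= z -> 0 <= q -> q <= 1 -> z `^ q <= 1 + q * (z - 1).
Proof.
move=> z0 q0 q1; have [zE|zN0] := eqVneq z 0.
  rewrite zE; have [->|qN0] := eqVneq q 0; first by rewrite powRr0 mul0r addr0.
  by rewrite powR0// sub0r mulrN1 subr_ge0.
have {zN0}z0 : 0 < z by rewrite lt_neqAle eq_sym zN0.
set l := ln z; have zE : z = expR l by rewrite lnK.
have -> : z `^ q = expR (q * l) by rewrite /powR gt_eqF.
have w0 := expR_gt0 (q * l); set w := expR (q * l) in w0 *.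
(* exp x >= 1 + x at two points; in the combination with weights q and 1 - q the
   terms in l cancel. *)
have h1 : 1 + (1 - q) * l <= z / w.
  by rewrite zE /w -expRB (_ : l - q * l = (1 - q) * l) ?expR_ge1Dx//; ring.
have h2 : 1 - q * l <= w^-1 by rewrite /w -expRN expR_ge1Dx.
have : 1 <= (q * z + (1 - q)) / w.
  have -> : (q * z + (1 - q)) / w = q * (z / w) + (1 - q) * w^-1 by ring.
  have q1' : 0 <= 1 - q by rewrite subr_ge0.
  have := ler_wpM2l q0 h1; have := ler_wpM2l q1' h2; nra.
by rewrite ler_pdivlMr// mul1r => /le_trans; apply; rewrite le_eqVlt; apply/orP;
  left; apply/eqP; ring.
Qed.

Lemma powR_ge_affine y p : 0 <= y -> 1 <= p -> 1 + p * (y - 1) <= y `^ p.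
Proof.
move=> y0 p1; have p0 : 0 < p by rewrite (lt_le_trans ltr01).
have := @powR_le_affine (y `^ p) p^-1 (powR_ge0 _ _).
rewrite -powRrM mulfV ?gt_eqF// powRr1// invr_ge0 (ltW p0) invf_le1// => /(_ isT p1).
rewrite -lerBlDl ler_pdivlMl// => h; lra.
Qed.

(** Rewritten as x^s - x^t >= (s - t) (x - 1), this is Bernoulli's inequality
    for both powers if t <= 1; if t > 1, apply it to x^s = (x^t)^(s/t) and then
    to x^t. *)
Lemma powR_tangent x s t : 0 <= x -> 1 <= s -> 0 <= t -> t <= s ->
  x `^ t + (s - t) * x <= x `^ s + (s - t).
Proof.
move=> x0 s1 t0 ts; have [t1|t1] := leP t 1.
  have := powR_le_affine x0 t0 t1; have := powR_ge_affine x0 s1; lra.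
have tgt0 : 0 < t by rewrite (lt_trans ltr01).
have h1 := powR_ge_affine x0 (ltW t1).
have p1 : 1 <= s / t by rewrite ler_pdivlMr// mul1r.
have := powR_ge_affine (powR_ge0 x t) p1.
rewrite -powRrM (_ : t * (s / t) = s); last by field; rewrite gt_eqF.
move=> h2; have pt : (s / t - 1) * t = s - t by field; rewrite gt_eqF.
have p0 : 0 <= s / t - 1 by rewrite subr_ge0.
have := ler_wpM2l p0 h1.
have -> : (s / t - 1) * (1 + t * (x - 1)) = (s / t - 1) + (s - t) * (x - 1).
  by rewrite -pt; ring.
lra.
Qed.

End power_inequalities.

Lemma lee_cancel_combination (R : realType) (a b k d : R) (et e1 es e0 : \bar R) :
  0 <= d -> e1 \is a fin_num -> (e0 <= k%:E * e1)%E ->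
  (a%:E * et + (d * k)%:E * e1 <= b%:E * es + d%:E * e0)%E ->
  (a%:E * et <= b%:E * es)%E.
Proof.
move=> d0 fin1 e01 main.
rewrite -(@leeD2rE _ ((d * k)%:E * e1)%E) ?fin_numM//.
apply: le_trans main _; rewrite leeD2l// EFinM -muleA.
by rewrite lee_wpmul2l// lee_fin.
Qed.

Lemma lee_cancel_factor (R : realType) (a c : R) (x y : \bar R) : 0 < a ->
  (a%:E * x <= (a * c)%:E * y)%E -> (x <= c%:E * y)%E.
Proof. by move=> a0; rewrite EFinM -muleA lee_pmul2l. Qed.

Section interpolation.
Variables (R : realType) (n : nat).
Local Notation mu := (@lebR R n).
Local Open Scope complex_scope.
Implicit Types (f g h k l u U : 'rV[R]_n -> R[i]).

Lemma energy_combination (a b : R) f g : 0 <= a -> 0 <= b -> cmeas f -> cmeas g ->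
  (a%:E * energy f + b%:E * energy g =
   \int[mu]_x (a * nsq (f x) + b * nsq (g x))%:E)%E.
Proof.
move=> a0 b0 mf mg.
have mE h : cmeas h -> measurable_fun setT (fun x => (nsq (h x))%:E).
  by move=> mh; apply/measurable_EFinP; exact: measurable_nsq.
have scale (c : R) h : 0 <= c -> cmeas h ->
    (c%:E * energy h = \int[mu]_x (c * nsq (h x))%:E)%E.
  move=> c0 mh; rewrite /energy -ge0_integralZl//; first exact: mE.
  by move=> x _; rewrite lee_fin nsq_ge0.
rewrite !scale// -ge0_integralD//.
- by move=> x _; rewrite lee_fin mulr_ge0// nsq_ge0.
- by apply/measurable_EFinP; apply: measurable_funM => //; exact: measurable_nsq.
- by move=> x _; rewrite lee_fin mulr_ge0// nsq_ge0.
- by apply/measurable_EFinP; apply: measurable_funM => //; exact: measurable_nsq.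
Qed.

Lemma energy_combination_le (a b c d : R) f g h k :
  0 <= a -> 0 <= b -> 0 <= c -> 0 <= d -> cmeas f -> cmeas g -> cmeas h -> cmeas k ->
  (forall x, a * nsq (f x) + b * nsq (g x) <= c * nsq (h x) + d * nsq (k x)) ->
  (a%:E * energy f + b%:E * energy g <= c%:E * energy h + d%:E * energy k)%E.
Proof.
move=> a0 b0 c0 d0 mf mg mh mk le_x.
rewrite (energy_combination a0 b0 mf mg) (energy_combination c0 d0 mh mk).
have mM l (r : R) : cmeas l -> measurable_fun setT (fun x => r * nsq (l x)).
  by move=> ml; apply: measurable_funM => //; exact: measurable_nsq.
apply: ge0_le_integral => //.
- by move=> x _; rewrite lee_fin addr_ge0// mulr_ge0// nsq_ge0.
- by apply/measurable_EFinP; apply: measurable_funD; exact: mM.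
- by apply/measurable_EFinP; apply: measurable_funD; exact: mM.
- by move=> x _; rewrite lee_fin.
Qed.

(** Integrate the pointwise inequality at (C |xi|)^2 against |U|^2. The terms of
    orders 1 and 0 carry the weights (s - t) C^2 and s - t, and the hypothesis
    compares them, so they can be cancelled. *)
Lemma riesz_interpolation U (C s t : R) : 0 < C -> 1 <= s -> 0 <= t -> t <= s ->
  cmeas U -> (energy (riesz 1 U) < +oo)%E ->
  (energy U <= (C ^+ 2)%:E * energy (riesz 1 U))%E ->
  (energy (riesz t U) <= ((C `^ (s - t)) ^+ 2)%:E * energy (riesz s U))%E.
Proof.
move=> C0 s1 t0 ts mU fin1 poin.
have mr r : cmeas (riesz r U) by exact: cmeas_riesz.
have nE r : (0 <= energy (riesz r U))%E by exact: energy_ge0.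
have st0 : 0 <= s - t by rewrite subr_ge0.
have Ct0 r : 0 <= (C `^ r) ^+ 2 by exact: sqr_ge0.
have ptw x : (C `^ t) ^+ 2 * nsq (riesz t U x) + (s - t) * C ^+ 2 * nsq (riesz 1 U x)
    <= (C `^ s) ^+ 2 * nsq (riesz s U x) + (s - t) * nsq (U x).
  rewrite !nsqZ powRr1 ?enorm_ge0//.
  set r := enorm x; have r0 : 0 <= r := enorm_ge0 x.
  have XE q : ((C * r) ^+ 2) `^ q = (C `^ q) ^+ 2 * (r `^ q) ^+ 2.
    have sq (y : R) : 0 <= y -> (y ^+ 2) `^ q = (y `^ q) ^+ 2.
      move=> y0; rewrite -[in LHS]powR_mulrn// -powRrM mulrC powRrM.
      by rewrite powR_mulrn ?powR_ge0.
    by rewrite exprMn powRM ?sqr_ge0// !sq// ltW.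
  have := powR_tangent (sqr_ge0 (C * r)) s1 t0 ts.
  rewrite !XE => /(ler_wpM2r (nsq_ge0 (U x))).
  by rewrite !mulrDl exprMn !mulrA.
have k0 : 0 <= (s - t) * C ^+ 2 by rewrite mulr_ge0 ?sqr_ge0.
have := energy_combination_le (Ct0 t) k0 (Ct0 s) st0 (mr t) (mr 1) (mr s) mU ptw.
have fin1' : energy (riesz 1 U) \is a fin_num by rewrite ge0_fin_numE.
move=> /(lee_cancel_combination st0 fin1' poin) main.
have Ct : 0 < (C `^ t) ^+ 2 by rewrite exprn_gt0// powR_gt0.
apply: (lee_cancel_factor Ct); move: main.
rewrite -exprMn -powRD ?subrKC//.
by apply/implyP => _; rewrite gt_eqF.
Qed.

End interpolation.

(** * Density and the theorem *)

Section density.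
Variables (R : realType) (n : nat).
Local Notation mu := (@lebR R n).
Local Open Scope complex_scope.
Implicit Types (f g u v phi : 'rV[R]_n -> R[i]) (Omega : set 'rV[R]_n).

Lemma continuous_norm_powR (s : R) : 1 <= s -> continuous (fun x : R => `|x| `^ s).
Proof.
move=> s1 x; have s0 : 0 < s by rewrite (lt_le_trans ltr01).
have [->|x0] := eqVneq x 0.
  apply/cvgrPdist_le => /= e e0; rewrite normr0 powR0 ?gt_eqF//.
  near=> y.
  rewrite sub0r normrN ger0_norm ?powR_ge0//.
  have y1 : `|y| <= Num.min 1 e.
    rewrite -[y]subr0 distrC; near: y; apply: cvgr_dist_le; first exact: cvg_id.
    by rewrite lt_min ltr01.
  move: y1; rewrite le_min => /andP[y1 ye]; apply: le_trans ye.
  have [->|y0] := eqVneq `|y| 0; first by rewrite powR0 ?gt_eqF.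
  have y0' : 0 < `|y| by rewrite lt_neqAle eq_sym y0/=.
  by rewrite -[leRHS]powRr1// ger_powR// y0' y1.
have nx : 0 < `|x| by rewrite normr_gt0.
have cl : expR (s * ln `|y|) @[y --> x] --> expR (s * ln `|x|).
  apply: continuous_comp; last exact: continuous_expR.
  apply: cvgM; first exact: cvg_cst.
  apply: continuous_comp; first exact: norm_continuous.
  exact: continuous_ln.
have xE : `|x| `^ s = expR (s * ln `|x|) by rewrite /powR gt_eqF.
rewrite /continuous_at xE; apply: cvg_trans cl; apply: near_eq_cvg; near=> y.
rewrite /powR ifF//; apply/negbTE; rewrite normr_eq0.
near: y; exact: cvgr_neq0 (@cvg_id _ _) x0.
Unshelve. all: by end_near. Qed.

Lemma continuous_enorm : continuous (@enorm R n).
Proof.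
move=> x; apply: continuous_comp; last exact: sqrt_continuous.
apply: (@continuous_big _ _ _ _ _ add_continuous) => i _ y.
by apply: (cvgM (@coord_continuous _ _ _ _ _ y) (@coord_continuous _ _ _ _ _ y)).
Qed.

Lemma continuous_enorm_powR (s : R) : 1 <= s ->
  continuous (fun x : 'rV[R]_n => enorm x `^ s).
Proof.
move=> s1 x; rewrite (_ : (fun y => _) = (fun t : R => `|t| `^ s) \o @enorm R n).
  apply: continuous_comp; first exact: continuous_enorm.
  exact: continuous_norm_powR.
by apply/funext => y /=; rewrite ger0_norm// enorm_ge0.
Qed.

(** A continuous function that is 1 on the ball of radius k and 0 outside the
    ball of radius k + 1 of the supremum norm. *)
Definition cutoff (k : nat) (x : 'rV[R]_n) : R :=
  Num.min 1 (Num.max 0 (k.+1%:R - `|x|)).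

Lemma cutoff_ge0 k x : 0 <= cutoff k x.
Proof. by rewrite le_min ler01 le_max lexx. Qed.

Lemma cutoff_le1 k x : cutoff k x <= 1.
Proof. by rewrite ge_min lexx. Qed.

Lemma continuous_cutoff k : continuous (cutoff k).
Proof.
move=> x; have cd : {for x, continuous (fun y : 'rV[R]_n => k.+1%:R - `|y| : R)}.
  exact: (cvgB (cvg_cst _) (@norm_continuous _ _ x)).
have c0 (c : R) : {for x, continuous (fun _ : 'rV[R]_n => c)}.
  exact: (@cst_continuous _ _ c x).
exact: continuous_min (c0 1) (continuous_max (c0 0) cd).
Qed.

Lemma cc_cutoff k : cc (cutoff k).
Proof.
split; first exact: continuous_cutoff.
exists k.+1%:R => x nc; apply/eqP; rewrite eq_le cutoff_ge0 andbT.
rewrite ge_min ge_max lexx/= subr_le0; apply/orP; right.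
apply: contrapT => /negP; rewrite -ltNge => xk; apply: nc => i.
by rewrite (le_trans (coord_le_norm x i))// ltW.
Qed.

Lemma cvg_cutoff (x : 'rV[R]_n) : cutoff k x @[k --> \oo] --> (1 : R).
Proof.
apply: cvg_near_cst; near=> k; apply/eqP; rewrite eq_le cutoff_le1/=.
rewrite le_min lexx/= le_max; apply/orP; right.
rewrite -natr1 addrAC lerDr subr_ge0.
near: k; exact: nbhs_infty_ger.
Unshelve. all: by end_near. Qed.

(** Dominated convergence, with |g|^2 as the dominating function. *)
Lemma cutoff_approx g (d : R) : 0 < d -> cLfun 2 g ->
  continuous (fun x => cRe (g x)) -> continuous (fun x => cIm (g x)) ->
  exists2 f, ccc f & (L2norm (fun x => f x - g x)%R <= d%:E)%E.
Proof.
move=> d0 /cLfun2P[mg gfin] cr ci.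
pose f k x := (cutoff k x)%:C * g x.
have cf k : ccc (f k).
  split; rewrite /f.
    under [X in cc X]eq_fun do rewrite cReZ mulrC.
    by apply: ccM => //; exact: cc_cutoff.
  under [X in cc X]eq_fun do rewrite cImZ mulrC.
  by apply: ccM => //; exact: cc_cutoff.
have nE k x : nsq (f k x - g x) = (1 - cutoff k x) ^+ 2 * nsq (g x).
  by rewrite /nsq cReB cImB /f cReZ cImZ; ring.
have ig : mu.-integrable setT (EFin \o (fun x => nsq (g x))).
  apply/integrableP; split; first by apply/measurable_EFinP; exact: measurable_nsq.
  by under eq_integral do rewrite gee0_abs ?lee_fin ?nsq_ge0//.
have mc k : measurable_fun setT (cutoff k) by exact: cc_measurable (cc_cutoff k).
have mf k : cmeas (fun x => f k x - g x).
  by apply: cmeasB => //; exact: cmeasZ.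
have le1 k x : (1 - cutoff k x) ^+ 2 <= 1.
  rewrite expr_le1 ?subr_ge0 ?cutoff_le1//.
  by rewrite lerBlDr lerDl cutoff_ge0.
have cv0 : \int[mu]_x nsq (f k x - g x) @[k --> \oo] --> \int[mu]_x (0 : R).
  apply: (Rintegral_dct _ _ ig).
  - by move=> k; exact: measurable_nsq.
  - move=> x; under eq_fun do rewrite nE expr2.
    have c1 : 1 - cutoff k x @[k --> \oo] --> (1 - 1 : R).
      by apply: cvgB; [exact: cvg_cst|exact: cvg_cutoff].
    have := cvgM (cvgM c1 c1) (cvg_cst (nsq (g x))).
    by rewrite subrr !mul0r; exact.
  - move=> k x; rewrite ger0_norm ?nsq_ge0// nE ler_piMl ?nsq_ge0 ?le1//.
rewrite /Rintegral integral0/= in cv0.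
have /cvgr0Pnorm_le/(_ (d ^+ 2)) := cv0; rewrite exprn_gt0// => /(_ isT).
move=> [N _ /(_ N (leqnn N))] /= le_d; exists (f N); first exact: cf.
apply/L2norm_le_num; first exact: ltW.
rewrite /energy -[leLHS]fineK; first by rewrite lee_fin (le_trans (ler_norm _)).
apply: integrable_fin_num => //; apply: le_integrable ig => //.
  by apply/measurable_EFinP; exact: measurable_nsq.
move=> x _; rewrite /= lee_fin !ger0_norm ?nsq_ge0// nE ler_piMl ?nsq_ge0 ?le1//.
Qed.

(** The weight is possibly unbounded, so this does not follow from an estimate:
    f vanishes almost everywhere. *)
Lemma energy0_weight (w : 'rV[R]_n -> R) f : measurable_fun setT w -> cmeas f ->
  energy f = 0%E -> energy (fun x => (w x)%:C * f x) = 0%E.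
Proof.
move=> mw mf f0; have mnf := measurable_nsq mf.
have mE : measurable_fun setT (fun x => (nsq (f x))%:E) by exact/measurable_EFinP.
have : (\int[mu]_x `|(nsq (f x))%:E| = 0)%E.
  by rewrite -f0; apply: eq_integral => x _; rewrite gee0_abs ?lee_fin ?nsq_ge0.
move/(ae_eq_integral_abs mu measurableT mE) => ae0.
have mwf : measurable_fun setT (fun x => (nsq ((w x)%:C * f x))%:E).
  by apply/measurable_EFinP; apply: measurable_nsq; exact: cmeasZ.
rewrite /energy (ae_eq_integral (fun=> 0%E))// ?integral0//.
apply: filterS ae0 => x /= /(_ I)[nf0] _.
by rewrite nsqZ nf0 mulr0.
Qed.

Lemma L2norm_eq0 f : L2norm f = 0%E <-> energy f = 0%E.
Proof.
split => f0; first by rewrite energyE f0 poweR0r.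
by rewrite L2normE f0 poweR0r.
Qed.

Lemma measurable_enorm_powR (r : R) :
  measurable_fun setT (fun x : 'rV[R]_n => enorm x `^ r).
Proof. exact: (measurableT_comp (measurable_powR _) (@measurable_enorm R n)). Qed.

Lemma enorm_powR_le (r s : R) (x : 'rV[R]_n) : 0 <= r -> r <= s ->
  enorm x `^ r <= (1 + enorm x ^+ 2) `^ (s / 2).
Proof.
move=> r0 rs; have e0 := enorm_ge0 x.
have b1 : 1 <= 1 + enorm x ^+ 2 by rewrite lerDl sqr_ge0.
apply: (@le_trans _ _ ((1 + enorm x ^+ 2) `^ (r / 2))); last first.
  by rewrite ler_powR// ler_pM2r.
have -> : enorm x `^ r = (enorm x ^+ 2) `^ (r / 2).
  by rewrite -powR_mulrn// -powRrM mulrC divfK.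
rewrite ge0_ler_powR ?nnegrE ?sqr_ge0 ?divr_ge0//; last by rewrite lerDr.
by rewrite addr_ge0 ?sqr_ge0.
Qed.

Definition bessel (s : R) f : 'rV[R]_n -> R[i] := fun xi =>
  ((1 + enorm xi ^+ 2) `^ (s / 2))%:C * f xi.

Lemma cmeas_bessel s f : cmeas f -> cmeas (bessel s f).
Proof.
move=> mf; apply: cmeasZ => //; apply: (measurableT_comp (measurable_powR _)).
by apply: measurable_funD => //; apply: measurable_funX; exact: measurable_enorm.
Qed.

Lemma riesz_le_bessel (r s : R) f : cmeas f -> 0 <= r -> r <= s ->
  (L2norm (riesz r f) <= L2norm (bessel s f))%E.
Proof.
move=> mf r0 rs; apply: L2norm_le; [exact: cmeas_riesz|exact: cmeas_bessel|].
move=> x; rewrite !nsqZ ler_wpM2r ?nsq_ge0//.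
by rewrite ler_pXn2r// ?nnegrE ?powR_ge0// enorm_powR_le.
Qed.

Lemma riesz0 f : riesz 0 f = f.
Proof. by apply/funext => x; rewrite /riesz powRr0 mul1r. Qed.

Lemma rieszB r f g : riesz r (fun x => f x - g x) = fun x => riesz r f x - riesz r g x.
Proof. by apply/funext => x; rewrite /riesz mulrBr. Qed.

(** The Bessel weight dominates |xi|^r for all r between 0 and s, so one test
    function is good for all these orders. *)
Lemma riesz_fourier_approx s Omega u (d : R) :
  (exists v, L2_extension (@fourier_integral R n) u v) ->
  sobolev_tilde s Omega u -> 0 < d ->
  exists2 phi, test_function Omega phi & forall r, 0 <= r -> r <= s ->
    (L2norm (riesz r (fun x => fourier u x - fourier_integral phi x)%R) <= d%:E)%E.
Proof.
move=> uext [_ approx] d0; have [phi tphi le_d] := approx d d0.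
exists phi => // r r0 rs.
have cphi := test_function_ccc tphi.
have [D0 D2] := fourierB_test cphi uext.
have [_ v2 _] := fourierP uext.
set D' := fourier (fun y => u y - phi y) in D0 D2.
have mD' := cLfun2_cmeas D2.
have mD : cmeas (fun x => fourier u x - fourier_integral phi x).
  apply: cmeasB; first exact: cLfun2_cmeas.
  by apply: cmeas_fourier_integral; exact: ccc_cLfun1.
set D := (fun x => _ - _) in mD *.
have mDD : cmeas (fun x => D' x - D x) by exact: cmeasB.
have z0 : L2norm (riesz r (fun x => D' x - D x)) = 0%E.
  apply/L2norm_eq0; apply: energy0_weight => //; first exact: measurable_enorm_powR.
  exact/L2norm_eq0.
apply: le_trans (L2norm_le_sub (cmeas_riesz r mD) (cmeas_riesz r mD')) _.
rewrite L2norm_sub_sym -rieszB z0 adde0.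
exact: le_trans (riesz_le_bessel mD' r0 rs) (ltW le_d).
Qed.

(** The inequality for test functions passes to the limit, the two approximation
    errors being those of orders 0 and 1. *)
Lemma poincare_sobolev s Omega C u : 1 <= s -> poincare_constant Omega C ->
  (exists v, L2_extension (@fourier_integral R n) u v) ->
  sobolev_tilde s Omega u ->
  (L2norm (fourier u) <= C%:E * L2norm (riesz 1 (fourier u)))%E.
Proof.
move=> s1 pC uext hu; have [C0 _] := pC.
have [_ v2 _] := fourierP uext; have mv := cLfun2_cmeas v2.
apply/lee_addgt0Pr => e e0.
have d0 : 0 < e / (1 + C) by rewrite divr_gt0// addr_gt0.
have [phi tphi le_d] := riesz_fourier_approx uext hu d0.
set d := e / (1 + C) in d0 le_d.
have eE : e%:E = (C%:E * d%:E + d%:E)%E.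
  by rewrite -EFinM -EFinD; congr EFin; rewrite /d; field; rewrite gt_eqF// addr_gt0.
have mF := cmeas_fourier_integral (ccc_cLfun1 (test_function_ccc tphi)).
have s0 : 0 <= s by rewrite (le_trans ler01).
have := le_d 0 (lexx 0) s0; rewrite riesz0 => le_d0.
apply: le_trans (L2norm_le_sub mv mF) _.
rewrite eE addeA leeD//.
apply: le_trans (poincare_fourier pC tphi) _.
rewrite -ge0_muleDr ?L2norm_ge0 ?lee_fin ?(ltW d0)//.
rewrite lee_wpmul2l ?lee_fin ?(ltW C0)//.
apply: le_trans (L2norm_le_sub (cmeas_riesz 1 mF) (cmeas_riesz 1 mv)) _.
rewrite leeD2l// L2norm_sub_sym -rieszB.
exact: le_d 1 ler01 s1.
Qed.

Lemma riesz_cLfun2 r s Omega u :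
  (exists v, L2_extension (@fourier_integral R n) u v) ->
  sobolev_tilde s Omega u -> 0 <= r -> r <= s -> cLfun 2 (riesz r (fourier u)).
Proof.
move=> /fourierP[_ v2 _] [[_ /cLfun2_L2norm[_ bfin]] _] r0 rs.
have mv := cLfun2_cmeas v2.
apply/cLfun2_L2norm; split; first exact: cmeas_riesz.
exact: le_lt_trans (riesz_le_bessel mv r0 rs) bfin.
Qed.

(** The transform of a test function is continuous, hence so is its product with
    |xi|^s; a cutoff of this product is an approximation in C_c. *)
Lemma riesz_ccc_approx s Omega u (d : R) : 1 <= s ->
  (exists v, L2_extension (@fourier_integral R n) u v) ->
  sobolev_tilde s Omega u -> 0 < d ->
  exists2 f, ccc f & (L2norm (fun x => f x - riesz s (fourier u) x)%R <= d%:E)%E.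
Proof.
move=> s1 uext hu d0; have s0 : 0 <= s by rewrite (le_trans ler01).
have d2 : 0 < d / 2 by rewrite divr_gt0.
have [phi tphi /(_ s s0 (lexx s)) le_d] := riesz_fourier_approx uext hu d2.
have cphi := test_function_ccc tphi; have phi1 := ccc_cLfun1 cphi.
have mF := cmeas_fourier_integral phi1.
have h2 := riesz_cLfun2 uext hu s0 (lexx s).
have mh := cLfun2_cmeas h2.
have mg := cmeas_riesz s mF.
rewrite rieszB in le_d.
have g2 : cLfun 2 (riesz s (fourier_integral phi)).
  apply/cLfun2_L2norm; split => //.
  apply: le_lt_trans (L2norm_le_sub mg mh) _.
  apply: lte_add_pinfty; first by have /cLfun2_L2norm[] := h2.
  by rewrite L2norm_sub_sym; apply: le_lt_trans le_d _; rewrite ltry.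
have [ia ib] := (cLfun1P _).1 phi1.
have hN1 : (-1 : R) = 1 \/ (-1 : R) = -1 by right.
have cReF : continuous (fun xi => cRe (fourier_integral phi xi)).
  rewrite fourier_integralE.
  under [X in continuous X]eq_fun => xi do rewrite (oftE hN1 xi ia ib).1.
  by move=> xi; exact: (cvgB (continuous_cosT cphi.1 (x := xi))
    (cvgM (cvg_cst _) (continuous_sinT cphi.2 (x := xi)))).
have cImF : continuous (fun xi => cIm (fourier_integral phi xi)).
  rewrite fourier_integralE.
  under [X in continuous X]eq_fun => xi do rewrite (oftE hN1 xi ia ib).2.
  by move=> xi; exact: (cvgD (continuous_cosT cphi.2 (x := xi))
    (cvgM (cvg_cst _) (continuous_sinT cphi.1 (x := xi)))).
have [||f cf fg] := cutoff_approx d2 g2.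
- under [X in continuous X]eq_fun do rewrite cReZ.
  by move=> xi; exact: (cvgM (continuous_enorm_powR s1 (x := xi)) (cReF xi)).
- under [X in continuous X]eq_fun do rewrite cImZ.
  by move=> xi; exact: (cvgM (continuous_enorm_powR s1 (x := xi)) (cImF xi)).
exists f => //.
apply: le_trans (L2norm_triangleB (cLfun2_cmeas (ccc_cLfun2 cf)) mg mh) _.
rewrite (splitr d) EFinD leeD// L2norm_sub_sym.
exact: le_d.
Qed.

End density.

Theorem theorem3p17 (R : realType) (n : nat) (hn : (0 < n)%N) (s t : R)
    (hst : (1 <= t /\ t <= s) \/ (0 <= t /\ t <= 1 /\ 1 <= s))
    (Omega : set 'rV[R]_n) (hopen : open Omega) (hbdd : bounded_set Omega)
    (C : R) (hC : poincare_constant Omega C)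
    (u : 'rV[R]_n -> R[i]) (hu : sobolev_tilde s Omega u) :
  (L2norm (frac_laplacian (t / 2) u) <=
     (C `^ (s - t))%:E * L2norm (frac_laplacian (s / 2) u))%E.
Proof.
have [s1 t0 ts] : [/\ 1 <= s, 0 <= t & t <= s].
  case: hst => [[t1 ts]|[t0 [t1 s1]]].
    by split; [exact: le_trans ts|exact: le_trans t1|].
  by split=> //; exact: le_trans s1.
have [C0 _] := hC; have s0 : 0 <= s by exact: le_trans ts.
have fracE r : frac_laplacian (r / 2) u = inv_fourier (riesz r (fourier u)).
  by rewrite /frac_laplacian (_ : 2 * (r / 2) = r)//; field.
have Cst0 : (0 <= (C `^ (s - t))%:E)%E by rewrite lee_fin powR_ge0.
rewrite !fracE.
(* Outside the domain of the extension [fourier u] is 0, and with it the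
   left-hand side. *)
have [uext|nuext] := pselect
    (exists v, L2_extension (@fourier_integral R n) u v); last first.
  have -> : fourier u = fun=> 0%R.
    by rewrite /fourier xgetPN// => v uv; apply: nuext; exists v.
  have -> : riesz t (fun _ : 'rV[R]_n => 0%R) = fun=> 0%R.
    by apply/funext => x; rewrite /riesz mulr0.
  apply: le_trans (inv_fourier_le _) _.
  by rewrite L2norm0 mule0 mule_ge0// L2norm_ge0.
have [_ v2 _] := fourierP uext; have mv := cLfun2_cmeas v2.
have e1 : (energy (riesz 1 (fourier u)) < +oo)%E.
  by have /cLfun2P[] := riesz_cLfun2 uext hu ler01 s1.
have poin := poincare_sobolev s1 hC uext hu.
have h2 := riesz_cLfun2 uext hu s0 (lexx s).
have interp : (L2norm (riesz t (fourier u)) <=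
    (C `^ (s - t))%:E * L2norm (riesz s (fourier u)))%E.
  apply/L2norm_leP; first exact: powR_ge0.
  apply: riesz_interpolation => //.
  by apply/L2norm_leP => //; exact: ltW.
apply: le_trans (inv_fourier_le _) _.
(* The inverse transform multiplies both norms by the same constant c. *)
set c := (X in (X%:E * _ <= _)%E).
have c0 : (0 <= c%:E)%E by rewrite lee_fin ltW// inv_cst_gt0.
apply: (@le_trans _ _ (c%:E * ((C `^ (s - t))%:E * L2norm (riesz s (fourier u))))%E).
  by rewrite lee_wpmul2l.
rewrite muleCA lee_wpmul2l//.
by apply: inv_fourier_ge h2 _ => d d0; exact: riesz_ccc_approx s1 uext hu d0.
Qed.
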